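(* Let $(\mathcal{T},\mathcal{F},\mathcal{S})$ be a tree of fusion systems satisfying $(H)$ with distinguished vertex $v_*$, such that $\mathcal{F}(v)$ is saturated for every vertex $v$. Let $S:=\mathcal{S}(v_* )$ and let $\mathcal{F}_\mathcal{T}$ be the completion. Assume that for every $P\le S$: (a) if $P$ is $\mathcal{F}_\mathcal{T}$-conjugate to an $\mathcal{F}(v)$-essential subgroup for some vertex $v$, or $P=\mathcal{S}(v)$ for some vertex $v$, then $P$ is $\mathcal{F}_\mathcal{T}$-centric; (b) if $P$ is $\mathcal{F}_\mathcal{T}$-centric then $\operatorname{Rep}_{\mathcal{F}_\mathcal{T}}(P,\mathcal{F})$ is a tree. Then $\mathcal{F}_\mathcal{T}$ is a saturated fusion system on $S$.
   Context: Maps act on the right; $\alpha\circ\beta$ means first $\alpha$ then $\beta$. A fusion system on a finite $p$-group $S$ is a category of subgroups with $\operatorname{Hom}_S(P,Q)\subseteq\operatorname{Hom}_\mathcal{F}(P,Q)\subseteq\operatorname{Inj}(P,Q)$ and every morphism an isomorphism followed by an inclusion. A tree of fusion systems consists of a finite tree $\mathcal{T}$, finite $p$-groups $\mathcal{S}(v),\mathcal{S}(e)$, fusion systems $\mathcal{F}(v)$ on $\mathcal{S}(v)$ and $\mathcal{F}(e)$ on $\mathcal{S}(e)$, and for $v$ incident on $e$ a monomorphism $\mathcal{S}(f_{ev}):\mathcal{S}(e)\to\mathcal{S}(v)$ which is an injective morphism of fusion systems $\mathcal{F}(e)\to\mathcal{F}(v)$ (i.e. maps $\mathcal{F}(e)$-morphisms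 to $\mathcal{F}(v)$-morphisms, injectively on $\operatorname{Hom}(P,\mathcal{S}(e))$). Hypothesis $(H)$: there is a vertex $v_*$ such that for each vertex $v\ne v_*$, the edge $e$ at $v$ on the minimal path from $v$ to $v_*$ has $\mathcal{S}(f_{ev})$ an isomorphism. Then all $\mathcal{S}(v),\mathcal{S}(e)$ are identified with subgroups of $S=\mathcal{S}(v_* )$ so that all $\mathcal{S}(f_{ev})$ are inclusions, and the completion $\mathcal{F}_\mathcal{T}:=\langle\operatorname{Hom}_{\mathcal{F}(v)}(P,\mathcal{S}(v))\mid P\le\mathcal{S}(v),v\in V(\mathcal{T})\rangle_S$ is the smallest fusion system on $S$ containing all $\mathcal{F}(v)$. $P$ is $\mathcal{F}$-centric if $C_S(R)=Z(R)$ for every $\mathcal{F}$-conjugate $R$ of $P$. $P$ is $\mathcal{F}$-essential if it is $\mathcal{F}$-centric and $\operatorname{Out}_\mathcal{F}(P)=\operatorname{Aut}_\mathcal{F}(P)/\operatorname{Inn}(P)$ contains a strongly $p$-embedded subgroup ($H<G$ strongly $p$-embedded: $H$ contains a Sylow $p$-subgroup of $G$ and $H\cap H^g$ is a $p'$-group for all $g\in G\setminus H$). Saturation: every fully normalised subgroup is fully centralised and fully automised ($\operatorname{Aut}_S(P)\in\operatorname{Syl}_p(\operatorname{Aut}_\mathcal{F}(P))$), and every $\varphi\in\operatorname{Hom}_\mathcal{F}(P,S)$ with $P\varphi$ fully centralised extends to $N_\varphi=\{g\in N_S(P)\mid\varphi^{-1}c_g\varphi\in\operatorname{Aut}_S(P\varphi)\}$.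 $\operatorname{Rep}_{\mathcal{F}_\mathcal{T}}(P,\mathcal{F})$ (for $P\le S$): the graph with vertex set $\bigsqcup_v\operatorname{Hom}_{\mathcal{F}_\mathcal{T}}(P,\mathcal{S}(v))/\!\sim_{\mathcal{F}(v)}$ and edge set $\bigsqcup_e\operatorname{Hom}_{\mathcal{F}_\mathcal{T}}(P,\mathcal{S}(e))/\!\sim_{\mathcal{F}(e)}$, where $\alpha\sim_\mathcal{K}\beta$ iff $\alpha\circ\gamma=\beta$ for some $\gamma\in\operatorname{Iso}_\mathcal{K}(P\alpha,P\beta)$; the edge $[\gamma]_{\mathcal{F}(e)}$, $e=(v,w)$, joins $[\gamma\circ\iota_{\mathcal{S}(e)}^{\mathcal{S}(v)}]_{\mathcal{F}(v)}$ and $[\gamma\circ\iota_{\mathcal{S}(e)}^{\mathcal{S}(w)}]_{\mathcal{F}(w)}$. A tree is a connected graph without cycles. *)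

(* Defs.v *)
From mathcomp Require Import all_boot all_fingroup all_solvable.
From Stdlib Require Import ClassicalEpsilon.

Set Implicit Arguments.
Unset Strict Implicit.
Unset Printing Implicit Defensive.

Local Open Scope group_scope.

Definition asbool (P : Prop) : bool :=
  if excluded_middle_informative P then true else false.

(* A multigraph: vertex set VV, edge set EE, and an incidence relation      *)
(* joins y x1 x2 ("edge y joins x1 and x2", meant to be symmetric).         *)
Section Graphs.
Variables (X Y : finType).

Fixpoint walk (joins : Y -> X -> X -> bool) (x0 : X) (s : seq (Y * X)) : bool :=
  if s is (y, x) :: s' then joins y x0 x && walk joins x s' else true.

Definition walk_in (VV : {set X}) (EE : {set Y}) (s : seq (Y * X)) : bool :=
  all (fun yx => (yx.1 \in EE) && (yx.2 \in VV)) s.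

Definition graph_connected (VV : {set X}) (EE : {set Y})
    (joins : Y -> X -> X -> bool) : Prop :=
  forall x1 x2, x1 \in VV -> x2 \in VV ->
    exists s, [&& walk_in VV EE s, walk joins x1 s & last x1 (map snd s) == x2].

Definition is_cycle (VV : {set X}) (EE : {set Y})
    (joins : Y -> X -> X -> bool) (x0 : X) (s : seq (Y * X)) : bool :=
  [&& x0 \in VV, s != [::], walk_in VV EE s, walk joins x0 s,
      last x0 (map snd s) == x0, uniq (map fst s) & uniq (map snd s)].

Definition is_tree (VV : {set X}) (EE : {set Y})
    (joins : Y -> X -> X -> bool) : Prop :=
  graph_connected VV EE joins /\ (forall x0 s, ~~ is_cycle VV EE joins x0 s).

Definition path_starting (joins : Y -> X -> X -> bool)
    (x1 : X) (y : Y) (x : X) (s : seq (Y * X)) (x2 : X) : bool :=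
  [&& walk joins x1 ((y, x) :: s), last x1 (map snd ((y, x) :: s)) == x2
    & uniq (x1 :: map snd ((y, x) :: s))].

End Graphs.

(* A morphism with domain P is encoded as a finite function gT -> gT which  *)
(* is the identity outside P ("normalised").  A fusion system on S is       *)
(* encoded by F : {set gT} -> {set mor}, with F P = Hom_F(P, S); then       *)
(* Hom_F(P, Q) = [set f in F P | f @: P \subset Q].                         *)
(* Maps act on the right: "first a then b" is  comp P a b.                  *)
Section Fusion.
Variable gT : finGroupType.

Definition mor := {ffun gT -> gT}.

Definition restr (P : {set gT}) (f : gT -> gT) : mor :=
  [ffun x => if x \in P then f x else x].

Definition comp (P : {set gT}) (a b : mor) : mor := restr P (fun x => b (a x)).

Definition injhom (P Q : {set gT}) (f : mor) : bool :=
  [&& restr P f == f,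
      [forall x in P, forall y in P, f (x * y) == f x * f y],
      [forall x in P, forall y in P, (f x == f y) ==> (x == y)]
    & f @: P \subset Q].

Definition Hom (F : {set gT} -> {set mor}) (P Q : {set gT}) : {set mor} :=
  [set f in F P | f @: P \subset Q].

Definition cmor (P : {set gT}) (g : gT) : mor := restr P (fun x => x ^ g).

Definition is_fusion (S : {group gT}) (F : {set gT} -> {set mor}) : Prop :=
  forall P : {group gT}, P \subset S ->
  [/\
      (forall g, g \in S -> cmor P g \in F P),
      (forall f, f \in F P -> injhom P S f),
      (forall (Q : {group gT}) a b, Q \subset S -> a \in Hom F P Q -> b \in F Q ->
         comp P a b \in F P)
    & (* every morphism is an F-isomorphism onto its image followed by an
         inclusion: the inverse P a -> P is an F-morphism *)
      (forall a, a \in F P ->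
         exists2 b, b \in F (a @: P) & forall x, x \in P -> b (a x) = x)].

End Fusion.

Definition strongly_p_embedded (p : nat) (rT : finGroupType) (H G : {set rT}) : Prop :=
  [/\ group_set H, H \proper G,
      (exists2 T : {group rT}, T \in 'Syl_p(G) & T \subset H)
    & forall g, g \in G :\: H -> p^'.-group (H :&: H :^ g)].

Section OnS.
Variables (gT : finGroupType) (p : nat) (S : {group gT}) (F : {set gT} -> {set (mor gT)}).

Definition fconj (P Q : {set gT}) : Prop := exists2 f, f \in F P & f @: P = Q.

Definition fully_normalised (P : {group gT}) : Prop :=
  forall Q : {group gT}, fconj P Q -> #|'N_S(Q)| <= #|'N_S(P)|.

Definition fully_centralised (P : {group gT}) : Prop :=
  forall Q : {group gT}, fconj P Q -> #|'C_S(Q)| <= #|'C_S(P)|.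

Definition AutF (P : {set gT}) : {set {perm gT}} :=
  [set a in Aut P | [ffun x => a x] \in F P].

Definition AutS (P : {group gT}) : {set {perm gT}} := conj_aut P @* 'N_S(P).
Definition Inn (P : {group gT}) : {group {perm gT}} := (conj_aut P @* P)%G.

Definition OutF (P : {group gT}) := (AutF P / Inn P)%g.

Definition fully_automised (P : {group gT}) : Prop :=
  p.-Sylow(AutF P) (AutS P).

Definition fcentric (P : {group gT}) : Prop :=
  forall R : {group gT}, fconj P R -> 'C_S(R) = 'Z(R).

Definition fessential (P : {group gT}) : Prop :=
  fcentric P /\ exists H, strongly_p_embedded p H (OutF P).

Definition Nphi (P : {group gT}) (phi : mor gT) : {set gT} :=
  [set g in 'N_S(P) | [exists h in 'N_S(phi @: P),
                         [forall x in P, phi (x ^ g) == (phi x) ^ h]]].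

Definition saturated : Prop :=
  [/\ is_fusion S F,
      (forall P : {group gT}, P \subset S -> fully_normalised P ->
         fully_centralised P /\ fully_automised P)
    & (forall (P Q : {group gT}) phi, P \subset S -> phi \in F P -> phi @: P = Q ->
         fully_centralised Q ->
         exists2 psi, psi \in F (Nphi P phi) & forall x, x \in P -> psi x = phi x)].
End OnS.

Definition generated (gT : finGroupType) (S : {group gT})
    (Gens : {set gT} -> {set mor gT}) : {set gT} -> {set mor gT} :=
  fun P => [set f | asbool (forall G, is_fusion S G ->
                      (forall Q : {group gT}, Gens Q \subset G Q) -> f \in G P)].

(* Trees of fusion systems, in the identified form available under (H):     *)
(* all S(v), S(e) are subgroups of S = S(v_star) and the S(f_ev) are        *)
(* inclusions.  Edge e has end points (ends e).1 and (ends e).2.            *)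
Section Tree.
Variables (gT : finGroupType) (V E : finType) (ends : E -> V * V).

Definition tjoins (e : E) (v w : V) : bool :=
  (ends e == (v, w)) || (ends e == (w, v)).

Definition incident (e : E) (v : V) : bool := (v == (ends e).1) || (v == (ends e).2).

Variables (Sv : V -> {group gT}) (Se : E -> {group gT})
          (Fv : V -> {set gT} -> {set mor gT}) (Fe : E -> {set gT} -> {set mor gT}).

Definition completion (S : {group gT}) : {set gT} -> {set mor gT} :=
  generated S (fun P => \bigcup_(v | P \subset Sv v) Fv v P).

Section Rep.
Variables (FT : {set gT} -> {set mor gT}) (P : {set gT}).

Definition equivF (K : {set gT} -> {set mor gT}) (a b : mor gT) : bool :=
  [exists c in K (a @: P), (c @: (a @: P) == b @: P) &&
                           [forall x in P, c (a x) == b x]].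

Definition vreps : {set V * mor gT} := [set x | x.2 \in Hom FT P (Sv x.1)].
Definition ereps : {set E * mor gT} := [set x | x.2 \in Hom FT P (Se x.1)].

Definition vclass (x : V * mor gT) : {set V * mor gT} :=
  [set y in vreps | (y.1 == x.1) && equivF (Fv x.1) x.2 y.2].
Definition eclass (x : E * mor gT) : {set E * mor gT} :=
  [set y in ereps | (y.1 == x.1) && equivF (Fe x.1) x.2 y.2].

Definition RepV : {set {set V * mor gT}} := [set vclass x | x in vreps].
Definition RepE : {set {set E * mor gT}} := [set eclass x | x in ereps].

(* the edge [gamma]_{F(e)}, e = (v,w), joins [gamma . incl]_{F(v)} and
   [gamma . incl]_{F(w)} *)
Definition Repjoins (C : {set E * mor gT}) (A B : {set V * mor gT}) : bool :=
  [exists x in C,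
     ((A == vclass ((ends x.1).1, x.2)) && (B == vclass ((ends x.1).2, x.2))) ||
     ((B == vclass ((ends x.1).1, x.2)) && (A == vclass ((ends x.1).2, x.2)))].

Definition Rep_is_tree : Prop := is_tree RepV RepE Repjoins.
End Rep.
End Tree.

(* Main.v *)
Require Import Defs.
From mathcomp Require Import all_boot all_fingroup all_solvable.
From Stdlib Require Import ClassicalEpsilon.

(* Alperin's fusion theorem, applied to each F(v), and hypothesis (a) show that the *)
(* completion F is generated by morphisms between F-centric subgroups, so it        *)
(* suffices to prove the saturation axioms at F-centric subgroups and then to       *)
(* propagate them downwards to the others (Broto-Castellana-Grodal-Levi-Oliver).    *)
(*   Let P be F-centric.  The group Aut_F(P) acts on the tree Rep(P) by             *)
(* precomposition, the stabiliser of the class of f : P -> S(v) being Aut_F(v)(P f) *)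
(* up to conjugation by f.  A Sylow p-subgroup of Aut_F(P) fixes a vertex, hence    *)
(* sits in some F(v), and the saturation of F(v) provides an F-conjugate of P that  *)
(* is fully automised.  To extend f : P -> S to N_f, let K be the image of N_f in   *)
(* Aut_F(P): K fixes the vertices of the inclusion and of f, hence the path joining *)
(* them, and extensions to N_f are carried along that path by saturation of the     *)
(* F(v).  Crossing an edge e requires K to be realised inside S(e); although F(e)   *)
(* is not assumed to be saturated, its fully normalised F-centric subgroups are     *)
(* fully automised (edge_faut), because an automorphism that lies in both end       *)
(* groups fixes two adjacent vertices of Rep, hence the edge between them.          *)

Set Implicit Arguments.
Unset Strict Implicit.
Unset Printing Implicit Defensive.

Local Open Scope group_scope.

(** Saturation is proved by one descending induction on the order of P, with [sat_at] holding the
    axioms for a single target. For centric P, [centric_sat] reads the axioms off the tree Rep.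
    [faut_conj] gives automisation: a finite tree has one more vertex than edges, so a p-group
    acting without inversions fixes a vertex ([pgroup_fixes_vertex]). [centric_extends] gives
    extension: [fixed_vertex_ind] walks along fixed edges, [extend_along] performs one extension
    inside an F(v), and [edge_faut] makes it possible to pass to the other end of an edge. For
    noncentric P, [alperin] and the hypothesis on essential subgroups write each morphism of P as a
    composite of restrictions from centric groups, hence of morphisms defined on groups strictly
    above P that normalise P. Saturation at larger groups lets [step] trade such a morphism for a
    chain of morphisms on still larger groups, and the process stops only at full normalisers or
    centralisers. So a fully normalised P receives the normaliser of each of its conjugates
    ([norm_target]), and its automorphisms extend to P C_S(P) ([iso_good]). That group is larger
    than P, where the axioms are known, and Sylow arguments in its automorphism group bring them
    down to P ([noncentric_sat]). *)

Lemma asboolP (P : Prop) : reflect P (asbool P).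
Proof.
by rewrite /asbool; case: excluded_middle_informative => h; constructor.
Qed.

Lemma ex_least (P : nat -> Prop) :
  (exists n, P n) -> exists n, P n /\ forall m, P m -> n <= m.
Proof.
case=> n Pn; have ex : exists n, asbool (P n) by exists n; apply/asboolP.
exists (ex_minn ex); case: ex_minnP => m /asboolP Pm mmin.
by split=> // k Pk; apply/mmin/asboolP.
Qed.

(** * Finite trees *)

Section TreeGraphs.
Variables (X Y : finType) (VV : {set X}) (EE : {set Y}).
Variable joins : Y -> X -> X -> bool.
Hypothesis tree : is_tree VV EE joins.
Hypothesis edge_ends : forall y, y \in EE -> exists u v,
  [/\ u \in VV, v \in VV & forall a b,
      joins y a b = ((a == u) && (b == v)) || ((a == v) && (b == u))].

Definition walk_to a s b :=
  [&& walk_in VV EE s, walk joins a s & last a (map snd s) == b].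

Lemma joins_sym y a b : y \in EE -> joins y a b = joins y b a.
Proof. by move/edge_ends=> [u [v [_ _ jE]]]; rewrite !jE orbC andbC (andbC (b == v)). Qed.

Lemma joins_VV y a b : y \in EE -> joins y a b -> (a \in VV) /\ (b \in VV).
Proof.
move/edge_ends=> [u [v [uV vV jE]]].
by rewrite jE => /orP[] /andP[/eqP-> /eqP->].
Qed.

Lemma joins_eq y a b c d : y \in EE -> joins y a b -> joins y c d ->
  (c = a /\ d = b) \/ (c = b /\ d = a).
Proof.
move/edge_ends=> [u [v [_ _ jE]]]; rewrite !jE.
by case/orP=> /andP[/eqP-> /eqP->]; case/orP=> /andP[/eqP-> /eqP->]; auto.
Qed.

Lemma joins_eqr y a b c : y \in EE -> joins y a b -> joins y a c -> b = c.
Proof. by move=> yE j1 j2; case: (joins_eq yE j1 j2) => [[]|[]] => [_ ->|<- ->]. Qed.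

Lemma walk_to_cons a y x s b :
  walk_to a ((y, x) :: s) b = [&& y \in EE, x \in VV, joins y a x & walk_to x s b].
Proof.
rewrite /walk_to /walk_in /=.
by case: (y \in EE) (x \in VV) (joins y a x) => [] [] [] //=; rewrite ?andbF.
Qed.

Lemma walk_to_cat a s b t c : walk_to a s b -> walk_to b t c -> walk_to a (s ++ t) c.
Proof.
elim: s a => [|[y x] s IH] a /=; first by case/and3P=> _ _ /eqP/= ->.
by rewrite !walk_to_cons => /and4P[-> -> -> /IH] h /h.
Qed.

Lemma walk_to_rev a s b : a \in VV -> walk_to a s b ->
  exists2 t, walk_to b t a & map fst t =i map fst s.
Proof.
elim: s a => [|[y x] s IH] a aV.
  by case/and3P=> _ _ /eqP/= <-; exists [::] => //; rewrite /walk_to /= eqxx.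
rewrite walk_to_cons => /and4P[yE xV jy /(IH _ xV)[t wt eqt]].
exists (t ++ [:: (y, a)]).
  apply: walk_to_cat wt _; rewrite walk_to_cons yE aV joins_sym // jy.
  by rewrite /walk_to /= eqxx.
by move=> z; rewrite map_cat mem_cat eqt /= !inE orbC.
Qed.

Lemma walk_to_suffix a s b c : walk_to a s b -> c \in map snd s ->
  exists t, [/\ walk_to c t b, size t < size s, {subset t <= s}
     & uniq (map snd s) -> uniq (c :: map snd t)].
Proof.
elim: s a => [//|[y x] s IH] a; rewrite walk_to_cons => /and4P[_ _ _ ws].
rewrite inE; case: eqVneq => [-> _|_ /= cs].
  by exists s; split=> // z zs; rewrite inE zs orbT.
have [t [wt st ts ut]] := IH _ ws cs; exists t; split=> //.
- by rewrite /= ltnW.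
- by move=> z /ts zs; rewrite inE zs orbT.
by case/andP=> _ /ut.
Qed.

Lemma walk_to_simple a s b : walk_to a s b ->
  exists t, [/\ walk_to a t b, {subset t <= s} & uniq (a :: map snd t)].
Proof.
elim: s a => [|[y x] s IH] a; first by exists [::].
rewrite walk_to_cons => /and4P[yE xV jy /IH[t [wt ts ut]]].
have wyt: walk_to a ((y, x) :: t) b by rewrite walk_to_cons yE xV jy.
have sub: {subset (y, x) :: t <= (y, x) :: s}.
  by move=> z; rewrite !inE => /orP[->//|/ts->]; rewrite orbT.
have [a_in|a_out] := boolP (a \in map snd ((y, x) :: t)).
  have [t' [wt' _ st' ut']] := walk_to_suffix wyt a_in.
  exists t'; split=> //; first by move=> z /st'/sub.
  exact: ut'.
by exists ((y, x) :: t); split=> //; rewrite cons_uniq a_out.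
Qed.

Lemma walk_edge_ends a s b y c d : walk_to a s b -> y \in map fst s ->
  joins y c d -> c \in a :: map snd s.
Proof.
elim: s a => [//|[z x] s IH] a; rewrite walk_to_cons => /and4P[zE xV jz ws].
rewrite inE; case: eqVneq => [-> _|_ /= ys].
  by case/(joins_eq zE jz)=> [[-> _]|[-> _]]; rewrite !inE eqxx ?orbT.
by move/(IH _ ws ys); rewrite !inE => ->; rewrite orbT.
Qed.

Lemma simple_uniq_edges a s b : walk_to a s b -> uniq (a :: map snd s) ->
  uniq (map fst s).
Proof.
elim: s a => [//|[y x] s IH] a; rewrite walk_to_cons => /and4P[yE _ jy ws].
rewrite cons_uniq => /andP[a_out us]; rewrite /= (IH _ ws us) andbT.
by apply: contra a_out => /(walk_edge_ends ws)/(_ jy).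
Qed.

(** A walk avoiding y would shorten to a simple one, which y closes into a cycle. Applied to the
    empty walk, this also excludes loops. *)
Lemma edge_bridge y a b s : y \in EE -> joins y a b -> walk_to a s b ->
  y \in map fst s.
Proof.
move=> yE jy /walk_to_simple[t [wt ts ut]]; apply: contraT => yNs.
have yNt : y \notin map fst t.
  by apply: contra yNs => /mapP[z /ts zs ->]; apply: map_f.
have [aV bV] := joins_VV yE jy.
case: tree => _ /(_ b ((y, a) :: t)) /negP[]; case/and3P: (wt) => w1 w2 w3.
have w1' : walk_in VV EE ((y, a) :: t) by rewrite /walk_in /= yE aV.
rewrite /is_cycle bV w1' /= w2 (eqP w3) eqxx joins_sym // jy yNt.
by rewrite (simple_uniq_edges wt ut); move: ut; rewrite cons_uniq => ->.
Qed.

Lemma no_loop y a : y \in EE -> ~~ joins y a a.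
Proof.
move=> yE; apply/negP=> /(edge_bridge (s := [::]) yE).
by rewrite /walk_to /= eqxx => /(_ isT).
Qed.

Lemma edge_uniq y1 y2 a b : y1 \in EE -> y2 \in EE -> joins y1 a b -> joins y2 a b ->
  y1 = y2.
Proof.
move=> y1E y2E j1 j2; have [_ bV] := joins_VV y2E j2.
have := edge_bridge (s := [:: (y2, b)]) y1E j1.
by rewrite walk_to_cons y2E bV j2 /walk_to /= eqxx inE => /(_ isT)/eqP.
Qed.

(** * Distance to a root *)

Section Rooted.
Variable r : X.
Hypothesis rV : r \in VV.

Definition is_dist (d : X -> nat) := forall x, x \in VV ->
  (exists2 s, walk_to x s r & size s = d x)
  /\ (forall s, walk_to x s r -> d x <= size s).

Lemma dist_ex : exists d, is_dist d.
Proof.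
apply: (@fin_all_exists X (fun=> nat) (fun x n => x \in VV ->
  (exists2 s, walk_to x s r & size s = n)
  /\ (forall s, walk_to x s r -> n <= size s))) => x.
have [xV|_] := boolP (x \in VV); last by exists 0.
have [] := @ex_least (fun n => exists2 s, walk_to x s r & size s = n).
  case: tree => /(_ _ _ xV rV)[s ws] _; exists (size s); exists s => //.
by move=> n [exn minn]; exists n => _; split=> // s ws; apply: minn; exists s.
Qed.

Variable d : X -> nat.
Hypothesis dP : is_dist d.

(** A shortest walk from u using y would pass through v, and its suffix from v would be shorter than
    [d v]. *)
Lemma geodesic_avoids y v w u s : y \in EE -> joins y v w -> v != u -> u \in VV ->
  d u <= d v -> walk_to u s r -> size s = d u -> y \notin map fst s.
Proof.
move=> yE jy nvu uV duv ws ss; have [vV _] := joins_VV yE jy.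
apply/negP=> /(walk_edge_ends ws)/(_ jy); rewrite inE (negPf nvu) /=.
case/(walk_to_suffix ws)=> t [wt st _ _]; case: (dP vV) => _ /(_ _ wt).
by rewrite leqNgt (leq_trans st) // ss.
Qed.

Lemma down_edge_uniq v y1 y2 u1 u2 : y1 \in EE -> y2 \in EE ->
  joins y1 v u1 -> joins y2 v u2 -> d u1 <= d v -> d u2 <= d v -> y1 = y2.
Proof.
move=> y1E y2E j1 j2 d1 d2; apply/eqP; apply: contraT => neq.
have [vV u1V] := joins_VV y1E j1; have [_ u2V] := joins_VV y2E j2.
have nv1: v != u1 by apply: contraL j1 => /eqP <-; apply: no_loop.
have nv2: v != u2 by apply: contraL j2 => /eqP <-; apply: no_loop.
have [[s1 w1 z1] _] := dP u1V; have [[s2 w2 z2] _] := dP u2V.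
have a1 := geodesic_avoids y1E j1 nv1 u1V d1 w1 z1.
have a2 := geodesic_avoids y1E j1 nv2 u2V d2 w2 z2.
have w : walk_to v ((y2, u2) :: s2) r by rewrite walk_to_cons y2E u2V j2 w2.
have [t1 wt1 et1] := walk_to_rev u1V w1.
have := edge_bridge y1E j1 (walk_to_cat w wt1).
by rewrite map_cat mem_cat et1 (negPf a1) orbF inE (negPf neq) /= (negPf a2).
Qed.

Lemma down_edge_ex v : v \in VV -> v != r ->
  exists y u, [/\ y \in EE, u \in VV, joins y v u & d u < d v].
Proof.
move=> vV nvr; have [[[|[y x] s] ws ss] _] := dP vV.
  by case/and3P: ws nvr => _ _ /= ->.
move: ws; rewrite walk_to_cons => /and4P[yE xV jy ws].
by exists y, x; split=> //; rewrite -ss ltnS; case: (dP xV) => _; apply.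
Qed.

Lemma edge_dist y a b : y \in EE -> joins y a b -> d a != d b.
Proof.
move=> yE jy; apply/eqP=> dab; have [aV bV] := joins_VV yE jy.
have nab: a != b by apply: contraL jy => /eqP <-; apply: no_loop.
have [ar|nar] := eqVneq a r.
  have d0 : d a = 0.
    by apply/eqP; rewrite -leqn0; case: (dP aV) => _ /(_ [::]); rewrite /walk_to /= ar eqxx; apply.
  have [[s ws ss] _] := dP bV; move: ss ws; rewrite -dab d0 => /size0nil->.
  by case/and3P=> _ _ /= /eqP bE; rewrite ar bE eqxx in nab.
have [z [u [zE uV jz du]]] := down_edge_ex aV nar.
have eyz := down_edge_uniq yE zE jy jz; rewrite -dab leqnn ltnW // in eyz.
rewrite -eyz // in jz; have bu := joins_eqr yE jy jz.
by rewrite -bu dab ltnn in du.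
Qed.

(** Sending a vertex other than the root to its edge towards the root is a bijection onto the
    edges. *)
Lemma tree_card : #|VV| = #|EE|.+1.
Proof.
have [par parP] : exists par : X -> option Y, forall v, v \in VV -> v != r ->
    exists y u, [/\ par v = Some y, y \in EE, joins y v u & d u < d v].
  apply: (@fin_all_exists X (fun=> option Y) (fun v o => v \in VV -> v != r ->
    exists y u, [/\ o = Some y, y \in EE, joins y v u & d u < d v])) => v.
  have [vV|] := boolP (v \in VV); last by exists None.
  have [|nvr] := eqVneq v r; first by exists None.
  have [y [u [yE _ jy du]]] := down_edge_ex vV nvr.
  by exists (Some y) => _ _; exists y, u.
rewrite (cardsD1 r) rV add1n; congr _.+1.
rewrite -(card_in_imset (f := par)); last first.
  move=> v v'; rewrite !inE => /andP[nv vV] /andP[nv' vV'].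
  have [y [u [-> yE jy du]]] := parP v vV nv.
  have [y' [u' [-> y'E jy' du']]] := parP v' vV' nv'.
  case=> eyy; rewrite -eyy in jy'.
  case: (joins_eq yE jy jy') => [[]//|[e1 e2]].
  by move: du'; rewrite e1 e2 ltnNge ltnW.
have injS : injective (@Some Y) by move=> y y' [].
rewrite -(card_imset EE injS); congr #|pred_of_set _|.
apply/setP=> o; apply/imsetP/imsetP=> [[v]|[y yE ->]].
  rewrite !inE => /andP[nv vV] ->; have [y [u [-> yE jy du]]] := parP v vV nv.
  by exists y.
have [u [v [uV vV jE]]] := edge_ends yE.
have juv : joins y u v by rewrite jE !eqxx.
wlog duv : u v uV vV juv {jE} / d v < d u => [wl|].
  have := edge_dist yE juv; rewrite neq_ltn => /orP[|] lt.
    by apply: (wl v u) => //; rewrite joins_sym.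
  by apply: (wl u v).
have nur: u != r.
  apply: contraTneq duv => ->.
  rewrite -leqNgt (leq_trans _ (leq0n _)) //.
  by case: (dP rV) => _ /(_ [::]); rewrite /walk_to /= eqxx; apply.
exists u; first by rewrite !inE nur uV.
have [z [w [-> zE jz dw]]] := parP u uV nur.
by rewrite (down_edge_uniq yE zE juv jz) // ltnW.
Qed.

(** Provides the simple paths to the root that hypothesis (H) speaks about. *)
Lemma geodesic_uniq v : v \in VV ->
  exists2 s, walk_to v s r & size s = d v /\ uniq (v :: map snd s).
Proof.
move=> vV; move: {-1}(d v) (erefl (d v)) => n.
elim: n v vV => [|n IH] v vV dv.
  have [[s ws ss] _] := dP vV; exists s => //; split; first by rewrite ss.
  by rewrite dv in ss; rewrite (size0nil ss).
have nvr: v != r.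
  apply/eqP=> vr; case: (dP vV) => _ /(_ [::]).
  by rewrite /walk_to /= vr eqxx -vr dv => /(_ isT).
have [y [u [yE uV jy du]]] := down_edge_ex vV nvr.
have [[s ws ss] _] := dP uV; have eun : d u = n.
  apply/eqP; rewrite eqn_leq -ltnS -{1}dv du /= -ltnS -dv -ss.
  case: (dP vV) => _ /(_ ((y, u) :: s)); rewrite walk_to_cons yE uV jy ws.
  exact.
have [s' ws' [ss' us']] := IH _ uV eun.
exists ((y, u) :: s'); first by rewrite walk_to_cons yE uV jy.
split; first by rewrite /= ss' -eun.
rewrite map_cons cons_uniq us' andbT; apply/negP; rewrite inE => /orP[/eqP vu|].
  by move: du; rewrite vu ltnn.
case/(walk_to_suffix ws')=> t [wt st _ _].
have [_ /(_ _ wt)] := dP vV; rewrite dv leqNgt => /negP[].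
by rewrite ltnS ltnW // -ss'.
Qed.

End Rooted.

(** * Groups acting on trees *)

Section Actions.
Variables (aT : finGroupType) (K : {group aT}).
Variables (toX : {action aT &-> X}) (toY : {action aT &-> Y}).
Hypothesis actV : forall k x, k \in K -> x \in VV -> toX x k \in VV.
Hypothesis actE : forall k y, k \in K -> y \in EE -> toY y k \in EE.
Hypothesis actJ : forall k y a b, k \in K -> y \in EE -> joins y a b ->
  joins (toY y k) (toX a k) (toX b k).

Lemma walk_to_act k a s b : k \in K -> walk_to a s b ->
  walk_to (toX a k) [seq (toY yx.1 k, toX yx.2 k) | yx <- s] (toX b k).
Proof.
move=> kK; elim: s a => [|[y x] s IH] a /=.
  by case/and3P=> _ _ /eqP/= ->; rewrite /walk_to /= eqxx.
rewrite !walk_to_cons => /and4P[yE xV jy /IH->].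
by rewrite actE // actV // actJ.
Qed.

(* In a tree, the path from a fixed root to a fixed vertex is fixed, so a property *)
(* of the fixed vertices may be propagated from the root along fixed edges.        *)
Lemma fixed_vertex_ind r (Q : X -> Prop) : r \in VV ->
    (forall k, k \in K -> toX r k = r) -> Q r ->
    (forall y a b, y \in EE -> a \in VV -> b \in VV -> joins y a b ->
       (forall k, k \in K -> [/\ toY y k = y, toX a k = a & toX b k = b]) ->
       Q b -> Q a) ->
  forall a, a \in VV -> (forall k, k \in K -> toX a k = a) -> Q a.
Proof.
move=> rV rfix Qr Qstep; have [d dP] := dist_ex rV.
move=> a; move: {2}(d a).+1 (ltnSn (d a)) => n.
elim: n a => // n IH a dan aV afix.
have [-> //|nar] := eqVneq a r.
have [y [b [yE bV jy db]]] := down_edge_ex dP aV nar.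
have jk k : k \in K -> joins (toY y k) a (toX b k).
  by move=> kK; rewrite -{1}(afix _ kK); apply: actJ.
have fixy k : k \in K -> toY y k = y.
  move=> kK; apply: (down_edge_uniq dP (actE kK yE) yE (jk k kK) jy _ (ltnW db)).
  (* K fixes the root, so the image of a geodesic from b bounds the distance of the image of b, and
     [down_edge_uniq] applies to y and its image. *)
  rewrite (leq_trans _ (ltnW db)) //; have [[s ws <-] _] := dP _ bV.
  have := walk_to_act kK ws; rewrite rfix // => wk.
  by have [_ /(_ _ wk)] := dP _ (actV kK bV); rewrite size_map.
have fixb k : k \in K -> toX b k = b.
  by move=> kK; apply: (joins_eqr yE _ jy); rewrite -{1}(fixy _ kK) jk.
apply: Qstep jy _ _ => //; first by move=> k kK; rewrite fixy ?fixb ?afix.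
by apply: IH => //; rewrite -ltnS (leq_trans _ dan).
Qed.

(** Modulo p, the numbers of vertices and edges equal the numbers of fixed ones. Without a fixed
    vertex there is no fixed edge either, as fixed edges have fixed ends; p would then divide two
    consecutive integers. *)
Lemma pgroup_fixes_vertex p : prime p -> p.-group K -> VV != set0 ->
    (forall k y a b, k \in K -> y \in EE -> joins y a b -> toY y k = y ->
       toX a k = a) ->
  exists2 a, a \in VV & forall k, k \in K -> toX a k = a.
Proof.
move=> p_pr pK /set0Pn[r rV] noinv; have [d dP] := dist_ex rV.
have aV : [acts K, on VV | toX].
  apply/actsP=> k kK x; apply/idP/idP=> [kx|]; last exact: actV.
  by rewrite -(actK toX k x) actV ?groupV.
have aE : [acts K, on EE | toY].
  apply/actsP=> k kK x; apply/idP/idP=> [kx|]; last exact: actE.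
  by rewrite -(actK toY k x) actE ?groupV.
have := pgroup_fix_mod pK aV; have := pgroup_fix_mod pK aE.
have [/eqP fix0|[a]] := set_0Vmem 'Fix_(VV | toX)(K); last first.
  by rewrite inE => /andP[aV' /afixP aF] _ _; exists a.
have -> : 'Fix_(EE | toY)(K) = set0.
  apply/setP=> y; rewrite inE [RHS]inE; apply/negP=> /andP[yE /afixP yF].
  have [u [v [uV vV jE]]] := edge_ends yE.
  have juv : joins y u v by rewrite jE !eqxx.
  have := in_set0 u; rewrite -(eqP fix0) inE uV /= => /negP[]; apply/afixP=> k kK.
  by apply: noinv juv _ => //; apply: yF.
rewrite (eqP fix0) cards0 (tree_card rV dP) -addn1 => e0 /eqP.
by rewrite -modnDml e0 cards0 mod0n add0n modn_small ?prime_gt1.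
Qed.

End Actions.
End TreeGraphs.

(** * Morphisms as permutations *)

(** The complements of P and of its image have equal size and are matched through their
    enumerations. *)
Lemma perm_extend (T : finType) (P : {set T}) (f : T -> T) :
  {in P &, injective f} -> exists s : {perm T}, {in P, s =1 f}.
Proof.
move=> injf; pose A := ~: P; pose B := ~: (f @: P).
have cAB : size (enum A) = size (enum B).
  by rewrite -!cardE; apply/eqP; rewrite -(eqn_add2l #|P|) cardsC -{1}(card_in_imset injf) cardsC.
pose g x := if x \in P then f x else nth x (enum B) (index x (enum A)).
have gB x : x \notin P -> g x \in B.
  move=> xP; rewrite /g (negPf xP) -mem_enum mem_nth // -cAB index_mem mem_enum.
  by rewrite inE.
have gP x : x \in P -> g x \notin B by move=> xP; rewrite /g xP inE negbK imset_f.
have injg : injective g.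
  move=> x y exy; have [xP|xP] := boolP (x \in P); have [yP|yP] := boolP (y \in P).
  - by move: exy; rewrite /g xP yP; apply: injf.
  - by move: (gP x xP); rewrite exy gB.
  - by move: (gP y yP); rewrite -exy gB.
  have xA : x \in enum A by rewrite mem_enum inE.
  have yA : y \in enum A by rewrite mem_enum inE.
  move: exy; rewrite /g (negPf xP) (negPf yP) (set_nth_default y) -?cAB ?index_mem //.
  move/eqP; rewrite nth_uniq ?enum_uniq -?cAB ?index_mem // => /eqP ii.
  by rewrite -(nth_index x xA) ii nth_index.
by exists (perm injg) => x xP; rewrite permE /g xP.
Qed.

Lemma set_in_eq (T : finType) (A : {set T}) x y : x \in A -> x = y -> y \in A.
Proof. by move=> xA <-. Qed.

Lemma perm_imsetM (T : finType) (f g : {perm T}) (A : {set T}) :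
  (f * g) @: A = g @: (f @: A).
Proof. by rewrite -imset_comp; apply: eq_imset => x; rewrite permM. Qed.

Lemma perm_imset1 (T : finType) (A : {set T}) : (1 : {perm T}) @: A = A.
Proof. by rewrite -[RHS]imset_id; apply: eq_imset => x; rewrite perm1. Qed.

Lemma perm_imsetK (T : finType) (f : {perm T}) (A : {set T}) : f^-1 @: (f @: A) = A.
Proof. by rewrite -perm_imsetM mulgV perm_imset1. Qed.

Section Restr.
Variable gT : finGroupType.
Implicit Types (P Q : {set gT}) (f g : gT -> gT).

Lemma restrE P f x : x \in P -> restr P f x = f x.
Proof. by move=> xP; rewrite ffunE xP. Qed.

Lemma eq_restr P f g : {in P, f =1 g} -> restr P f = restr P g.
Proof. by move=> fg; apply/ffunP=> x; rewrite !ffunE; case: ifP => // /fg. Qed.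

Lemma restr_id P f : restr P (restr P f) = restr P f.
Proof. by apply: eq_restr => x xP; rewrite restrE. Qed.

Lemma restr_im P Q f : Q \subset P -> restr P f @: Q = f @: Q.
Proof. by move=> /subsetP QP; apply: eq_in_imset => x /QP xP; rewrite restrE. Qed.

Lemma comp_restr P Q f g : f @: P \subset Q ->
  Defs.comp P (restr P f) (restr Q g) = restr P (g \o f).
Proof.
move=> /subsetP fP; apply: eq_restr => x xP.
by rewrite /= (restrE _ xP) restrE // fP ?imset_f.
Qed.

End Restr.

Canonical AutS_group (gT : finGroupType) (S P : {group gT}) :=
  Eval hnf in [group of AutS S P].

Section Img.
Variable gT : finGroupType.

(** Generation makes this a group for every permutation; by [imgE] it is the plain image when f is
    an isomorphism on a group containing P. *)
Definition img (f : {perm gT}) (P : {group gT}) : {group gT} := [group of <<f @: P>>].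

Definition cj (g : gT) : {perm gT} := actperm 'J g.

Lemma cjE g x : cj g x = x ^ g.
Proof. by rewrite actpermE. Qed.

Lemma cj_im g (A : {set gT}) : cj g @: A = A :^ g.
Proof. by apply: eq_imset => x; rewrite cjE. Qed.

End Img.

Section Injections.
Variables (gT : finGroupType) (S : {group gT}).
Implicit Types (P : {group gT}) (f : {perm gT}).

Lemma injhomP P (m : mor gT) :
  reflect (exists2 f : {perm gT}, m = restr P f &
             {in P &, {morph f : x y / x * y}} /\ f @: P \subset S)
          (injhom P S m).
Proof.
apply: (iffP and4P) => [[/eqP m1 /'forall_in_'forall_in_eqP mM inj mS]|[f -> [fM fS]]].
  have minj : {in P &, injective m}.
    move=> x y xP yP; move/'forall_in_forall_inP: inj => /(_ x xP y yP) /implyP h /eqP/h.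
    by move/eqP.
  have [f fE] := perm_extend minj; exists f.
    by rewrite -m1; apply: eq_restr => x xP; rewrite fE.
  by split=> [x y xP yP|]; [rewrite !fE ?groupM // mM | rewrite (eq_in_imset fE)].
split; first by rewrite restr_id.
- by apply/'forall_in_'forall_in_eqP=> x xP y yP; rewrite !restrE ?groupM // fM.
- apply/'forall_in_forall_inP=> x xP y yP; rewrite !restrE //; apply/implyP=> /eqP e.
  by apply/eqP; apply: (@perm_inj _ f).
by rewrite restr_im.
Qed.

Lemma morph_perm_group P f : {in P &, {morph f : x y / x * y}} -> group_set (f @: P).
Proof.
move=> fM; have f1 : f 1 = 1 by apply: (mulgI (f 1)); rewrite -fM // !mulg1.
apply/group_setP; split=> [|u v]; first by apply/imsetP; exists 1.
by case/imsetP=> x xP -> /imsetP[y yP ->]; rewrite -fM // imset_f ?groupM.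
Qed.

End Injections.

Section Iso.
Variables (gT : finGroupType) (S : {group gT}) (F : {set gT} -> {set mor gT}).
Implicit Types (P Q R N : {group gT}) (f g : {perm gT}).

(* Any permutation of gT that agrees with a morphism on its domain represents it.   *)
(* Composition and inversion of isomorphisms then take place in the group           *)
(* {perm gT}, and transport of automorphisms along f is conjugation by f.           *)
Definition iso P Q f :=
  [/\ P \subset S, restr P f \in F P & f @: P = Q].

(* The set Nphi of an isomorphism P -> Q (see Nphi_nphi), presented so that its     *)
(* group structure is inferred.                                                     *)
Definition nphi P Q f : {group gT} :=
  (S :&: conj_aut P @*^-1 (AutS S Q :^ f^-1))%G.

Hypothesis fus : is_fusion S F.

Lemma iso_img P Q f : iso P Q f -> img f P = Q.
Proof. by case=> _ _ fP; apply: val_inj; rewrite /= fP genGid. Qed.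

Lemma isoSl P Q f : iso P Q f -> P \subset S. Proof. by case. Qed.

Lemma iso_im P Q f : iso P Q f -> f @: P = Q. Proof. by case. Qed.

Lemma iso_mem P Q f x : iso P Q f -> (f x \in Q) = (x \in P).
Proof. by case=> _ _ <-; rewrite mem_imset //; apply: perm_inj. Qed.

Lemma iso_card P Q f : iso P Q f -> #|Q| = #|P|.
Proof. by case=> _ _ <-; rewrite card_imset //; apply: perm_inj. Qed.

Lemma iso_injhom P Q f : iso P Q f -> injhom P S (restr P f).
Proof. by case=> PS fF _; case: (fus PS) => _ /(_ _ fF). Qed.

Lemma isoSr P Q f : iso P Q f -> Q \subset S.
Proof.
move=> If; case/iso_injhom/and4P: (If) => _ _ _.
by rewrite restr_im // (iso_im If).
Qed.

Lemma isoM P Q f : iso P Q f -> {in P &, {morph f : x y / x * y}}.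
Proof.
move=> If x y xP yP; case/iso_injhom/and4P: (If) => _ /'forall_in_'forall_in_eqP fM _ _.
by have := fM x xP y yP; rewrite !restrE // groupM.
Qed.

Lemma iso_ext P Q f g : {in P, f =1 g} -> iso P Q f -> iso P Q g.
Proof.
move=> fg [PS fF fP]; split=> //; first by rewrite -(eq_restr fg).
by rewrite -fP; apply/esym/eq_in_imset.
Qed.

Lemma iso_trans P Q R f g : iso P Q f -> iso Q R g -> iso P R (f * g).
Proof.
move=> [PS fF fP] [QS gF gQ]; split=> //; last by rewrite perm_imsetM fP.
have [_ _ /(_ Q _ _ QS) C _] := fus PS.
have := C (restr P f) (restr Q g).
rewrite comp_restr ?fP // inE fF restr_im // fP subxx => /(_ isT gF).
move=> h; apply: set_in_eq h _; apply: eq_restr => x _.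
by rewrite /= permM.
Qed.

Lemma iso_id P : P \subset S -> iso P P 1.
Proof.
move=> PS; split=> //; last by rewrite perm_imset1.
have [/(_ 1 (group1 S)) C _ _ _] := fus PS; apply: set_in_eq C _.
by apply: eq_restr => x _; rewrite conjg1 perm1.
Qed.

Lemma iso_sub P Q P' f : P' \subset P -> iso P Q f -> iso P' (img f P') f.
Proof.
move=> sPP If; have P'S := subset_trans sPP (isoSl If); split=> //; last first.
  rewrite /= gen_set_id //; apply: morph_perm_group => x y xP yP.
  by rewrite (isoM If) ?(subsetP sPP).
have [_ idF idP] := iso_id P'S; have [_ _ /(_ P _ _ (isoSl If)) C _] := fus P'S.
have := C (restr P' (1 : {perm gT})) (restr P f).
rewrite comp_restr ?idP // inE idF restr_im // idP sPP.
case: If => _ fF _ /(_ isT fF) h.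
apply: set_in_eq h _; by apply: eq_restr => x _; rewrite /= perm1.
Qed.

Lemma iso_inv P Q f : iso P Q f -> iso Q P f^-1.
Proof.
move=> If; split; [exact: isoSr If | | by rewrite -(iso_im If) perm_imsetK].
have [PS fF fP] := If; have [_ _ _ /(_ _ fF)] := fus PS.
rewrite restr_im // fP => -[b bF bK].
have [_ /(_ b bF) /and4P[/eqP b1 _ _ _] _ _] := fus (isoSr If).
rewrite -b1 in bF; apply: set_in_eq bF _; apply: eq_restr => y.
rewrite -fP => /imsetP[x xP ->]; rewrite permK.
by have := bK x xP; rewrite restrE.
Qed.

Lemma iso_cj (g : gT) P : P \subset S -> g \in S -> iso P (P :^ g)%G (cj g).
Proof.
move=> PS gS; split=> //; last exact: cj_im.
have [/(_ g gS) C _ _ _] := fus PS; apply: set_in_eq C _.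
by apply: eq_restr => x _; rewrite cjE.
Qed.

Lemma iso_mor P (m : mor gT) : P \subset S -> m \in F P ->
  exists Q f, iso P Q f /\ m = restr P f.
Proof.
move=> PS mF; have [_ /(_ m mF)/injhomP[f mf [fM _]] _ _] := fus PS.
by exists (Group (morph_perm_group fM)), f; split=> //; split; rewrite -?mf.
Qed.

Lemma iso1f P Q f : iso P Q f -> f 1 = 1.
Proof.
by move=> If; apply: (mulgI (f 1)); rewrite -(isoM If) // !mulg1.
Qed.

Lemma isoV P Q f : iso P Q f -> {in P, {morph f : x / x^-1}}.
Proof.
move=> If x xP; apply/eqP; rewrite eq_sym eq_invg_mul -(isoM If) ?groupV //.
by rewrite mulgV (iso1f If).
Qed.

Lemma isoJ P Q f : iso P Q f -> {in P &, {morph f : x y / x ^ y}}.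
Proof.
by move=> If x y xP yP; rewrite /conjg !(isoM If, isoV If) ?groupM ?groupV.
Qed.

Lemma img_sub f P P' : P' \subset P -> img f P' \subset img f P.
Proof. by move=> s; rewrite genS // imsetS. Qed.

Lemma imgE R R' P f : iso R R' f -> P \subset R -> f @: P = img f P.
Proof. by move=> If PR; have /iso_im := iso_sub PR If. Qed.

Lemma mem_img R R' P f x : iso R R' f -> P \subset R -> (f x \in img f P) = (x \in P).
Proof. by move=> If PR; rewrite (iso_mem _ (iso_sub PR If)). Qed.

Lemma iso_norm R R' P f y : iso R R' f -> P \subset R -> y \in R ->
  (f y \in 'N(img f P)) = (y \in 'N(P)).
Proof.
move=> If PR yR; rewrite !inE -(imgE If PR); apply/subsetP/subsetP=> h x.
  case/imsetP=> z zP ->{x}; have zR := subsetP PR z zP.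
  have := h (f z ^ f y); rewrite memJ_conjg imset_f // => /(_ isT).
  by rewrite -(isoJ If) // mem_imset //; apply: perm_inj.
case/imsetP=> _ /imsetP[z zP ->] ->; have zR := subsetP PR z zP.
by rewrite -(isoJ If) // imset_f // h // memJ_conjg.
Qed.

Lemma iso_cent R R' P f y : iso R R' f -> P \subset R -> y \in R ->
  (f y \in 'C(img f P)) = (y \in 'C(P)).
Proof.
move=> If PR yR; apply/centP/centP=> h x.
  move=> xP; apply/(@perm_inj _ f); have xR := subsetP PR x xP.
  by rewrite !(isoM If) // h // (mem_img _ If PR).
rewrite -(imgE If PR) => /imsetP[z zP ->]; have zR := subsetP PR z zP.
by rewrite /commute -!(isoM If) // h.
Qed.

Lemma iso_center P Q f y : iso P Q f -> y \in P -> (f y \in 'Z(Q)) = (y \in 'Z(P)).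
Proof.
move=> If yP; rewrite !inE (iso_mem _ If) yP /=.
by rewrite -(iso_cent If (subxx P) yP) (iso_img If).
Qed.

Lemma iso_card_center P Q f : iso P Q f -> #|'Z(Q)| = #|'Z(P)|.
Proof.
move=> If; rewrite -(card_imset 'Z(P) (@perm_inj _ f)); congr #|pred_of_set _|.
apply/setP=> y; apply/idP/imsetP=> [yZ|[x xZ ->]].
  have yQ := subsetP (center_sub Q) y yZ.
  exists (f^-1 y); last by rewrite permKV.
  by rewrite (iso_center (iso_inv If)).
by rewrite (iso_center If) // (subsetP (center_sub P)).
Qed.

Lemma fconjP P Q : P \subset S -> fconj F P Q <-> exists f, iso P Q f.
Proof.
move=> PS; split=> [[m mF mP]|[f [_ fF fP]]]; last first.
  by exists (restr P f) => //; rewrite restr_im.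
have [Q' [f [If mE]]] := iso_mor PS mF; exists f.
suff <- : Q' = Q by [].
by apply: val_inj; rewrite /= -mP mE restr_im // (iso_im If).
Qed.

Lemma AutF_intro P f : iso P P f -> perm_on P f -> f \in AutF F P.
Proof.
move=> If fP; rewrite !inE fP /=; apply/andP; split.
  by apply/morphicP; apply: isoM If.
have [_ fF _] := If; apply: set_in_eq fF _.
by apply/ffunP=> x; rewrite !ffunE; case: ifPn => // /(out_perm fP).
Qed.

Lemma AutF_iso P f : P \subset S -> f \in AutF F P -> iso P P f.
Proof.
move=> PS; rewrite inE => /andP[fA fF]; split=> //.
  apply: set_in_eq fF _; apply/ffunP=> x; rewrite !ffunE; case: ifPn => //.
  by move: fA; rewrite inE => /andP[fP _] /(out_perm fP).
by apply: im_perm_on; move: fA; rewrite inE => /andP[].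
Qed.

Lemma AutF_on P f : f \in AutF F P -> perm_on P f.
Proof. by rewrite !inE => /andP[/andP[]]. Qed.

Lemma restr_perm_eq P f : iso P P f -> {in P, restr_perm P f =1 f}.
Proof.
move=> If x xP; apply: restr_permE => //; apply/astabsP=> z /=.
by rewrite apermE (iso_mem _ If).
Qed.

Lemma restr_perm_AutF P f : iso P P f -> restr_perm P f \in AutF F P.
Proof.
move=> If; apply: AutF_intro; last exact: restr_perm_on.
by apply: (iso_ext _ If) => x xP; rewrite (restr_perm_eq If).
Qed.

(** Generation supplies the group structure; by [AutGE] nothing is added when P lies in S. *)
Definition AutG P : {group {perm gT}} := <<AutF F P>>%G.

Lemma AutGE P : P \subset S -> AutG P = AutF F P :> {set _}.
Proof.
move=> PS; rewrite /= gen_set_id //; apply/group_setP; split=> [|a b aA bA].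
  by apply: AutF_intro (iso_id PS) _; apply: perm_on1.
apply: AutF_intro; last by apply: perm_onM; apply: AutF_on; eassumption.
by apply: iso_trans; apply: AutF_iso; eassumption.
Qed.

Lemma AutF_J P Q f : iso P Q f -> AutF F Q = AutF F P :^ f.
Proof.
have sub P' Q' g : iso P' Q' g -> AutF F P' :^ g \subset AutF F Q'.
  move=> Ig; apply/subsetP=> _ /imsetP[a aA ->]; have PS := isoSl Ig.
  have Ia := AutF_iso PS aA; have aP := AutF_on aA.
  apply: AutF_intro; first by apply: iso_trans (iso_inv Ig) (iso_trans Ia Ig).
  apply/subsetP=> x; rewrite inE; apply: contraR => xQ.
  rewrite !permM (out_perm aP) ?permKV //.
  by rewrite -(iso_mem _ Ig) permKV.
move=> If; apply/eqP; rewrite eqEsubset sub // andbT.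
by rewrite -sub_conjgV sub //; apply: iso_inv.
Qed.

Lemma AutG_J P Q f : iso P Q f -> AutG Q = AutG P :^ f :> {set _}.
Proof. by move=> If; rewrite !AutGE ?(isoSl If) ?(isoSr If) // (AutF_J If). Qed.


End Iso.

Lemma Sylow_of_card (rT : finGroupType) p (G T L : {group rT}) :
  p.-Sylow(G) L -> T \subset G -> p.-group T -> #|L| <= #|T| -> p.-Sylow(G) T.
Proof.
move=> sylL TG pT cL; rewrite pHallE TG /= eqn_leq -(card_Hall sylL) cL andbT.
by rewrite dvdn_leq // (card_Hall sylL) -(part_pnat_id pT) partn_dvd // cardSg.
Qed.

(** * Normalisers, extension groups and saturation at one subgroup *)

Section Norm.
Variables (gT : finGroupType) (S : {group gT}).
Implicit Types (P Q R N : {group gT}).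

Lemma AutSP P a :
  reflect (exists2 g, g \in 'N_S(P) & a = conj_aut P g) (a \in AutS S P).
Proof.
apply: (iffP morphimP) => [[g _ gN ->]|[g gN ->]]; first by exists g.
by exists g => //; move: gN; rewrite inE => /andP[].
Qed.

Lemma conj_aut_on P g : g \in 'N(P) -> perm_on P (conj_aut P g).
Proof.
by move=> gN; have := Aut_conj_aut P [set g]; rewrite morphim_set1 // sub1set inE => /andP[]. Qed.

Lemma card_AutS P : (#|AutS S P| * #|'C_S(P)| = #|'N_S(P)|)%N.
Proof.
rewrite /AutS card_morphim ker_conj_aut (setIidPr (subsetIr _ _)).
rewrite -indexgI (_ : 'N_S(P) :&: 'C(P) = 'C_S(P)); last first.
  by rewrite -setIA (setIidPr (cent_sub P)).
by rewrite mulnC Lagrange // setIS // cent_sub.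
Qed.

Lemma pgroup_AutS p P : p.-group S -> p.-group (AutS S P).
Proof. by move=> pS; rewrite morphim_pgroup // (pgroupS _ pS) // subsetIl. Qed.

End Norm.

Section Nphi.
Variables (gT : finGroupType) (S : {group gT}) (F : {set gT} -> {set mor gT}).
Hypothesis fus : is_fusion S F.
Implicit Types (P Q R N : {group gT}) (f : {perm gT}).

Lemma iso_conj_aut P g : P \subset S -> g \in 'N_S(P) -> iso S F P P (conj_aut P g).
Proof.
move=> PS; rewrite inE => /andP[gS gN].
have [_ gF gP] := iso_cj fus PS gS.
have e : {in P, cj g =1 conj_aut P g} by move=> x xP; rewrite cjE norm_conj_autE.
apply: (iso_ext e); split=> //; rewrite gP /=; exact: normP.
Qed.

Lemma AutS_sub P : P \subset S -> AutS S P \subset AutF F P.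
Proof.
move=> PS; apply/subsetP=> _ /AutSP[g gN ->]; apply: (AutF_intro fus).
  exact: iso_conj_aut.
by apply: conj_aut_on; move: gN; rewrite inE => /andP[].
Qed.

(** Translates the elementwise condition defining N_f into containments between groups of
    permutations, where Sylow's theorem applies. *)
Lemma conj_aut_J P Q f g h : iso S F P Q f -> g \in 'N_S(P) -> h \in 'N_S(Q) ->
  conj_aut P g ^ f = conj_aut Q h <-> {in P, forall x, f (x ^ g) = f x ^ h}.
Proof.
move=> If; rewrite inE => /andP[gS gN]; rewrite inE => /andP[hS hN]; split=> [e x xP|e].
  have := congr1 (fun s : {perm gT} => s (f x)) e.
  by rewrite permJ !norm_conj_autE // (iso_mem _ If).
apply/permP=> y; rewrite -(permKV f y) permJ; move: (f^-1 y) => x.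
have [xP|xP] := boolP (x \in P).
  by rewrite !norm_conj_autE ?e // (iso_mem _ If).
by rewrite !(out_perm (conj_aut_on _)) // (iso_mem _ If).
Qed.

Lemma nphiP P Q f g : iso S F P Q f ->
  reflect (g \in 'N_S(P) /\ exists2 h, h \in 'N_S(Q) & {in P, forall x, f (x ^ g) = f x ^ h})
          (g \in nphi S P Q f).
Proof.
move=> If; apply: (iffP setIP) => [[gS /morphpreP[gN]]|[gN [h hN e]]].
  have gNS : g \in 'N_S(P) by rewrite inE gS.
  rewrite mem_conjgV => /AutSP[h hN e]; split=> //; exists h => //.
  by apply/(conj_aut_J If gNS hN).
split; first by case/setIP: gN.
apply/morphpreP; split; first by case/setIP: gN.
by rewrite mem_conjgV (iffRL (conj_aut_J If gN hN) e); apply/AutSP; exists h.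
Qed.

Lemma nphi_sub P Q f : nphi S P Q f \subset 'N_S(P).
Proof.
by apply/subsetP=> g /setIP[gS /morphpreP[gN _]]; rewrite inE gS.
Qed.

Lemma sub_nphi P Q f (M : {group gT}) : M \subset 'N_S(P) ->
  (conj_aut P @* M) :^ f \subset AutS S Q -> M \subset nphi S P Q f.
Proof.
rewrite subsetI => /andP[MS MN] h.
by rewrite subsetI MS -sub_morphim_pre //= -sub_conjg.
Qed.

Lemma nphi_ge P Q f : iso S F P Q f -> P \subset nphi S P Q f.
Proof.
move=> If; apply/subsetP=> g gP; apply/(nphiP _ If); split.
  by rewrite inE (subsetP (isoSl If)) // (subsetP (normG P)).
exists (f g); last by move=> x xP; rewrite (isoJ fus If).
have fgQ : f g \in Q by rewrite (iso_mem _ If).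
by rewrite inE (subsetP (isoSr fus If)) // (subsetP (normG Q)).
Qed.

Lemma Nphi_nphi P Q f : iso S F P Q f -> Nphi S P (restr P f) = nphi S P Q f.
Proof.
move=> If; have fP : restr P f @: P = Q by rewrite restr_im // (iso_im If).
apply/setP=> g; apply/idP/(nphiP _ If) => [|[gN [h hN e]]].
  rewrite inE fP => /andP[gN /exists_inP[h hN /forall_inP e]]; split=> //.
  exists h => // x xP; have := e x xP; rewrite !restrE ?memJ_norm //; first by move/eqP.
  by case/setIP: gN.
rewrite inE gN fP; apply/exists_inP; exists h => //; apply/forall_inP=> x xP.
rewrite !restrE ?memJ_norm ?e //.
by case/setIP: gN.
Qed.

Lemma iso_normal P Q N N' f : P \subset N -> N \subset 'N_S(P) ->
  iso S F N N' f -> f @: P = Q -> N' \subset 'N_S(Q).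
Proof.
move=> PN NN If fP; have Qi : img f P = Q.
  by apply: val_inj; rewrite /= fP genGid.
apply/subsetP=> y yN; rewrite inE (subsetP (isoSr fus If)) //=.
rewrite -(permKV f y) -Qi (iso_norm fus If PN).
  by have /setIP[] := subsetP NN _ (etrans (iso_mem y (iso_inv fus If)) yN).
by rewrite (iso_mem _ (iso_inv fus If)).
Qed.

Lemma iso_subE P Q N N' f : P \subset N -> iso S F N N' f -> f @: P = Q -> iso S F P Q f.
Proof.
move=> PN If fP; have := iso_sub fus PN If; congr (iso _ _ _ _ _).
by apply: val_inj; rewrite /= fP genGid.
Qed.

Section Sat.
Variable p : nat.
Hypothesis pS : p.-group S.

Definition extends P Q f := exists N g,
  iso S F (nphi S P Q f) N g /\ {in P, g =1 f}.

(** Both axioms are attached to the target Q, which allows induction on its order. *)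
Definition sat_at Q :=
  (fully_normalised S F Q -> fully_centralised S F Q /\ fully_automised p S F Q)
  /\ (forall P f, iso S F P Q f -> fully_centralised S F Q -> extends P Q f).

(** K transported along f is a p-subgroup of Aut_F(Q), in which Aut_S(Q) is Sylow. *)
Lemma faut_adjust P Q f (K : {group {perm gT}}) :
  fully_automised p S F Q -> iso S F P Q f -> K \subset AutF F P -> p.-group K ->
  exists2 b, b \in AutF F Q & K :^ (f * b) \subset AutS S Q.
Proof.
move=> sylQ If KP pK; have QS := isoSr fus If.
rewrite /fully_automised -(AutGE fus QS) in sylQ.
have KQ : K :^ f \subset AutG F Q.
  by rewrite (AutGE fus QS) (AutF_J fus If) conjSg.
have [|b bA Kb] := Sylow_Jsub sylQ KQ; first by rewrite pgroupJ.
by exists b; [rewrite -(AutGE fus QS) | rewrite conjsgM].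
Qed.

(** Take b carrying a Sylow subgroup of W into Aut_S(Q); some w moves K into that Sylow subgroup.
    The point is that b does not depend on K. *)
Lemma faut_pivot Q (W : {group {perm gT}}) : Q \subset S ->
  fully_automised p S F Q -> W \subset AutF F Q ->
  exists2 b, b \in AutF F Q & forall K : {group {perm gT}}, K \subset W -> p.-group K ->
    exists2 w, w \in W & K :^ (w * b) \subset AutS S Q.
Proof.
move=> QS sylQ WQ; have [T sylT] := Sylow_exists p W.
have [b bA Tb] := faut_adjust sylQ (iso_id fus QS)
  (subset_trans (pHall_sub sylT) WQ) (pHall_pgroup sylT).
rewrite mul1g in Tb; exists b => // K KW pK.
have [w wW Kw] := Sylow_Jsub sylT KW pK; exists w => //.
by rewrite conjsgM (subset_trans _ Tb) // conjSg.
Qed.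

Lemma fully_normalisedP P : P \subset S -> fully_normalised S F P <->
  (forall Q f, iso S F P Q f -> #|'N_S(Q)| <= #|'N_S(P)|).
Proof.
move=> PS; split=> [fn Q f If|h Q /(fconjP fus _ PS)[f /h] //].
by apply: fn; apply/(fconjP fus _ PS); exists f.
Qed.

Lemma fully_centralisedP P : P \subset S -> fully_centralised S F P <->
  (forall Q f, iso S F P Q f -> #|'C_S(Q)| <= #|'C_S(P)|).
Proof.
move=> PS; split=> [fn Q f If|h Q /(fconjP fus _ PS)[f /h] //].
by apply: fn; apply/(fconjP fus _ PS); exists f.
Qed.

Lemma fcentricP P : P \subset S -> fcentric S F P <->
  (forall Q f, iso S F P Q f -> 'C_S(Q) \subset Q).
Proof.
move=> PS; split=> [fn Q f If|h Q /(fconjP fus _ PS)[f If]].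
  rewrite (fn Q); first exact: center_sub.
  by apply/(fconjP fus _ PS); exists f.
apply/eqP; rewrite eqEsubset; apply/andP; split; last exact: setSI (isoSr fus If).
by apply/subsetIP; split; [apply: h If | apply: subsetIr].
Qed.

Lemma fcentric_iso P Q f : iso S F P Q f -> fcentric S F P -> fcentric S F Q.
Proof.
move=> If /(fcentricP (isoSl If)) h; apply/(fcentricP (isoSr fus If)) => R g Ig.
exact: h (iso_trans fus If Ig).
Qed.

Lemma fcentric_sup P Q : Q \subset S -> P \subset Q -> fcentric S F P -> fcentric S F Q.
Proof.
move=> QS PQ /(fcentricP (subset_trans PQ QS)) h; apply/(fcentricP QS) => R f If.
rewrite -(iso_img If); apply: subset_trans (img_sub f PQ).
apply: subset_trans (h _ _ (iso_sub fus PQ If)).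
by rewrite setIS // centS // img_sub.
Qed.

(** The centraliser of each conjugate lies in its centre, whose order is that of Z(P). *)
Lemma fcentric_fcent P : P \subset S -> fcentric S F P -> fully_centralised S F P.
Proof.
move=> PS /(fcentricP PS) h; apply/(fully_centralisedP PS) => Q f If.
rewrite (leq_trans (subset_leq_card _) (_ : #|'Z(Q)| <= _)) //.
  by apply/subsetIP; split; [apply: h If | apply: subsetIr].
by rewrite (iso_card_center fus If) subset_leq_card // setSI.
Qed.

Lemma fully_normalised_ex P : P \subset S ->
  exists Q f, iso S F P Q f /\ fully_normalised S F Q.
Proof.
move=> PS.
have [|n [[Q [f [If ne]]] nmin]] :=
  @ex_least (fun n => exists Q f, iso S F P Q f /\ n = #|S| - #|'N_S(Q)|).
  by exists (#|S| - #|'N_S(P)|), P, 1; split=> //; apply: iso_id.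
exists Q, f; split=> //; apply/(fully_normalisedP (isoSr fus If)) => R g Ig.
have := nmin _ (ex_intro _ R (ex_intro _ (f * g) (conj (iso_trans fus If Ig) erefl))).
rewrite ne leq_sub2lE //.
by rewrite subset_leq_card // subsetIl.
Qed.

(** Once f is corrected by an automorphism of Q so as to take Aut_S(P) into Aut_S(Q), its extension
    group is all of N_S(P). Because of the correction, g need not agree with f on P. *)
Lemma norm_extend P Q f : iso S F P Q f -> sat_at Q -> fully_normalised S F Q ->
  exists N g, [/\ iso S F 'N_S(P)%G N g, g @: P = Q & iso S F P Q g].
Proof.
move=> If [fn ext] /fn[fc fa]; have PS := isoSl If; have QS := isoSr fus If.
have [b bA Kb] := faut_adjust (K := AutS_group S P) fa If (AutS_sub PS) (pgroup_AutS P pS).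
have Ifb : iso S F P Q (f * b) := iso_trans fus If (AutF_iso QS bA).
have [N [g [Ig gE]]] := ext _ _ Ifb fc.
have sN := sub_nphi (M := 'N_S(P)%G) (subxx _) Kb.
have PN : P \subset 'N_S(P) by rewrite subsetI PS normG.
exists (img g 'N_S(P)%G), g; split; first exact: iso_sub Ig.
  by rewrite (eq_in_imset gE) (iso_im Ifb).
by apply: iso_ext Ifb => x xP; rewrite gE.
Qed.

End Sat.
End Nphi.

Lemma saturatedP (gT : finGroupType) p (S : {group gT}) F :
  saturated p S F <-> is_fusion S F /\ forall P : {group gT}, P \subset S -> sat_at S F p P.
Proof.
split=> [[fus fn ext]|[fus sat]]; split=> //.
- move=> P PS; split; first exact: fn.
  move=> Q f If fc; have [_ fF fQ] := If.
  have [|m] := ext Q P _ (isoSl If) fF _ fc; first by rewrite restr_im.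
  rewrite (Nphi_nphi If) => mF mE.
  have nS : nphi S Q P f \subset S by rewrite (subset_trans (nphi_sub _ _ _ _)) ?subsetIl.
  have [N [g [Ig gm]]] := iso_mor fus nS mF; exists N, g; split=> // x xQ.
  by have := mE x xQ; rewrite gm !restrE // (subsetP (nphi_ge fus If)).
- by move=> P PS; case: (sat P PS).
move=> P Q m PS mF mP fc; have [Q' [f [If mf]]] := iso_mor fus PS mF.
have eQ : Q' = Q by apply: val_inj; rewrite /= -mP mf restr_im // (iso_im If).
rewrite eQ in If; have [_ ext] := sat Q (isoSr fus If).
have [N [g [Ig gf]]] := ext _ _ If fc; exists (restr (nphi S P Q f) g).
  by rewrite mf (Nphi_nphi If); case: Ig.
by move=> x xP; rewrite mf !restrE ?gf // (subsetP (nphi_ge fus If)).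
Qed.

(** * Alperin's fusion theorem *)

Section Gen.
Variables (gT : finGroupType) (C : {group gT} -> Prop).
Variables (S : {group gT}) (F : {set gT} -> {set mor gT}).
Hypothesis fus : is_fusion S F.
Hypothesis C_iso : forall P Q f, iso S F P Q f -> C P -> C Q.
Implicit Types (P Q R N : {group gT}) (f g : {perm gT}).

(** In the application C means centric in the completion, even when F is one of the F(v). *)
Inductive gen : {group gT} -> {group gT} -> {perm gT} -> Prop :=
| gen_base P Q R R' f of C R & iso S F R R' f & P \subset R & f @: P = Q : gen P Q f
| gen_comp P Q R f g of gen P Q f & gen Q R g : gen P R (f * g)
| gen_ext P Q f g of {in P, f =1 g} & gen P Q f : gen P Q g.

Lemma gen_iso P Q f : gen P Q f -> iso S F P Q f.
Proof.
elim=> {P Q f} [P Q R R' f _ If PR fP|P Q R f g _ If _ Ig|P Q f g fg _ If].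
- exact: (iso_subE fus PR If fP).
- exact: (iso_trans fus If Ig).
exact: iso_ext fg If.
Qed.

Lemma gen_sub P Q P' Q' f : P' \subset P -> f @: P' = Q' -> gen P Q f -> gen P' Q' f.
Proof.
move=> PP fP gf; elim: gf P' Q' PP fP => {P Q f}
  [P Q R R' f CR If PR fP|P Q R f g g1 IH1 g2 IH2|P Q f g fg g1 IH] P' Q' PP fP'.
- exact: gen_base CR If (subset_trans PP PR) fP'.
- have If := gen_iso g1; have fE := imgE fus If PP.
  apply: gen_comp (IH1 _ (img f P') PP fE) (IH2 _ _ _ _).
    by rewrite -(iso_img If) img_sub.
  by rewrite -fE -perm_imsetM.
apply: gen_ext (IH _ _ PP _); first by move=> x /(subsetP PP)/fg.
by rewrite -fP'; apply: eq_in_imset => x /(subsetP PP)/fg.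
Qed.

Lemma gen_inv P Q f : gen P Q f -> gen Q P f^-1.
Proof.
elim=> {P Q f} [P Q R R' f CR If PR fP|P Q R f g _ If _ Ig|P Q f g fg g1 If].
- apply: (gen_base (C_iso If CR) (iso_inv fus If)); last by rewrite -fP perm_imsetK.
  by rewrite -fP -(iso_im If) imsetS.
- by rewrite invMg; apply: gen_comp Ig If.
apply: gen_ext If => y; rewrite -(iso_im (gen_iso g1)) => /imsetP[x xP ->].
by rewrite permK fg // permK.
Qed.

End Gen.

(** If H and H^g share an element x of order p, then x and its conjugate by g^-1 both lie in H and
    move into T by elements h1, h2 of H. So T meets its conjugate by h1^-1 g^-1 h2, which puts this
    element, hence g, in H. *)
Lemma strongly_p_embedded_gen (rT : finGroupType) p (G T : {group rT}) :
  prime p -> p.-Sylow(G) T -> T :!=: 1 ->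
  let H := <<[set x in G | T :&: T :^ x != 1]>> in
  ~~ (G \subset H) -> strongly_p_embedded p H G.
Proof.
move=> p_pr sylT nT; set D := [set x in G | _]; set H := <<D>>%G => /= nGH.
have HG : H \subset G by rewrite gen_subG; apply/subsetP=> x; rewrite inE => /andP[].
have TH : T \subset H.
  apply/subsetP=> t tT; apply: mem_gen; rewrite inE (subsetP (pHall_sub sylT)) //=.
  by rewrite conjGid // setIid.
split.
- exact: groupP.
- by rewrite properE HG.
- by exists T; rewrite // inE.
move=> g /setDP[gG gH]; rewrite /pgroup p'natE //.
apply: contra gH => /(Cauchy p_pr)[x /setIP[xH xHg] ox].
have sylTH : p.-Sylow(H) T := pHall_subl TH HG sylT.
have px : p.-group <[x]> by rewrite /pgroup -orderE ox pnat_id.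
have [|h1 h1H T1] := Sylow_Jsub sylTH _ px; first by rewrite cycle_subG.
have [||h2 h2H T2] := Sylow_Jsub (Q := (<[x]> :^ g^-1)%G) sylTH.
- by rewrite /= sub_conjgV cycle_subG.
- by rewrite pgroupJ.
have uD : h1^-1 * g^-1 * h2 \in H.
  have h1G := subsetP HG _ h1H; have h2G := subsetP HG _ h2H.
  apply: mem_gen; rewrite inE !groupM ?groupV //=.
  apply/trivgPn; exists (x ^ (g^-1 * h2)).
    apply/setIP; split.
      by rewrite (subsetP T2) //= conjgM !memJ_conjg cycle_id.
    have -> : g^-1 * h2 = h1 * (h1^-1 * g^-1 * h2) by rewrite -mulgA mulKVg.
    by rewrite conjgM memJ_conjg (subsetP T1) // memJ_conjg cycle_id.
  by rewrite conjg_eq1 -order_eq1 ox neq_ltn prime_gt1 ?orbT.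
rewrite -groupV -(groupMl _ (groupVr h1H)) -(groupMr _ h2H).
exact: uD.
Qed.

Section Alperin.
Variables (gT : finGroupType) (p : nat) (C : {group gT} -> Prop).
Variables (S : {group gT}) (F : {set gT} -> {set mor gT}).
Hypothesis p_pr : prime p.
Hypothesis pS : p.-group S.
Hypothesis fus : is_fusion S F.
Hypothesis sat : forall P : {group gT}, P \subset S -> sat_at S F p P.
Hypothesis C_iso : forall P Q f, iso S F P Q f -> C P -> C Q.
Hypothesis CS : C S.
Hypothesis C_ess : forall Q : {group gT}, Q \subset S -> fessential p S F Q -> C Q.
Implicit Types (P Q R N : {group gT}) (f : {perm gT}).
Local Notation gen := (gen C S F).

Lemma norm_grows P : P \proper S -> P \proper 'N_S(P).
Proof. exact: nilpotent_proper_norm (pgroup_nil pS). Qed.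

Lemma Inn_AutS P : P \subset S -> Defs.Inn P \subset AutS S P.
Proof. by move=> PS; apply: morphimS; rewrite subsetI PS normG. Qed.

Lemma AutF_norm_Inn P : P \subset S -> AutF F P \subset 'N(Defs.Inn P).
Proof.
move=> PS; apply/subsetP=> a aA; rewrite inE.
apply/subsetP=> _ /imsetP[_ /morphimP[x _ xP ->] ->].
have Ia := AutF_iso PS aA.
have xN : x \in 'N_S(P) by rewrite inE (subsetP PS) // (subsetP (normG P)).
have axP : a x \in P by rewrite (iso_mem _ Ia).
have aN : a x \in 'N_S(P) by rewrite inE (subsetP PS) // (subsetP (normG P)).
rewrite (iffRL (conj_aut_J Ia xN aN)) ?mem_morphim // ?(subsetP (normG P)) //.
by move=> y yP; rewrite (isoJ fus Ia).
Qed.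

Section Step.
Variable Q : {group gT}.
Hypothesis QS : Q \proper S.
Hypothesis fnQ : fully_normalised S F Q.
Hypothesis IH : forall P R f, #|Q| < #|P| -> iso S F P R f -> gen P R f.

Lemma gen_extending a (N : {group gT}) : a \in AutF F Q -> Q \proper N ->
  N \subset nphi S Q Q a -> gen Q Q a.
Proof.
move=> aA QN Nn; have QS' := proper_sub QS; have Ia := AutF_iso QS' aA.
have [fn ext] := sat QS'; have [fc _] := fn fnQ.
have [N' [g [Ig ga]]] := ext _ _ Ia fc.
have QN' := proper_sub_trans QN Nn.
apply: (gen_ext ga); apply: (gen_sub fus _ _ (IH (proper_card QN') Ig)).
  exact: proper_sub.
by rewrite (eq_in_imset ga) (iso_im Ia).
Qed.

(** Automorphisms extending beyond Q are generated by induction. If C_S(Q) is not inside Q, all of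
    them extend to Q C_S(Q). Otherwise Q is centric, and the generated automorphisms form a group B
    containing Inn(Q). Let T be the image of Aut_S(Q) in Out_F(Q). Any x for which T meets T^x
    nontrivially comes from an automorphism that extends, so such x generate a subgroup of B/Inn(Q);
    were B proper, it would be strongly p-embedded, Q would be essential, and [C Q] would hold. *)
Lemma gen_AutF a : a \in AutF F Q -> gen Q Q a.
Proof.
have QS' := proper_sub QS; have [fn _] := sat QS'; have [fc fa] := fn fnQ.
move=> aA; have [CQ|nCQ] := classic (C Q).
  by have Ia := AutF_iso QS' aA; apply: gen_base CQ Ia (subxx _) (iso_im Ia).
have [cQ|ncQ] := boolP ('C_S(Q) \subset Q); last first.
  have sub : 'C_S(Q) \subset 'N_S(Q) by rewrite setIS // cent_sub.
  apply: (gen_extending (N := (Q <*> 'C_S(Q))%G) aA).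
    rewrite properE joing_subl; apply: contra ncQ => h.
    exact: subset_trans (joing_subr _ _) h.
  have Ia := AutF_iso QS' aA.
  rewrite join_subG (nphi_ge fus Ia) /=; apply/subsetP=> g gC; apply/(nphiP _ Ia).
  split; first exact: (subsetP sub).
  exists 1 => // x xQ; rewrite conjg1; congr (a _).
  by case/setIP: gC => _ /centP/(_ x xQ) cgx; rewrite /conjg -cgx mulKg.
have centr : fcentric S F Q.
  apply/(fcentricP fus QS') => R f If.
  have cR : #|'C_S(R)| <= #|'Z(R)|.
    rewrite (leq_trans ((fully_centralisedP fus QS').1 fc _ _ If)) //.
    rewrite (iso_card_center fus If) subset_leq_card //.
    by apply/subsetIP; split; [exact: cQ | apply: subsetIr].
  have ZR : 'Z(R) \subset 'C_S(R) by apply: setSI (isoSr fus If).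
  by have/eqP <- : 'Z(R) == 'C_S(R); [rewrite eqEcard ZR | exact: center_sub].
pose B := [set b in AutF F Q | asbool (gen Q Q b)].
have BE b : (b \in B) = (b \in AutF F Q) && asbool (gen Q Q b) by rewrite inE.
have extB b N : b \in AutF F Q -> Q \proper N -> N \subset nphi S Q Q b -> b \in B.
  by move=> bA QN Nn; rewrite BE bA; apply/asboolP; apply: gen_extending Nn.
have gB : group_set B.
  apply/group_setP; split=> [|b c].
    rewrite BE -(AutGE fus QS') group1; apply/asboolP.
    have I1 := iso_id fus (subxx S).
    exact: gen_base CS I1 QS' (perm_imset1 _).
  rewrite !BE => /andP[bA /asboolP gb] /andP[cA /asboolP gc].
  rewrite -(AutGE fus QS') groupM ?(AutGE fus QS') // andTb; apply/asboolP.
  exact: gen_comp gb gc.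
pose I := Defs.Inn Q; pose BG := Group gB.
have QN := norm_grows QS.
have IB : I \subset B.
  apply/subsetP=> b bI; have bA := subsetP (Inn_AutS QS') b bI.
  have bF := subsetP (AutS_sub fus QS') b bA.
  apply: (extB _ 'N_S(Q)%G) => //; apply: sub_nphi => //=.
  by rewrite [_ :^ b]conjGid.
have nI : AutF F Q \subset 'N(I) := AutF_norm_Inn QS'.
suff sub : AutF F Q \subset B by have := subsetP sub a aA; rewrite BE => /andP[_ /asboolP].
have BA : B \subset AutF F Q by apply/subsetP=> b; rewrite BE => /andP[].
apply/negPn/negP=> nAB; case: nCQ; apply: C_ess => //; split=> //.
pose T := (AutS_group S Q / I)%G.
have sylT : p.-Sylow(AutG F Q / I) T.
  apply: quotient_pHall; last by rewrite (AutGE fus QS').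
  by apply: subset_trans nI; rewrite -(AutGE fus QS') (AutGE fus QS') AutS_sub.
have QNnot g : g \in 'N_S(Q) -> (conj_aut Q g \in I) -> g \in Q.
  move=> gN /morphimP[x xN xQ e].
  have gxC : g * x^-1 \in 'C_S(Q).
    have gS : g \in S by case/setIP: gN.
    have xS := subsetP QS' x xQ.
    rewrite inE groupM ?groupV //=.
    have gNQ : g \in 'N(Q) by case/setIP: gN.
    rewrite -(ker_conj_aut Q); apply/kerP; first by rewrite groupM ?groupV.
    have h : conj_aut Q (g * x^-1) = conj_aut Q g * (conj_aut Q x)^-1.
      by rewrite morphM ?groupV // morphV.
    by apply: (etrans h); rewrite [conj_aut Q g]e mulgV.
  by rewrite -[g](mulgKV x) groupM // (subsetP cQ).
(* Some g in N_S(Q) lies outside Q, and conjugation by it is not inner because C_S(Q) lies in Q. *)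
have nT : T :!=: 1.
  have /properP[_ [g gN gQ]] := QN; apply/trivgPn; exists (coset I (conj_aut Q g)).
    by rewrite mem_morphim //; [apply: (subsetP nI); apply: (subsetP (AutS_sub fus QS')) | ];
      apply/AutSP; exists g.
  apply: contra gQ => /eqP h; apply: QNnot => //; apply: coset_idr => //.
  by apply: (subsetP nI); apply: (subsetP (AutS_sub fus QS')); apply/AutSP; exists g.
exists <<[set x in AutG F Q / I | T :&: T :^ x != 1]>>.
have -> : OutF F Q = AutG F Q / I by rewrite /OutF (AutGE fus QS').
apply: strongly_p_embedded_gen => //; apply: contra nAB => sub.
have <- := quotientSGK (G := BG) nI IB; rewrite -{1}(AutGE fus QS').
apply: subset_trans sub _; rewrite (gen_subG _ (BG / I)%G).
apply/subsetP=> x; rewrite inE => /andP[/morphimP[b bN bA ->] /trivgPn[t]].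
rewrite inE mem_conjg => /andP[tT t'T] nt1.
have [s' s'N s'A t'E] := morphimP t'T; have [s sN sA tE] := morphimP tT.
(* s' will be conjugation by some g outside Q; since b carries it into Aut_S(Q), b extends to the
   group generated by Q and g. *)
have sJ : s' ^ b \in AutS S Q.
  have : coset I (s' ^ b) = coset I s.
    by rewrite -tE morphJ // -t'E conjgKV.
  case/(kercoset_rcoset (groupJ s'N bN) sN)=> z zI ->.
  by rewrite groupM // (subsetP (Inn_AutS QS')).
have [g gN s'g] := AutSP _ _ _ s'A.
have gQ : g \notin Q.
  apply: contra nt1 => gQ; rewrite -(conjg_eq1 _ (coset I b)^-1).
  apply/eqP; apply: (etrans t'E); apply: coset_id; rewrite s'g.
  by rewrite mem_morphim //; case/setIP: gN.
apply: mem_quotient; apply: (extB _ (Q <*> <[g]>)%G).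
- by rewrite -(AutGE fus QS').
- rewrite properE joing_subl; apply: contra gQ => h.
  by rewrite (subsetP h) // (subsetP (joing_subr _ _)) // cycle_id.
have Ib : iso S F Q Q b by apply: AutF_iso => //; rewrite -(AutGE fus QS').
rewrite join_subG (nphi_ge fus Ib) cycle_subG; case/setIP: gN => gS gN.
apply/setIP; split=> //; apply/morphpreP; split=> //; rewrite mem_conjgV.
by apply: (set_in_eq sJ); rewrite s'g.
Qed.

End Step.

(** P and Q both reach a fully normalised R by morphisms defined on their normalisers, which are
    generated by induction; what remains of f is an automorphism of R. *)
Theorem alperin P Q f : iso S F P Q f -> gen P Q f.
Proof.
move: {2}(#|S| - #|P|).+1 (ltnSn (#|S| - #|P|)) => n.
elim: n P Q f => // n IHn P Q f ltn If; have PS := isoSl If; have QS := isoSr fus If.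
have [PeS|nPS] := eqVneq (P : {set gT}) S.
  have PeS' : P = S by apply: val_inj.
  have IfS : iso S F S Q f by rewrite -{2}PeS'.
  exact: gen_base CS IfS PS (iso_im If).
have pPS : P \proper S by rewrite properEneq nPS.
have IH P' R g : #|P| < #|P'| -> iso S F P' R g -> gen P' R g.
  move=> lt Ig; apply: IHn (Ig); rewrite ltnS in ltn; apply: leq_trans ltn.
  by apply: ltn_sub2l => //; apply: proper_card.
have cQ := iso_card If.
have pQS : Q \proper S by rewrite properEcard QS cQ proper_card.
have [R [h [Ih fnR]]] := fully_normalised_ex fus PS.
have RS := isoSr fus Ih; have cR := iso_card Ih.
have pRS : R \proper S by rewrite properEcard RS cR proper_card.
have [N1 [g1 [I1 g1P Ig1]]] := norm_extend fus pS Ih (sat RS) fnR.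
have Ih' := iso_trans fus (iso_inv fus If) Ih.
have [N2 [g2 [I2 g2P Ig2]]] := norm_extend fus pS Ih' (sat RS) fnR.
have G1 : gen P R g1.
  apply: (gen_sub fus (proper_sub (norm_grows pPS)) g1P); apply: (IH 'N_S(P)%G) I1.
  exact: proper_card (norm_grows pPS).
have G2 : gen Q R g2.
  apply: (gen_sub fus (proper_sub (norm_grows pQS)) g2P); apply: (IH 'N_S(Q)%G) I2.
  by rewrite -cQ; apply: proper_card (norm_grows pQS).
have -> : f = g1 * ((g1^-1 * f * g2) * g2^-1) by rewrite !mulgA mulgK mulgV mul1g.
apply: (gen_comp G1); apply: gen_comp (gen_inv fus C_iso G2).
have Ia : iso S F R R (g1^-1 * f * g2).
  have h1 := iso_trans fus (iso_inv fus Ig1) If; exact: (iso_trans fus h1 Ig2).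
apply: (gen_ext (restr_perm_eq Ia)).
apply: gen_AutF => //; last exact: (restr_perm_AutF fus Ia).
by move=> P' R' g; rewrite cR; apply: IH.
Qed.

End Alperin.

(** * Noncentric subgroups *)

Section Links.
Variables (gT : finGroupType) (p : nat).
Variables (S : {group gT}) (F : {set gT} -> {set mor gT}).
Hypothesis pS : p.-group S.
Hypothesis fus : is_fusion S F.
Implicit Types (P Q R N : {group gT}) (f : {perm gT}).
Local Notation iso := (iso S F).

(* The boolean b selects between moving subgroups around, which involves            *)
(* normalisers, and moving them with their embeddings, which involves centralisers. *)
Definition NC (b : bool) Q : {group gT} := if b then 'C_S(Q)%G else 'N_S(Q)%G.

Lemma NC_sub b Q : NC b Q \subset 'N_S(Q).
Proof. by case: b => //=; rewrite setIS // cent_sub. Qed.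

Lemma NC_norm b Q : 'N_S(Q) \subset 'N(NC b Q).
Proof.
case: b => /=; last exact: normG.
rewrite normsI //; first by rewrite subIset ?normG.
by rewrite subIset // cent_norm ?orbT.
Qed.

(** R is proper in the p-group generated by R and [NC b Q], so its normaliser there is larger; an
    element of it outside R is adjusted by R to lie in [NC b Q]. *)
Lemma NC_grows b Q R : R \subset 'N_S(Q) -> ~~ (NC b Q \subset R) ->
  exists m, [/\ m \in NC b Q, m \in 'N(R) & m \notin R].
Proof.
move=> RN nsub; have RM := subset_trans RN (NC_norm b Q).
have nilG : nilpotent (R <*> NC b Q).
  apply: nilpotentS (pgroup_nil pS); rewrite join_subG.
  by rewrite !(subset_trans _ (subsetIl S 'N(Q))) // NC_sub.
have pRG : R \proper R <*> NC b Q.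
  by rewrite properE joing_subl; apply: contra nsub; apply: subset_trans (joing_subr _ _).
have /properP[_ [g]] := nilpotent_proper_norm nilG pRG.
case/setIP; rewrite /= norm_joinEl // => /mulsgP[r m rR mM ->] gN gR.
have rN : r \in 'N(R) by rewrite (subsetP (normG R)).
exists m; split=> //; first by rewrite -(groupMl _ rN).
by apply: contra gR => mR; rewrite groupM.
Qed.

Definition stab_set (b : bool) R Q :=
  [set a in AutF F R | (a @: Q == Q) && (b ==> [forall x in Q, a x == x])].

Definition stab b R Q : {group {perm gT}} := <<stab_set b R Q>>%G.

Lemma stab_setP (b : bool) R Q a :
  reflect [/\ a \in AutF F R, a @: Q = Q & b -> {in Q, forall x, a x = x}]
          (a \in stab_set b R Q).
Proof.
rewrite [_ \in stab_set _ _ _]inE; apply: (iffP and3P) => [[aA /eqP aQ h]|[aA aQ h]].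
  by split=> // bT x xQ; move: h; rewrite bT => /forall_inP/(_ x xQ)/eqP.
split=> //; first exact/eqP.
by apply/implyP=> /h e; apply/forall_inP=> x /e/eqP.
Qed.

Lemma stabP (b : bool) R Q a : R \subset S ->
  reflect [/\ a \in AutF F R, a @: Q = Q & b -> {in Q, forall x, a x = x}]
          (a \in stab b R Q).
Proof.
move=> RS; have gs : group_set (stab_set b R Q).
  apply/group_setP; split=> [|u v /stab_setP[uA uQ uf] /stab_setP[vA vQ vf]].
    apply/stab_setP; rewrite -(AutGE fus RS) group1 perm_imset1; split=> // _ x _.
    by rewrite perm1.
  apply/stab_setP; rewrite -(AutGE fus RS) groupM ?(AutGE fus RS) //.
  split=> //; first by rewrite perm_imsetM uQ vQ.
  by move=> bT x xQ; rewrite permM uf // vf.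
have -> : (a \in stab b R Q) = (a \in stab_set b R Q) by rewrite /= gen_set_id.
exact: stab_setP.
Qed.

Lemma stab_sub b R Q : R \subset S -> stab b R Q \subset AutF F R.
Proof. by move=> RS; apply/subsetP=> a /stabP[]. Qed.

(* Links are the elementary steps from which the morphisms of a noncentric subgroup *)
(* are built: by step, they can be replaced by links defined on larger and larger   *)
(* groups, until these contain NC b Q.                                              *)
Definition link m Q Q' f := exists R R',
  [/\ iso R R' f, Q \subset R, R \subset 'N_S(Q), f @: Q = Q' & m < #|R|].

Lemma link_iso m Q Q' f : link m Q Q' f -> iso Q Q' f.
Proof. by case=> R [R' [If QR _ fQ _]]; apply: (iso_subE fus QR If fQ). Qed.

Lemma link_inv m Q Q' f : link m Q Q' f -> link m Q' Q f^-1.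
Proof.
case=> R [R' [If QR RN fQ lt]]; exists R', R; split.
- exact: (iso_inv fus If).
- by rewrite -fQ -(iso_im If) imsetS.
- exact: (iso_normal fus QR RN If fQ).
- by rewrite -fQ perm_imsetK.
by rewrite (iso_card If).
Qed.

(** The end state for links: a morphism defined on the whole normaliser. *)
Definition target Q Q' f := exists N, iso 'N_S(Q)%G N f /\ f @: Q = Q'.

Lemma sub_NS Q : Q \subset S -> Q \subset 'N_S(Q).
Proof. by move=> QS; rewrite subsetI QS normG. Qed.

Lemma target_id Q : target Q Q 1.
Proof.
by exists 'N_S(Q)%G; split; [apply: (iso_id fus); apply: subsetIl | rewrite perm_imset1]. Qed.

Lemma target_iso Q Q' f : Q \subset S -> target Q Q' f -> iso Q Q' f.
Proof. by move=> QS [N [If fQ]]; apply: (iso_subE fus (sub_NS QS) If fQ). Qed.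

Lemma target_trans P Q R f g : P \subset S -> target P Q f -> target Q R g ->
  target P R (f * g).
Proof.
move=> PS [N [If fP]] [N' [Ig gQ]].
have NN := iso_normal fus (sub_NS PS) (subxx _) If fP.
exists (img g N); split; last by rewrite perm_imsetM fP.
exact: (iso_trans fus If (iso_sub fus NN Ig)).
Qed.

Lemma link_target m Q Q' f A g A' g' : link m Q Q' f ->
  target Q A g -> target Q' A' g' -> link m A A' (g^-1 * f * g').
Proof.
move=> L T T'; have If := link_iso L; have QS := isoSl If.
case: L => R [R' [I1 QR RN fQ lt]].
case: T => N [Ig gQ]; case: T' => N' [Ig' gQ'].
have RN' := iso_normal fus QR RN I1 fQ.
have IgR := iso_sub fus RN Ig.
exists (img g R), (img g' R'); split.
- exact: (iso_trans fus (iso_trans fus (iso_inv fus IgR) I1) (iso_sub fus RN' Ig')).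
- by rewrite -gQ -(iso_im IgR) imsetS.
- exact: (iso_normal fus QR RN IgR gQ).
- by rewrite !perm_imsetM -gQ perm_imsetK fQ.
by rewrite (iso_card IgR).
Qed.

Lemma targets_link m Q A B f g : Q \subset S -> m < #|'N_S(Q)| ->
  target Q A f -> target Q B g -> link m A B (f^-1 * g).
Proof.
move=> QS lt [N [If fQ]] [N' [Ig gQ]]; exists N, N'; split.
- exact: (iso_trans fus (iso_inv fus If) Ig).
- by rewrite -fQ -(iso_im If) imsetS // sub_NS.
- exact: (iso_normal fus (sub_NS QS) (subxx _) If fQ).
- by rewrite perm_imsetM -fQ perm_imsetK.
by rewrite (iso_card If).
Qed.

Variable n : nat.
Hypothesis sat : forall R : {group gT}, R \subset S -> n < #|R| -> sat_at S F p R.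

(** The part M of [NC b Q1] normalising R acts on R as a p-group, which [de] carries into the
    stabiliser of Q. By [faut_pivot] and saturation at R, the morphism extends to R M, larger than R
    by [NC_grows]. As [be] serves all [de] and Q1 at once, morphisms from different Q1 end at the
    same subgroup. *)
Lemma pivot (b : bool) R Q : R \subset S -> n < #|R| -> fully_normalised S F R ->
    Q \subset R -> R \subset 'N_S(Q) ->
  exists2 be, be \in AutF F R & forall de Q1, de \in AutF F R -> de @: Q1 = Q ->
    ~~ (NC b Q1 \subset R) ->
    exists f, link #|R| Q1 (img be Q) f /\ (b -> {in Q1, f =1 de * be}).
Proof.
move=> RS nR fnR QR RN; have [fn ext] := sat RS nR; have [fc fa] := fn fnR.
have [be beA beP] := faut_pivot fus RS fa (stab_sub b Q RS).
exists be => // de Q1 deA deQ nsub.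
have Ide := AutF_iso RS deA; have Ibe := AutF_iso RS beA.
have Q1R : Q1 \subset R.
  by rewrite -(perm_imsetK de Q1) deQ -(iso_im (iso_inv fus Ide)) imsetS.
have RQ1 : R \subset 'N_S(Q1).
  have Qe : de^-1 @: Q = Q1 by rewrite -deQ perm_imsetK.
  exact: (iso_normal fus QR RN (iso_inv fus Ide) Qe).
pose M := (NC b Q1 :&: 'N(R))%G.
have MS : M \subset S by rewrite subIset // (subset_trans (NC_sub b Q1)) ?subsetIl.
have MR : M \subset 'N_S(R) by rewrite subsetI MS subsetIr.
pose K := (conj_aut R @* M)%G.
have KA : K \subset AutF F R.
  by apply: subset_trans (AutS_sub fus RS); apply: morphimS.
have pK : p.-group K by rewrite morphim_pgroup // (pgroupS MS).
have KW : K :^ de \subset stab b R Q.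
  apply/subsetP=> _ /imsetP[_ /morphimP[m mNR mM ->] ->]; apply/stabP => //.
  have kA : conj_aut R m \in AutF F R by rewrite (subsetP KA) // mem_morphim.
  have kE x : x \in Q1 -> conj_aut R m x = x ^ m.
    by move=> xQ; rewrite norm_conj_autE // (subsetP Q1R).
  have mNC : m \in NC b Q1 by case/setIP: mM.
  split.
  - by rewrite (AutF_J fus Ide) memJ_conjg.
  - have /setIP[_ mNQ] := subsetP (NC_sub b Q1) _ mNC.
    have e : conj_aut R m @: Q1 = Q1.
      by rewrite (eq_in_imset kE) -[RHS](normP mNQ).
    by rewrite conjgE !perm_imsetM -deQ perm_imsetK e.
  move=> bT y; rewrite -deQ => /imsetP[x xQ ->]; rewrite permJ kE //.
  move: mNC; rewrite bT => /setIP[_ /centP/(_ x xQ) cmx].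
  by rewrite conjgE -cmx mulKg.
have [|w wW Kw] := beP (K :^ de)%G KW; first by rewrite pgroupJ.
have /stabP[//|wA wQ wf] := wW; have Iw := AutF_iso RS wA.
have Ig : iso R R (de * (w * be)) := iso_trans fus Ide (iso_trans fus Iw Ibe).
have [N [g [IN gE]]] := ext _ _ Ig fc.
have Mn : M \subset nphi S R R (de * (w * be)).
  by apply: sub_nphi => //; rewrite conjsgM.
have Rn := nphi_ge fus Ig.
have RMn : R <*> M \subset nphi S R R (de * (w * be)) by rewrite join_subG Rn.
have Q1RM : Q1 \subset R <*> M := subset_trans Q1R (joing_subl _ _).
have gQ : g @: Q1 = img be Q.
  have -> : g @: Q1 = (de * (w * be)) @: Q1.
    by apply: eq_in_imset => x /(subsetP Q1R)/gE.
  by rewrite !perm_imsetM deQ wQ (imgE fus Ibe QR).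
exists g; split.
  exists (R <*> M)%G, (img g (R <*> M)%G); split=> //.
  - exact: (iso_sub fus RMn IN).
  - rewrite join_subG RQ1 /= subIset // NC_sub //.
  have [m [mNC mN mR]] := NC_grows RQ1 nsub.
  apply: proper_card; rewrite properE joing_subl; apply: contra mR => h.
  by rewrite (subsetP h) // (subsetP (joing_subr _ _)) // inE mNC.
move=> bT x xQ; rewrite gE ?(subsetP Q1R) // !permM wf // -deQ imset_f //.
Qed.

(** R and R' move to one fully normalised group by morphisms defined on their normalisers. There f
    becomes an automorphism, and [pivot], applied to the identity and to the inverse of that
    automorphism, joins the images of Q and Q' at a common subgroup. *)
Lemma step (b : bool) R R' Q Q' f : iso R R' f -> n < #|R| -> Q \subset R -> R \subset 'N_S(Q) ->
    f @: Q = Q' -> ~~ (NC b Q \subset R) -> ~~ (NC b Q' \subset R') ->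
  exists Q0 Q1 Q2 f0 f1 f2 f3,
    [/\ link #|R| Q Q0 f0, link #|R| Q0 Q1 f1, link #|R| Q2 Q1 f2,
        link #|R| Q' Q2 f3 & b -> {in Q, f * f3 * f2 =1 f0 * f1}].
Proof.
move=> If nR QR RN fQ nsub nsub'.
have RS := isoSl If; have RS' := isoSr fus If.
have [R0 [h [Ih fnR0]]] := fully_normalised_ex fus RS.
have RS0 := isoSr fus Ih; have nR0 : n < #|R0| by rewrite (iso_card Ih).
have [N [g [IN gR Ig]]] := norm_extend fus pS Ih (sat RS0 nR0) fnR0.
have Ih' := iso_trans fus (iso_inv fus If) Ih.
have [N' [g' [IN' gR' Ig']]] := norm_extend fus pS Ih' (sat RS0 nR0) fnR0.
have Q'R' : Q' \subset R' by rewrite -fQ -(iso_im If) imsetS.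
have RN' := iso_normal fus QR RN If fQ.
have aux (A B M : {group gT}) (k : {perm gT}) :
    A \subset B -> B \subset 'N_S(A) -> ~~ (NC b A \subset B) ->
    iso 'N_S(B)%G M k -> iso B R0 k -> #|B| = #|R| ->
    link #|R| A (img k A) k /\ ~~ (NC b (img k A) \subset R0).
  move=> AB BN ns Ik IkB cB; have [m [mNC mN mB]] := NC_grows BN ns.
  have mNA := subsetP (NC_sub b A) _ mNC.
  have mS : m \in S by case/setIP: mNA.
  have BS := isoSl IkB.
  have mNB : m \in 'N_S(B) by rewrite inE mS.
  have ANB : A \subset 'N_S(B) := subset_trans AB (sub_NS BS).
  split.
    have sub : B <*> <[m]> \subset 'N_S(B) by rewrite join_subG sub_NS // cycle_subG.
    exists (B <*> <[m]>)%G, (img k (B <*> <[m]>)%G); split.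
    - exact: (iso_sub fus sub Ik).
    - exact: subset_trans AB (joing_subl _ _).
    - by rewrite join_subG BN cycle_subG.
    - exact: (imgE fus Ik ANB).
    rewrite -cB proper_card // properE joing_subl; apply: contra mB => hh.
    by rewrite (subsetP hh) // (subsetP (joing_subr _ _)) // cycle_id.
  apply: contra mB => /subsetP/(_ (k m)); rewrite (iso_mem _ IkB); apply.
  have kS : k m \in S by rewrite (subsetP (isoSr fus Ik)) // (iso_mem _ Ik).
  case: (b) mNC => /setIP[_ mX]; rewrite inE kS /=.
    by rewrite (iso_cent fus Ik).
  by rewrite (iso_norm fus Ik).
have [L0 ns0] := aux _ _ _ _ QR RN nsub IN Ig erefl.
have [L3 ns3] := aux _ _ _ _ Q'R' RN' nsub' IN' Ig' (iso_card If).
have Q0R0 : img g Q \subset R0 by rewrite -(iso_img Ig) img_sub.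
have R0N : R0 \subset 'N_S(img g Q).
  exact: (iso_normal fus QR RN Ig (imgE fus Ig QR)).
have [be beA beP] := pivot b RS0 nR0 fnR0 Q0R0 R0N.
have cR0 : #|R0| = #|R| := iso_card Ih.
have id0 : (1 : {perm gT}) \in AutF F R0 by rewrite -(AutGE fus RS0) group1.
have [f1 [L1 f1E]] := beP 1 (img g Q) id0 (perm_imset1 _) ns0.
have Ia := iso_trans fus (iso_trans fus (iso_inv fus Ig') (iso_inv fus If)) Ig.
have raA := restr_perm_AutF fus Ia; have raE := restr_perm_eq Ia.
set a := g'^-1 * f^-1 * g in Ia raA raE.
have Q2R0 : img g' Q' \subset R0 by rewrite -(iso_img Ig') img_sub.
have raQ : restr_perm R0 a @: img g' Q' = img g Q.
  rewrite (_ : _ @: _ = a @: img g' Q'); last first.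
    by apply: eq_in_imset => x /(subsetP Q2R0)/raE.
  rewrite -(imgE fus Ig' Q'R') !perm_imsetM perm_imsetK -fQ perm_imsetK.
  exact: (imgE fus Ig QR).
have [f2 [L2 f2E]] := beP _ _ raA raQ ns3.
rewrite cR0 in L1 L2.
exists (img g Q), (img be (img g Q)), (img g' Q'), g, f1, f2, g'; split=> // bT x xQ.
have gx : g x \in img g Q by rewrite (mem_img fus _ Ig QR).
have fx : f x \in Q' by rewrite -fQ imset_f.
have gfx : g' (f x) \in img g' Q' by rewrite (mem_img fus _ Ig' Q'R').
rewrite !permM f2E // f1E // !permM perm1 raE ?(subsetP Q2R0) //.
by rewrite !permM !permK.
Qed.

End Links.

(** * Extending morphisms of noncentric subgroups to normalisers and centralisers *)

Section NoncentricExtension.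
Variables (gT : finGroupType) (p : nat).
Variables (S : {group gT}) (F : {set gT} -> {set mor gT}).
Hypothesis pS : p.-group S.
Hypothesis fus : is_fusion S F.
Implicit Types (A B D P Q R N X Y : {group gT}) (f g h k : {perm gT}).
Local Notation iso := (iso S F).
Local Notation gen := (gen (fcentric S F) S F).
Local Notation link := (link S F).
Local Notation target := (target S F).
Variable n : nat.
Hypothesis sat : forall R : {group gT}, R \subset S -> n < #|R| -> sat_at S F p R.
Hypothesis genF : forall P Q f, iso P Q f -> gen P Q f.

Definition common A B := exists D f g, target A D f /\ target B D g.

(** The two maps out of N_S(B) compose to a link between the two meeting subgroups, on a group of
    order above m; the hypothesis on links merges these. *)
Lemma common_trans m A B D : B \subset S -> A \subset S -> D \subset S -> m < #|'N_S(B)| ->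
  (forall X Y f, link m X Y f -> common X Y) -> common A B -> common B D -> common A D.
Proof.
move=> BS AS DS lt IH [X [f [g [Tf Tg]]]] [Y [f' [g' [Tf' Tg']]]].
have [Z [h [h' [Th Th']]]] := IH _ _ _ (targets_link fus BS lt Tg Tf').
exists Z, (f * h), (g' * h'); split; first exact: (target_trans fus AS Tf Th).
exact: (target_trans fus DS Tg' Th').
Qed.

Lemma link_sub m Q Q' f : link m Q Q' f -> Q \subset S /\ Q' \subset S.
Proof. by move/(link_iso fus)=> If; split; [apply: isoSl If | apply: (isoSr fus If)]. Qed.

(** Descending induction on m. If the link is defined on a full normaliser at either end, it or its
    inverse is a target; otherwise [step] replaces it by links on larger groups, chained by
    [common_trans]. *)
Lemma link_common m Q Q' f : n <= m -> link m Q Q' f -> common Q Q'.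
Proof.
move: {2}(#|S| - m) (leqnn (#|S| - m)) => d; elim: d m Q Q' f => [|d IH] m Q Q' f.
  rewrite leqn0 subn_eq0 => Sm _ [R [R' [If _ _ _ lt]]].
  have := subset_leq_card (isoSl If).
  by rewrite leqNgt (leq_ltn_trans Sm lt).
move=> dm nm L.
have IH' X Y k : link m.+1 X Y k -> common X Y.
  apply: IH; last exact: leqW.
  by rewrite subnS -ltnS; case: (_ - _) dm.
have [QS QS'] := link_sub L; case: (L) => R [R' [If QR RN fQ lt]].
have [lt'|] := ltnP m.+1 #|R|; first by apply: (IH' _ _ f); exists R, R'.
move=> le; have eR : #|R| = m.+1 by apply/eqP; rewrite eqn_leq le.
have RN' := iso_normal fus QR RN If fQ.
have [NR|nsub] := boolP (NC S false Q \subset R).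
  exists Q', f, 1; split; last exact: target_id.
  have e : R = 'N_S(Q)%G by apply: val_inj; apply/eqP; rewrite eqEsubset RN.
  by exists R'; rewrite -e.
have [NR|nsub'] := boolP (NC S false Q' \subset R').
  exists Q, 1, f^-1; split; first exact: target_id.
  have e : R' = 'N_S(Q')%G by apply: val_inj; apply/eqP; rewrite eqEsubset RN'.
  by exists R; rewrite -e -fQ perm_imsetK; split; first exact: (iso_inv fus If).
have nR : n < #|R| by rewrite eR ltnS.
have [Q0 [Q1 [Q2 [f0 [f1 [f2 [f3 [L0 L1 L2 L3 _]]]]]]]] :=
  step pS fus sat If nR QR RN fQ nsub nsub'.
have NS X Y k : link #|R| X Y k -> m.+1 < #|'N_S(X)|.
  case=> B [B' [_ _ BN _]]; rewrite eR => ltB.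
  exact: leq_trans ltB (subset_leq_card BN).
have L3' := link_inv fus L3; have L1' := link_inv fus L1; have L2' := link_inv fus L2.
have [S0 S1] := link_sub L1; have [S2 _] := link_sub L2.
have c3 : common Q2 Q' by apply: (IH' _ _ f3^-1); rewrite -eR.
have c2 : common Q1 Q2 by apply: (IH' _ _ f2^-1); rewrite -eR.
have c1 : common Q0 Q1 by apply: (IH' _ _ f1); rewrite -eR.
have c0 : common Q Q0 by apply: (IH' _ _ f0); rewrite -eR.
apply: (common_trans S0 QS QS' (NS _ _ _ L1) IH' c0).
apply: (common_trans S1 S0 QS' (NS _ _ _ L2') IH' c1).
exact: (common_trans S2 S1 QS' (NS _ _ _ L2) IH' c2 c3).
Qed.

Lemma proper_of_noncentric P : P \subset S -> ~ fcentric S F P -> P \proper S.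
Proof.
move=> PS nc; rewrite properEneq PS andbT; apply/eqP=> PeS; apply: nc.
have -> : P = S by apply: val_inj.
apply/(fcentricP fus (subxx S)) => Q f If.
have -> : Q :=: S; last exact: subsetIl.
by apply/eqP; rewrite eqEcard (isoSr fus If) (iso_card If) /=.
Qed.

Lemma noncentric_iso P Q f : iso P Q f -> ~ fcentric S F P -> ~ fcentric S F Q.
Proof. by move=> If nc /(fcentric_iso fus (iso_inv fus If)). Qed.

(** A noncentric P is proper in R, so N_R(P) is larger than P. *)
Lemma base_link P Q R R' f : fcentric S F R -> iso R R' f -> P \subset R -> f @: P = Q ->
  ~ fcentric S F P -> link #|P| P Q f.
Proof.
move=> cR If PR fP nc; have RS := isoSl If.
have pPR : P \proper R.
  rewrite properEneq PR andbT; apply/eqP=> PeR; apply: nc.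
  by have -> : P = R by apply: val_inj.
have NR : 'N_R(P) \subset R := subsetIl _ _.
exists 'N_R(P)%G, (img f 'N_R(P)%G); split=> //.
- exact: (iso_sub fus NR If).
- by rewrite subsetI PR normG.
- exact: setSI.
exact: proper_card (nilpotent_proper_norm (pgroup_nil (pgroupS RS pS)) pPR).
Qed.

Lemma gen_common P Q f : gen P Q f -> #|P| = n -> ~ fcentric S F P -> common P Q.
Proof.
elim=> {P Q f} [P Q R R' f cR If PR fP|P Q R f g g1 IH1 g2 IH2|P Q f g _ _ IH] //.
  move=> Pn nc; apply: link_common (base_link cR If PR fP nc).
  by rewrite Pn.
move=> Pn nc; have If := gen_iso fus g1; have Ig := gen_iso fus g2.
have ncQ := noncentric_iso If nc; have cQ : #|Q| = n by rewrite (iso_card If).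
apply: (common_trans (isoSl Ig) (isoSl If) (isoSr fus Ig) (m := n) _ _ (IH1 Pn nc) (IH2 cQ ncQ)).
  rewrite -cQ; apply: proper_card; apply: (nilpotent_proper_norm (pgroup_nil pS)).
    exact: (proper_of_noncentric (isoSl Ig)).
move=> X Y k; exact: link_common.
Qed.

Section FullyNormalised.
Variable P : {group gT}.
Hypothesis PS : P \subset S.
Hypothesis cP : #|P| = n.
Hypothesis ncP : ~ fcentric S F P.
Hypothesis fnP : fully_normalised S F P.

Lemma norm_target Q f : iso Q P f -> exists g, target Q P g.
Proof.
move=> If; have QS := isoSl If.
have ncQ : ~ fcentric S F Q := noncentric_iso (iso_inv fus If) ncP.
have cQ : #|Q| = n by rewrite -cP (iso_card If).
have [D [g [h [Tg [N [Ih hP]]]]]] := gen_common (genF If) cQ ncQ.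
exists (g * h^-1); apply: (target_trans fus QS Tg).
have NN := iso_normal fus (sub_NS PS) (subxx _) Ih hP.
have IPD := iso_subE fus (sub_NS PS) Ih hP.
have eN : N = 'N_S(D)%G.
  apply: val_inj; apply/eqP; rewrite eqEcard NN (iso_card Ih).
  exact: ((fully_normalisedP fus PS).1 fnP _ _ IPD).
exists 'N_S(P)%G; rewrite -eN; split; first exact: (iso_inv fus Ih).
by rewrite -hP perm_imsetK.
Qed.

Lemma fcent_of_fnorm : fully_centralised S F P.
Proof.
apply/(fully_centralisedP fus PS) => Q f If.
have [g [N [Ig gQ]]] := norm_target (iso_inv fus If).
have QS := isoSr fus If.
have Qi : img g Q = P by apply: val_inj; rewrite /= gQ genGid.
rewrite -(card_imset _ (@perm_inj _ g)); apply: subset_leq_card.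
apply/subsetP=> _ /imsetP[x xC ->].
have xN : x \in 'N_S(Q) by rewrite (subsetP _ x xC) // setIS // cent_sub.
rewrite inE (subsetP (isoSr fus Ig)) ?(iso_mem _ Ig) //= -Qi.
by rewrite (iso_cent fus Ig (sub_NS QS) xN); case/setIP: xC.
Qed.

Definition PC Q : {group gT} := (Q <*> 'C_S(Q))%G.

Definition good f := exists g, iso (PC P) (PC P) g /\ {in P, g =1 f}.

Lemma PC_sub_NS Q : Q \subset S -> PC Q \subset 'N_S(Q).
Proof. by move=> QS; rewrite join_subG sub_NS //= setIS // cent_sub. Qed.

Lemma good_mul f g : iso P P f -> good f -> good g -> good (f * g).
Proof.
move=> If [f' [If' fE]] [g' [Ig' gE]]; exists (f' * g'); split.
  exact: (iso_trans fus If' Ig').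
by move=> x xP; rewrite !permM fE // gE // (iso_mem _ If).
Qed.

Lemma good_inv f : iso P P f -> good f -> good f^-1.
Proof.
move=> If [f' [If' fE]]; exists f'^-1; split; first exact: (iso_inv fus If').
move=> x xP; apply: (@perm_inj _ f'); rewrite permKV fE ?permKV //.
by rewrite (iso_mem _ (iso_inv fus If)).
Qed.

Lemma good_ext f g : {in P, f =1 g} -> good f -> good g.
Proof. by move=> fg [h [Ih hE]]; exists h; split=> // x xP; rewrite hE ?fg. Qed.

Lemma good_big R R' f : iso R R' f -> P \subset R -> f @: P = P -> 'C_S(P) \subset R -> good f.
Proof.
move=> If PR fP CR; have PCR : PC P \subset R by rewrite join_subG PR.
have Ig := iso_sub fus PCR If; exists f; split=> //.
have Pi : img f P = P by apply: val_inj; rewrite /= fP genGid.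
suff e : img f (PC P) = PC P by rewrite -{2}e.
apply: val_inj; apply/eqP; rewrite eqEcard (iso_card Ig) leqnn andbT.
apply/subsetP=> y yI; have : y \in f @: PC P by rewrite (iso_im Ig).
case/imsetP=> x xPC ->; move: xPC; rewrite /= cent_joinEr ?subsetIr // => /mulsgP[u v uP vC ->].
rewrite (isoM fus If) ?(subsetP PR u) ?(subsetP CR v) // mem_mulg //.
  by rewrite -fP imset_f.
have vR := subsetP CR v vC; rewrite inE (subsetP (isoSr fus If)) ?(iso_mem _ If) //=.
by rewrite -Pi (iso_cent fus If PR vR); case/setIP: vC.
Qed.

(** The induction of [link_common] with centralisers, where the identity in [step] matters: composed
    with targets from the intermediate subgroups to P, the four links become automorphisms of P
    covered by induction, and f is a product of these and their inverses. *)
Lemma good_link m f : n <= m -> link m P P f -> good f.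
Proof.
move: {2}(#|S| - m) (leqnn (#|S| - m)) => d; elim: d m f => [|d IH] m f.
  rewrite leqn0 subn_eq0 => Sm _ [R [R' [If _ _ _ lt]]].
  have := subset_leq_card (isoSl If).
  by rewrite leqNgt (leq_ltn_trans Sm lt).
move=> dm nm L; have IPf := link_iso fus L; case: (L) => R [R' [If PR RN fP lt]].
have PR' : P \subset R' by rewrite -fP -(iso_im If) imsetS.
have fVP : f^-1 @: P = P by rewrite -{1}fP perm_imsetK.
have [CR|nsub] := boolP (NC S true P \subset R); first exact: good_big If PR fP CR.
have [CR|nsub'] := boolP (NC S true P \subset R').
  rewrite -[f]invgK; apply: good_inv; first exact: (iso_inv fus).
  exact: good_big (iso_inv fus If) PR' fVP CR.
have nR : n < #|R| := leq_ltn_trans nm lt.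
have [Q0 [Q1 [Q2 [f0 [f1 [f2 [f3 [L0 L1 L2 L3 fE]]]]]]]] :=
  step pS fus sat If nR PR RN fP nsub nsub'.
have I0 := link_iso fus L0; have I1 := link_iso fus L1.
have I2 := link_iso fus L2; have I3 := link_iso fus L3.
have [h0 T0] := norm_target (iso_inv fus I0).
have [h1 T1] := norm_target (iso_inv fus (iso_trans fus I0 I1)).
have [h2 T2] := norm_target (iso_inv fus I3).
have TP := target_id fus P.
have G X Y k k' l : link #|R| X Y l -> target X P k -> target Y P k' ->
    iso P P (k^-1 * l * k') /\ good (k^-1 * l * k').
  move=> Ll Tk Tk'; have Ll' := link_target fus Ll Tk Tk'; split.
    exact: (link_iso fus Ll').
  apply: IH Ll'; last exact: ltnW.
  rewrite -ltnS (leq_trans _ dm) // ltn_sub2l // (leq_trans lt) //.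
  by rewrite subset_leq_card // (isoSl If).
have [J0 G0] := G _ _ _ _ _ L0 TP T0.
have [J1 G1] := G _ _ _ _ _ L1 T0 T1.
have [J2 G2] := G _ _ _ _ _ L2 T2 T1.
have [J3 G3] := G _ _ _ _ _ L3 TP T2.
have G01 := good_mul J0 G0 G1; have G32 := good_mul J3 G3 G2.
have J01 := iso_trans fus J0 J1; have J32 := iso_trans fus J3 J2.
apply: good_ext (good_mul J01 G01 (good_inv J32 G32)) => x xP.
have e := fE isT x xP; rewrite !permM in e.
rewrite invg1 !mul1g !mulgA !mulgK !invMg !mulgA mulgK.
by rewrite !permM -e !permK.
Qed.

Lemma gen_good Q Q' f : gen Q Q' f -> #|Q| = n -> ~ fcentric S F Q ->
  forall h h', target Q P h -> target Q' P h' -> good (h^-1 * f * h').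
Proof.
elim=> {Q Q' f} [Q Q' R R' f cR If QR fQ|Q Q' Q'' f g g1 IH1 g2 IH2|
  Q Q' f g fg g1 IH] cQ nc h h' Th Th'.
- apply: (@good_link n) => //; apply: (link_target fus _ Th Th').
  by rewrite -cQ; apply: base_link cR If QR fQ nc.
- have If := gen_iso fus g1; have Ig := gen_iso fus g2.
  have QS := isoSl If; have IhQ := target_iso fus QS Th.
  have [k Tk] := norm_target (iso_trans fus (iso_inv fus If) IhQ).
  have ncQ' := noncentric_iso If nc; have cQ' : #|Q'| = n by rewrite (iso_card If).
  have IkQ := target_iso fus (isoSl Ig) Tk.
  have J := iso_trans fus (iso_trans fus (iso_inv fus IhQ) If) IkQ.
  have := good_mul J (IH1 cQ nc _ _ Th Tk) (IH2 cQ' ncQ' _ _ Tk Th').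
  by rewrite !mulgA mulgK.
have QS := isoSl (gen_iso fus g1); have IhQ := target_iso fus QS Th.
apply: good_ext (IH cQ nc _ _ Th Th') => x xP.
by rewrite !permM fg // (iso_mem _ (iso_inv fus IhQ)).
Qed.

Lemma iso_good f : iso P P f -> good f.
Proof.
move=> If; have TP := target_id fus P.
by have := gen_good (genF If) cP ncP TP TP; rewrite mulg1 invg1 mul1g.
Qed.

End FullyNormalised.
End NoncentricExtension.

(** * Saturation at noncentric subgroups *)

Section NoncentricSaturation.
Variables (gT : finGroupType) (p : nat).
Variables (S : {group gT}) (F : {set gT} -> {set mor gT}).
Hypothesis pS : p.-group S.
Hypothesis fus : is_fusion S F.
Implicit Types (A B D P Q R N X Y : {group gT}) (f g h k : {perm gT}).
Local Notation iso := (iso S F).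
Local Notation gen := (gen (fcentric S F) S F).
Local Notation target := (target S F).
Variable n : nat.
Hypothesis sat : forall R : {group gT}, R \subset S -> n < #|R| -> sat_at S F p R.
Hypothesis genF : forall P Q f, iso P Q f -> gen P Q f.
Local Notation PC := (PC S).

Section FullyNormalised.
Variable P : {group gT}.
Hypothesis PS : P \subset S.
Hypothesis cP : #|P| = n.
Hypothesis ncP : ~ fcentric S F P.
Hypothesis fnP : fully_normalised S F P.

Let fcP : fully_centralised S F P := fcent_of_fnorm pS fus sat genF PS cP ncP fnP.
Local Notation R := (PC P).

Lemma PC_subS Q : Q \subset S -> PC Q \subset S.
Proof. by move=> QS; rewrite (subset_trans (PC_sub_NS QS)) ?subsetIl. Qed.

Let RS := PC_subS PS.

(** If C_S(P) were inside P, full centralisation would force the centraliser of every conjugate into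
    its centre, and P would be centric. *)
Lemma PC_card : n < #|R|.
Proof.
rewrite ltnNge; apply/negP=> le; apply: ncP; apply/(fcentricP fus PS) => Q f If.
have QS := isoSr fus If.
have PeR : P :=: R by apply/eqP; rewrite eqEcard joing_subl cP.
have CP : 'C_S(P) \subset P by rewrite {2}PeR joing_subr.
have cC : #|'C_S(Q)| <= #|'Z(Q)|.
  rewrite (leq_trans ((fully_centralisedP fus PS).1 fcP _ _ If)) //.
  rewrite (iso_card_center fus If) subset_leq_card //.
  by apply/subsetIP; split; [exact: CP | apply: subsetIr].
have ZC : 'Z(Q) \subset 'C_S(Q) by apply: setSI.
by have/eqP <- : 'Z(Q) == 'C_S(Q); [rewrite eqEcard ZC | exact: center_sub].
Qed.

(** As P is fully centralised, f maps C_S(P) onto the centraliser of the image of P; this lies in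
    the image of R and contains the centraliser of that image. *)
Lemma PC_centric : fcentric S F R.
Proof.
apply/(fcentricP fus RS) => Q f If.
have PR := joing_subl P 'C_S(P).
have IP := iso_sub fus PR If; set P' := img f P in IP.
have CR := joing_subr P 'C_S(P).
have sub : f @: 'C_S(P) \subset 'C_S(P').
  apply/subsetP=> _ /imsetP[x xC ->]; have xR := subsetP CR x xC.
  rewrite inE (subsetP (isoSr fus If)) ?(iso_mem _ If) //=.
  by rewrite (iso_cent fus If PR xR); case/setIP: xC.
have eC : f @: 'C_S(P) = 'C_S(P').
  apply/eqP; rewrite eqEcard sub card_imset; last exact: perm_inj.
  exact: ((fully_centralisedP fus PS).1 fcP _ _ IP).
apply: subset_trans (_ : 'C_S(P') \subset Q).
  by rewrite setIS // centS // -(iso_img If) img_sub.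
by rewrite -eC -(iso_im If) imsetS.
Qed.

Let T0 : {group {perm gT}} := (conj_aut R @* 'N_S(P))%G.

Lemma NSP_NR : 'N_S(P) \subset 'N_S(R).
Proof.
rewrite subsetI subsetIl /= normsY //; first exact: subsetIr.
by rewrite normsI ?(subset_trans (subsetIl _ _) (normG S)) //
  (subset_trans (subsetIr _ _)) ?cent_norm.
Qed.

Let sPR : P \subset R := joing_subl _ _.

Lemma conj_autR (g x : gT) : g \in 'N_S(P) -> x \in R -> conj_aut R g x = x ^ g.
Proof. by move=> /(subsetP NSP_NR)/setIP[_ gN] xR; rewrite norm_conj_autE. Qed.

Lemma T0_AutS : T0 \subset AutS S R.
Proof. exact: morphimS NSP_NR. Qed.

Lemma T0_stab : T0 \subset stab F false R P.
Proof.
apply/subsetP=> a aT; apply/(stabP fus) => //; split=> //.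
  by rewrite (subsetP (AutS_sub fus RS)) // (subsetP T0_AutS).
have /morphimP[g _ gN ->] := aT; have /setIP[_ gNP] := gN.
rewrite (_ : _ @: P = P :^ g); first exact: (normP gNP).
by apply: eq_in_imset => x /(subsetP sPR) xR; rewrite conj_autR.
Qed.

Lemma T0_pgroup : p.-group T0.
Proof. by rewrite morphim_pgroup // (pgroupS _ pS) // subsetIl. Qed.

Lemma card_conj_aut_NS Q (X : {group gT}) : Q \subset S ->
    'C_S(X) \subset 'N_S(Q) -> 'N_S(Q) \subset 'N(X) ->
  (#|conj_aut X @* 'N_S(Q)| * #|'C_S(X)| = #|'N_S(Q)|)%N.
Proof.
move=> QS sub nX; rewrite card_morphim ker_conj_aut (setIidPr nX) -indexgI.
rewrite (_ : 'N_S(Q) :&: 'C(X) = 'C_S(X)); first by rewrite mulnC Lagrange.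
apply/eqP; rewrite eqEsubset setSI ?subsetIl //=.
by rewrite subsetI sub subsetIr.
Qed.

(** A Sylow subgroup T of the stabiliser is realised inside N_S(P') on a fully normalised conjugate
    R' of R, P' being the image of P. Hence |T| is at most |N_S(P')| / |C_S(R')|, which full
    normalisation of P bounds by |N_S(P)| / |C_S(R)|, the order of [T0]. *)
Lemma T0_Sylow : p.-Sylow(stab F false R P) T0.
Proof.
have [R' [f [If fnR']]] := fully_normalised_ex fus RS.
have RS' := isoSr fus If; have nR' : n < #|R'| by rewrite (iso_card If) PC_card.
have [fn _] := sat RS' nR'; have [_ fa] := fn fnR'.
have [T sylT] := Sylow_exists p (stab F false R P).
have TA : T \subset AutF F R := subset_trans (pHall_sub sylT) (stab_sub fus _ _ RS).
have [b bA Tb] := faut_adjust fus fa If TA (pHall_pgroup sylT).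
have Ig := iso_trans fus If (AutF_iso RS' bA); set g := f * b in Ig Tb.
have IP := iso_sub fus sPR Ig; set P' := img g P in IP.
have PR' : P' \subset R' by rewrite -(iso_img Ig) img_sub.
have cR' := fcentric_iso fus Ig PC_centric.
have CR' : 'C_S(R') \subset R' := (fcentricP fus RS').1 cR' _ _ (iso_id fus RS').
have CR : 'C_S(R) \subset R := (fcentricP fus RS).1 PC_centric _ _ (iso_id fus RS).
have cC : #|'C_S(R')| = #|'C_S(R)|.
  have ZE (X : {group gT}) : X \subset S -> 'C_S(X) \subset X -> 'C_S(X) = 'Z(X).
    move=> XS CX; apply/eqP; rewrite eqEsubset; apply/andP; split; last exact: setSI.
    by apply/subsetIP; split; [exact: CX | apply: subsetIr].
  by rewrite (ZE R' RS' CR') (ZE R RS CR) (iso_card_center fus Ig).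
have R'N : R' \subset 'N_S(P').
  exact: (iso_normal fus sPR (PC_sub_NS PS) Ig (imgE fus Ig sPR)).
have RN : R \subset 'N_S(P) := PC_sub_NS PS.
pose M := ('N_S(P') :&: 'N(R'))%G.
have TM : T :^ g \subset conj_aut R' @* M.
  apply/subsetP=> a aT; have /AutSP[h hN ae] := subsetP Tb a aT.
  have [hS hNR] := setIP hN; rewrite ae mem_morphim //.
  rewrite inE hNR andbT inE hS /=; apply/normP.
  have /imsetP[t tT at_] := aT.
  have /(stabP fus) [//|tA tP _] := subsetP (pHall_sub sylT) t tT.
  have <- : a @: P' = P' :^ h.
    by apply: eq_in_imset => x /(subsetP PR') xR; rewrite ae norm_conj_autE.
  have gP : g @: P = P' := imgE fus Ig sPR.
  have e : (t ^ g) @: (g @: P) = g @: P.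
    by rewrite conjgE (perm_imsetM g^-1) perm_imsetK perm_imsetM tP.
  by rewrite gP -at_ in e.
have cT : #|T| <= #|T0|.
  rewrite -(cardJg T g) (leq_trans (subset_leq_card TM)) //.
  have CRpos : 0 < #|'C_S(R)| := cardG_gt0 _.
  have e0 := card_conj_aut_NS PS (subset_trans CR RN) (subset_trans NSP_NR (subsetIr _ _)).
  rewrite -(leq_pmul2r CRpos) e0.
  rewrite -cC card_morphim ker_conj_aut.
  rewrite (setIidPr (subsetIr _ _)) -indexgI.
  have CM : 'C_S(R') \subset M.
    by rewrite (subset_trans CR') // subsetI R'N normG.
  have -> : M :&: 'C(R') = 'C_S(R').
    apply/setP=> x; apply/setIP/setIP=> [[/setIP[/setIP[xS _] _] xC]|[xS xC]] //.
    by split=> //; apply: (subsetP CM); rewrite inE xS.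
  rewrite mulnC Lagrange //.
  rewrite (leq_trans (subset_leq_card (subsetIl _ _))) //.
  exact: ((fully_normalisedP fus PS).1 fnP _ _ IP).
exact: Sylow_of_card sylT T0_stab T0_pgroup cT.
Qed.

Lemma stab_astabs : stab F false R P \subset 'N(P | 'P).
Proof.
apply/subsetP=> a /(stabP fus) [//|aA aP _].
by apply/astabsP=> x /=; rewrite apermE -{1}aP mem_imset //; apply: perm_inj.
Qed.

Lemma restr_stab a : a \in stab F false R P -> {in P, restr_perm P a =1 a}.
Proof. by move=> aS x xP; apply: restr_permE => //; apply: (subsetP stab_astabs). Qed.

Lemma iso_extends_PC f : iso P P f ->
  exists2 a, a \in stab F false R P & {in P, a =1 f}.
Proof.
move=> If; have [g [Ig gE]] := iso_good pS fus sat genF PS cP ncP fnP If.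
have aE x : x \in P -> restr_perm R g x = f x.
  by move=> xP; rewrite (restr_perm_eq Ig) ?(subsetP sPR) // gE.
exists (restr_perm R g) => //; apply/(stabP fus) => //; split=> //.
  exact: (restr_perm_AutF fus Ig).
by rewrite (eq_in_imset aE) (iso_im If).
Qed.

(** Restriction to P maps the stabiliser of P in Aut_F(R) onto Aut_F(P) and [T0] onto Aut_S(P), and
    images of Sylow subgroups are Sylow. *)
Lemma faut_of_fnorm : fully_automised p S F P.
Proof.
have im1 : restr_perm P @* stab F false R P = AutF F P.
  apply/setP=> f; apply/morphimP/idP=> [[a aN aS ->]|fA].
    have /(stabP fus) [//|aA aP _] := aS.
    have Ia := iso_subE fus sPR (AutF_iso RS aA) aP.
    exact: (restr_perm_AutF fus Ia).
  have If := AutF_iso PS fA; have [a aS aE] := iso_extends_PC If.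
  exists a => //; first by rewrite (subsetP stab_astabs).
  apply/permP=> x; have [xP|xP] := boolP (x \in P); first by rewrite restr_stab // aE.
  by rewrite (out_perm (AutF_on fA)) // (out_perm (restr_perm_on _ _)).
have im2 : restr_perm P @* T0 = AutS S P.
  have cE a (g : gT) : g \in 'N_S(P) -> a = conj_aut R g -> restr_perm P a = conj_aut P g.
    move=> gN ae; have aS : a \in stab F false R P.
      by rewrite (subsetP T0_stab) // ae mem_morphim //; have /setIP[] := subsetP NSP_NR g gN.
    have gNP : g \in 'N(P) by case/setIP: gN.
    apply/permP=> x; have [xP|xP] := boolP (x \in P).
      by rewrite restr_stab // ae conj_autR ?(subsetP sPR) // norm_conj_autE.
    by rewrite (out_perm (conj_aut_on gNP)) // (out_perm (restr_perm_on _ _)).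
  apply/setP=> f; apply/morphimP/AutSP=> [[a aN /morphimP[g _ gN ae] ->]|[g gN ->]].
    by exists g => //; apply: cE.
  have aT : conj_aut R g \in T0.
    by rewrite mem_morphim //; have /setIP[] := subsetP NSP_NR g gN.
  exists (conj_aut R g) => //; last by symmetry; apply: cE.
  by rewrite (subsetP stab_astabs) // (subsetP T0_stab).
rewrite /fully_automised -im1 -im2; apply: morphim_pHall T0_Sylow.
exact: subset_trans T0_stab stab_astabs.
Qed.

(* The subgroup Aut_{N_S(P)}(R), R = P C_S(P), is Sylow in the stabiliser of P, so   *)
(* an extension of f to R can be corrected by an automorphism that is trivial on P  *)
(* to send Aut_{N_f}(R) into Aut_S(R); saturation at R > P then applies.            *)
Lemma extends_auto f : iso P P f -> extends S F P P f.
Proof.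
move=> If; have [a aS aE] := iso_extends_PC If.
have /(stabP fus) [//|aA aP _] := aS.
pose G := stab F true R P; pose N := nphi S P P f.
have NN : N \subset 'N_S(P) := nphi_sub _ _ _ _.
have GS : G \subset stab F false R P.
  by apply/subsetP=> b /(stabP fus)[//|bA bP _]; apply/(stabP fus).
have nG : stab F false R P \subset 'N(G).
  apply/subsetP=> b bS; rewrite inE; apply/subsetP=> _ /imsetP[c cG ->].
  have /(stabP fus) [//|bA bP _] := bS; have /(stabP fus) [//|cA cP' cf] := cG.
  have cS := subsetP GS c cG.
  have /(stabP fus) [//|dA dP _] := groupJ cS bS; apply/(stabP fus) => //.
  split=> // _ x; rewrite -bP => /imsetP[y yP ->].
  by rewrite permJ cf.
have T0N : T0 \subset 'N(G) := subset_trans T0_stab nG.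
pose D := (conj_aut R @* N)%G.
have NR : N \subset 'N_S(R) := subset_trans NN NSP_NR.
have DT0 : D \subset T0 by apply: morphimS.
have DG : D :^ a \subset G <*> T0.
  rewrite norm_joinEr //; apply/subsetP=> _ /imsetP[_ /morphimP[g gNR gN ->] ->].
  have /(nphiP _ If) [gP [h hP ghE]] := gN.
  have dT : conj_aut R g \in T0.
    by rewrite mem_morphim //; have /setIP[] := subsetP NSP_NR g gP.
  have hT : conj_aut R h \in T0.
    by rewrite mem_morphim //; have /setIP[] := subsetP NSP_NR h hP.
  have dS := subsetP T0_stab _ dT; have hS := subsetP T0_stab _ hT.
  rewrite -[_ ^ a](mulgKV (conj_aut R h)) mem_mulg //.
  have uS : conj_aut R g ^ a * (conj_aut R h)^-1 \in stab F false R P.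
    by rewrite groupM ?groupV ?groupJ.
  have /(stabP fus) [//|uA uP _] := uS; apply/(stabP fus) => //; split=> // _ x.
  have afP : a @: P = P by rewrite aP.
  rewrite -{1}aP => /imsetP[y yP ->]; rewrite permM permJ conj_autR ?(subsetP sPR) //.
  have ygP : y ^ g \in P by rewrite memJ_norm //; case/setIP: gP.
  rewrite aE // ghE // aE //.
  have fyP : f y \in P by rewrite (iso_mem _ If).
  by rewrite -(conj_autR hP) ?permK // (subsetP sPR).
have sylT : p.-Sylow(G <*> T0) T0.
  apply: pHall_subl T0_Sylow; first exact: joing_subr.
  by rewrite join_subG GS T0_stab.
have [|x xG Dx] := Sylow_Jsub (Q := (D :^ a)%G) sylT DG.
  by rewrite pgroupJ (pgroupS DT0) ?T0_pgroup.
move: xG; rewrite /= norm_joinEr // => /mulsgP[w t wG tT xE].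
have Dw : D :^ (a * w) \subset T0.
  by move: Dx; rewrite xE -conjsgM mulgA conjsgM sub_conjg (conjGid (groupVr tT)).
have /(stabP fus) [//|wA wP wf] := wG.
have Ia := AutF_iso RS aA; have Iw := AutF_iso RS wA.
have Iaw := iso_trans fus Ia Iw.
have [_ ext] := sat RS PC_card.
have [N' [g [Ig gE]]] := ext _ _ Iaw (fcentric_fcent fus RS PC_centric).
have Nn : N \subset nphi S R R (a * w).
  by apply: sub_nphi => //; apply: subset_trans Dw T0_AutS.
exists (img g N), g; split; first exact: (iso_sub fus Nn Ig).
move=> x' xP; rewrite gE ?(subsetP sPR) // permM aE // wf //.
by rewrite (iso_mem _ If).
Qed.

End FullyNormalised.

(** For the extension axiom, f is transported to an automorphism of a fully normalised conjugate,
    extended there, and carried back. *)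
Theorem noncentric_sat P : P \subset S -> #|P| = n -> ~ fcentric S F P -> sat_at S F p P.
Proof.
move=> PS cP ncP; split=> [fnP|Q f If fcP].
  split; last exact: faut_of_fnorm.
  exact: (fcent_of_fnorm pS fus sat genF PS cP ncP fnP).
have [P0 [f0 [I0 fn0]]] := fully_normalised_ex fus PS.
have PS0 := isoSr fus I0; have nc0 := noncentric_iso fus I0 ncP.
have c0 : #|P0| = n by rewrite (iso_card I0).
have tgt := norm_target pS fus sat genF PS0 c0 nc0 fn0.
have [g Tg] := tgt _ _ I0; have [h Th] := tgt _ _ (iso_trans fus If I0).
have QS := isoSl If.
have Ig := target_iso fus PS Tg; have Ih := target_iso fus QS Th.
have Ia := iso_trans fus (iso_trans fus (iso_inv fus Ih) If) Ig.
set a := h^-1 * f * g in Ia.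
have [N [r [Ir rE]]] := extends_auto PS0 c0 nc0 fn0 Ia.
have [Ng [INg gP]] := Tg; have [Nh [INh hQ]] := Th.
pose M := nphi S Q P f.
have MN : M \subset 'N_S(Q) := nphi_sub _ _ _ _.
have IMh := iso_sub fus MN INh.
have Ngi : Ng \subset 'N_S(P0) := iso_normal fus (sub_NS PS) (subxx _) INg gP.
have NhN : Nh \subset 'N_S(P0) := iso_normal fus (sub_NS QS) (subxx _) INh hQ.
have ahE x : x \in Q -> a (h x) = g (f x) by move=> xQ; rewrite !permM permK.
have key u : u \in M -> exists2 v, v \in 'N_S(P) & {in P0, forall y, a (y ^ h u) = a y ^ g v}.
  move=> uM; have /(nphiP _ If)[uN [v vN uv]] := uM; exists v => // y.
  have Pe : P0 = h @: Q :> {set gT} by rewrite hQ.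
  rewrite Pe => /imsetP[x xQ ->]; have QN := sub_NS QS.
  have xN := subsetP QN x xQ.
  rewrite -(isoJ fus INh) //.
  rewrite !ahE ?memJ_norm //; last by case/setIP: uN.
  rewrite uv // (isoJ fus INg) // (subsetP (sub_NS PS)) //.
  by rewrite (iso_mem _ If).
have Mh : img h M \subset nphi S P0 P0 a.
  apply/subsetP=> z zM; have : z \in h @: M by rewrite (iso_im IMh).
  case/imsetP=> u uM -> {z zM}.
  have [v vN uv] := key u uM.
  apply/(nphiP _ Ia); split.
    by rewrite (subsetP NhN) // (iso_mem _ INh) (subsetP MN).
  by exists (g v) => //; rewrite (subsetP Ngi) // (iso_mem _ INg).
have IM := iso_trans fus IMh (iso_sub fus Mh Ir).
(* r (h u) and g v act alike on P0, so they differ by an element of C_S(P0). This is the image of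
   C_S(P) under g, because P is fully centralised. *)
have sub : img r (img h M) \subset Ng.
  apply/subsetP=> z zM; have : z \in (h * r) @: M by rewrite (iso_im IM).
  case/imsetP=> u uM -> {z zM}; rewrite permM.
  have [v vN uv] := key u uM.
  have huN : h u \in nphi S P0 P0 a.
    by rewrite (subsetP Mh) // -(iso_im IMh) imset_f.
  have gvS : g v \in S by rewrite (subsetP (isoSr fus INg)) // (iso_mem _ INg).
  have rS : r (h u) \in S by rewrite (subsetP (isoSr fus Ir)) // (iso_mem _ Ir).
  have Cz : r (h u) * (g v)^-1 \in 'C_S(P0).
    rewrite inE groupM ?groupV //=; apply/centP=> y yP.
    have hyN := nphi_ge fus Ia.
    have y'P : a^-1 y \in P0 by rewrite (iso_mem _ (iso_inv fus Ia)).
    have e := uv _ y'P.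
    have huP : h u \in 'N(P0) by have /setIP[] := subsetP (nphi_sub _ _ _ _) _ huN.
    have wP : a^-1 y ^ h u \in P0 by rewrite memJ_norm.
    rewrite -(rE _ wP) (isoJ fus Ir (subsetP hyN _ y'P) huN) (rE _ y'P) permKV in e.
    apply/esym/commgP/conjg_fixP.
    by rewrite conjgM e conjgK.
  have CC : g @: 'C_S(P) = 'C_S(P0).
    have sC : 'C_S(P) \subset 'N_S(P) by rewrite setIS // cent_sub.
    apply/eqP; rewrite eqEcard card_imset; last exact: perm_inj.
    apply/andP; split; last first.
      exact: ((fully_centralisedP fus PS).1 fcP _ _ Ig).
    apply/subsetP=> _ /imsetP[x xC ->]; have xN := subsetP sC x xC.
    rewrite inE (subsetP (isoSr fus INg)) ?(iso_mem _ INg) //= -(iso_img Ig).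
    by rewrite (iso_cent fus INg (sub_NS PS) xN); case/setIP: xC.
  have CN : 'C_S(P0) \subset Ng.
    by rewrite -CC -(iso_im INg) imsetS // setIS // cent_sub.
  have gvN : g v \in Ng by rewrite (iso_mem _ INg).
  by rewrite -[r (h u)](mulgKV (g v)) groupM //; apply: (subsetP CN).
exists (img g^-1 (img r (img h M))), (h * r * g^-1); split.
  exact: (iso_trans fus IM (iso_sub fus sub (iso_inv fus INg))).
move=> x xQ; rewrite !permM rE ?(iso_mem _ Ih) // ahE // permK //.
Qed.

End NoncentricSaturation.

(** * The completion and the graphs Rep *)

Section Generated.
Variables (gT : finGroupType) (S : {group gT}).
Implicit Types (P Q R : {group gT}) (f g : {perm gT}).

(** This largest fusion system contains the generators, which forces generated morphisms to be
    injective homomorphisms. *)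
Lemma injhoms_fusion : is_fusion S (fun A => [set m | injhom A S m]).
Proof.
move=> P PS; split=> [g gS|m|Q a b QS|a].
- rewrite inE; apply/injhomP; exists (cj g).
    by apply: eq_restr => x _; rewrite cjE.
  split=> [x y _ _|]; first by rewrite !cjE conjMg.
  by rewrite cj_im conj_subG.
- by rewrite inE.
- rewrite !inE => /andP[/injhomP[f -> [fM fS]]]; rewrite restr_im // => fPQ.
  case/injhomP=> g -> [gM gS]; rewrite comp_restr //; apply/injhomP; exists (f * g).
    by apply: eq_restr => x _; rewrite /= permM.
  split=> [x y xP yP|].
    by rewrite !permM fM // gM // (subsetP fPQ) // imset_f.
  by rewrite perm_imsetM (subset_trans _ gS) // imsetS.
rewrite inE => /injhomP[f -> [fM fS]]; pose Q := Group (morph_perm_group fM).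
exists (restr (f @: P) f^-1); last first.
  by move=> x xP; rewrite (restrE f xP) restrE ?imset_f // permK.
rewrite inE restr_im //; apply/(@injhomP _ S Q); exists f^-1 => //; split.
  move=> _ _ /imsetP[x xP ->] /imsetP[y yP ->].
  by rewrite -fM // !permK.
by rewrite /= perm_imsetK.
Qed.

Variable Gens : {set gT} -> {set mor gT}.
Hypothesis gens_inj : forall Q m, m \in Gens Q -> injhom Q S m.

Lemma fusion_generatedP A m : reflect
  (forall G, is_fusion S G -> (forall Q, Gens Q \subset G Q) -> m \in G A)
  (m \in Defs.generated S Gens A).
Proof. by rewrite inE; apply: asboolP. Qed.

Lemma gens_generated Q : Gens Q \subset Defs.generated S Gens Q.
Proof. by apply/subsetP=> m mG; apply/fusion_generatedP=> G _ /(_ Q)/subsetP; apply. Qed.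

Lemma generated_fusion : is_fusion S (Defs.generated S Gens).
Proof.
have injF P m : P \subset S -> m \in Defs.generated S Gens P -> injhom P S m.
  move=> PS /fusion_generatedP/(_ _ injhoms_fusion); rewrite inE; apply=> Q.
  by apply/subsetP=> k /gens_inj; rewrite inE.
move=> P PS; split=> [g gS|m mF|Q a b QS|a aF].
- by apply/fusion_generatedP=> G fG _; case: (fG P PS) => /(_ g gS).
- exact: injF.
- rewrite inE => /andP[/fusion_generatedP aF aPQ] /fusion_generatedP bF.
  apply/fusion_generatedP=> G fG GG; case: (fG P PS) => _ _ /(_ Q a b QS) h _; apply: h.
    by rewrite inE aF.
  exact: bF.
have /injhomP[f aE [fM fS]] := injF _ _ PS aF.
pose Q := Group (morph_perm_group fM).
have aP : a @: P = Q by rewrite aE restr_im.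
(* The inverse is determined by [a], so it is the same map in every fusion system containing the
   generators. *)
exists (restr Q f^-1); last first.
  by move=> x xP; rewrite aE (restrE f xP) restrE ?imset_f // permK.
apply/fusion_generatedP=> G fG GG; have /fusion_generatedP/(_ _ fG GG) aG := aF.
have [_ _ _ /(_ a aG)[b bG bK]] := fG P PS; rewrite aP in bG *.
have [_ /(_ b bG)/and4P[/eqP b1 _ _ _] _ _] := fG Q fS.
apply: (set_in_eq bG); rewrite -b1; apply: eq_restr => _ /imsetP[x xP ->].
by rewrite permK; have := bK x xP; rewrite aE restrE.
Qed.

End Generated.

(** * Classes of morphisms and the action of Aut_F(P) *)

Section Precompose.
Variables (gT : finGroupType) (I : finType).

(* Permutations act on the right, hence the inverse.                                *)
Definition precomp (x : I * mor gT) (a : {perm gT}) : I * mor gT :=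
  (x.1, [ffun z => x.2 (a^-1 z)]).

Lemma precomp1 x : precomp x 1 = x.
Proof.
by case: x => i m; congr (_, _); apply/ffunP=> z; rewrite ffunE invg1 perm1.
Qed.

Lemma precompM x a b : precomp x (a * b) = precomp (precomp x a) b.
Proof. by congr (_, _); apply/ffunP=> z; rewrite !ffunE invMg permM. Qed.

Canonical precomp_action := TotalAction precomp1 precompM.

End Precompose.

Section Classes.
Variables (gT : finGroupType) (S : {group gT}) (F : {set gT} -> {set mor gT}).
Hypothesis fus : is_fusion S F.
Variables (I : finType) (Sx : I -> {group gT}) (Fx : I -> {set gT} -> {set mor gT}).
Hypothesis fusx : forall i, is_fusion (Sx i) (Fx i).
Variable P : {group gT}.
Hypothesis PS : P \subset S.
Implicit Types (Q R : {group gT}) (f g : {perm gT}) (i j : I).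

(* Edge classes have the same definition as vertex classes, so rep serves for both. *)
Definition rep i f : {set I * mor gT} := vclass Sx Fx F P (i, restr P f).

Lemma vrepsP i (m : mor gT) : (i, m) \in vreps Sx F P <->
  exists Q f, [/\ iso S F P Q f, Q \subset Sx i & m = restr P f].
Proof.
rewrite !inE /=; split=> [/andP[mF mS]|[Q [f [If QS ->]]]].
  have [Q [f [If me]]] := iso_mor fus PS mF; exists Q, f; split=> //.
  by rewrite -(iso_im If); move: mS; rewrite me restr_im.
by have [_ fF fP] := If; rewrite fF restr_im // fP.
Qed.

Lemma equivFP i Q Q' f g : iso S F P Q f -> Q \subset Sx i -> iso S F P Q' g ->
  reflect (iso (Sx i) (Fx i) Q Q' (f^-1 * g)) (equivF P (Fx i) (restr P f) (restr P g)).
Proof.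
move=> If QS Ig; apply: (iffP existsP) => [[c]|Ifg].
  rewrite !restr_im // (iso_im If) (iso_im Ig) => /and3P[cF /eqP cQ /forall_inP cE].
  have [R [h [Ih ce]]] := iso_mor (@fusx i) QS cF.
  have hE : {in Q, h =1 f^-1 * g}.
    move=> y; rewrite -(iso_im If) => /imsetP[x xP ->]; rewrite permM permK.
    have := cE x xP; rewrite !restrE // => /eqP <-.
    by rewrite ce restrE // (iso_mem _ If).
  have -> : Q' = R; last exact: (iso_ext hE Ih).
  by apply: val_inj; rewrite /= -cQ ce restr_im // (iso_im Ih).
exists (restr Q (f^-1 * g)); rewrite !restr_im ?(iso_im If) ?(iso_im Ig) //.
case: (Ifg) => _ -> /= => ->; rewrite eqxx /=.
apply/forall_inP=> x xP; rewrite !restrE ?(iso_mem _ If) //.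
by rewrite permM permK.
Qed.

Lemma rep_eq_ext i f g : {in P, f =1 g} -> rep i f = rep i g.
Proof. by move=> fg; rewrite /rep (eq_restr fg). Qed.

Lemma in_rep i Q f x : iso S F P Q f -> Q \subset Sx i ->
  reflect (exists Q' g, [/\ iso S F P Q' g, x = (i, restr P g) & iso (Sx i) (Fx i) Q Q' (f^-1 * g)])
          (x \in rep i f).
Proof.
move=> If QS; rewrite [_ \in rep _ _]inE; case: x => j m /=.
apply: (iffP and3P) => [[xV /eqP ji e]|[Q' [g [Ig [-> ->] Ifg]]]].
  have [Q' [g [Ig Q'S me]]] := (vrepsP _ _).1 xV; exists Q', g; split=> //.
    by rewrite ji me.
  by apply/(equivFP If QS Ig); rewrite -me.
split=> //; last by apply/(equivFP If QS Ig).
by apply/vrepsP; exists Q', g; split=> //; apply: (isoSr (@fusx i) Ifg).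
Qed.

Lemma rep_eqP i Q f j Q' g : iso S F P Q f -> Q \subset Sx i ->
    iso S F P Q' g -> Q' \subset Sx j ->
  rep i f = rep j g <-> i = j /\ iso (Sx i) (Fx i) Q Q' (f^-1 * g).
Proof.
move=> If QS Ig QS'; split=> [e|[ij Ifg]].
  have : (j, restr P g) \in rep j g.
    apply/(in_rep _ Ig QS'); exists Q', g; split=> //.
    by rewrite mulVg; apply: iso_id.
  rewrite -e => /(in_rep _ If QS)[R [h [Ih [-> eh] Ifh]]]; split=> //.
  have hg : {in P, h =1 g}.
    by move=> x xP; have := congr1 (fun k : mor gT => k x) eh; rewrite !restrE.
  have -> : Q' = R.
    apply: val_inj; rewrite /= -(iso_im Ih) -(iso_im Ig); apply: eq_in_imset => x xP.
    by rewrite hg.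
  apply: iso_ext Ifh => y; rewrite -(iso_im If) => /imsetP[x xP ->].
  by rewrite !permM permK hg.
subst j; apply/setP=> x; apply/(in_rep _ If QS)/(in_rep _ Ig QS').
  case=> R [h [Ih -> Ifh]]; exists R, h; split=> //.
  have := iso_trans (@fusx i) (iso_inv (@fusx i) Ifg) Ifh.
  by rewrite invMg invgK !mulgA mulgK.
case=> R [h [Ih -> Igh]]; exists R, h; split=> //.
by have := iso_trans (@fusx i) Ifg Igh; rewrite mulgA mulgK.
Qed.

Lemma RepVP A : reflect (exists i Q f, [/\ iso S F P Q f, Q \subset Sx i & A = rep i f])
  (A \in RepV Sx Fx F P).
Proof.
apply: (iffP imsetP) => [[[i m] xV ->]|[i [Q [f [If QS ->]]]]].
  by have [Q [f [If QS ->]]] := (vrepsP _ _).1 xV; exists i, Q, f.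
by exists (i, restr P f) => //; apply/vrepsP; exists Q, f.
Qed.

Definition rep_act : {action {perm gT} &-> {set I * mor gT}} := ((precomp_action gT I)^*)%act.

Lemma AutF_trans a Q f : a \in AutF F P -> iso S F P Q f -> iso S F P Q (a^-1 * f).
Proof.
move=> aA If; have Ia := AutF_iso PS aA.
exact: (iso_trans fus (iso_inv fus Ia) If).
Qed.

Lemma rep_actE i Q f a : iso S F P Q f -> Q \subset Sx i -> a \in AutF F P ->
  rep_act (rep i f) a = rep i (a^-1 * f).
Proof.
have sub Q' g b : iso S F P Q' g -> Q' \subset Sx i -> b \in AutF F P ->
    rep_act (rep i g) b \subset rep i (b^-1 * g).
  move=> Ig QS' bA; have Ib := AutF_iso PS bA.
  apply/subsetP=> _ /imsetP[_ /(in_rep _ Ig QS')[R [h [Ih -> Igh]]] ->].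
  apply/(in_rep _ (AutF_trans bA Ig) QS'); exists R, (b^-1 * h); split.
  - exact: AutF_trans.
  - congr (_, _); apply/ffunP=> z; rewrite !ffunE permM /=.
    rewrite (iso_mem _ (iso_inv fus Ib)); case: ifPn => // zP.
    by rewrite (out_perm _ zP) // perm_onV // (AutF_on bA).
  by rewrite invMg invgK -!mulgA mulKVg.
move=> If QS aA; apply/eqP; rewrite eqEsubset (sub _ _ _ If QS aA) /=.
have aVA : a^-1 \in AutF F P by rewrite -(AutGE fus PS) groupV (AutGE fus PS).
have := sub Q (a^-1 * f) a^-1 (AutF_trans aA If) QS aVA; rewrite invgK mulKVg => s.
have h : rep_act (rep_act (rep i (a^-1 * f)) a^-1) a \subset rep_act (rep i f) a.
  exact: imsetS s.
by rewrite actKV in h.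
Qed.

(** With [fixed_rep], this identifies the stabiliser of the class of f with the automorphisms of Q
    in F(i), conjugated back by f. *)
Lemma rep_fixed i Q f a : iso S F P Q f -> Q \subset Sx i -> a \in AutF F P ->
  rep_act (rep i f) a = rep i f -> a ^ f \in AutF (Fx i) Q.
Proof.
move=> If QS aA; rewrite (rep_actE If QS aA).
case/(rep_eqP (AutF_trans aA If) QS If QS)=> _; rewrite invMg invgK -mulgA -conjgE => Ia.
apply: AutF_intro => //.
by apply: (@AutF_on _ F); rewrite (AutF_J fus If) memJ_conjg.
Qed.

Lemma fixed_rep i Q f a : iso S F P Q f -> Q \subset Sx i -> a \in AutF F P ->
  iso (Sx i) (Fx i) Q Q (a ^ f) -> rep_act (rep i f) a = rep i f.
Proof.
move=> If QS aA Ia; rewrite (rep_actE If QS aA).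
apply/(rep_eqP (AutF_trans aA If) QS If QS); split=> //.
by rewrite invMg invgK -mulgA -conjgE.
Qed.

End Classes.

(** * Centric subgroups *)

Section Tree.
Variables (gT : finGroupType) (p : nat) (V E : finType) (ends : E -> V * V).
Variables (Sv : V -> {group gT}) (Se : E -> {group gT}).
Variables (Fv : V -> {set gT} -> {set mor gT}) (Fe : E -> {set gT} -> {set mor gT}).
Variable vstar : V.
Hypothesis p_pr : prime p.
Hypothesis treeT : is_tree [set: V] [set: E] (tjoins ends).
Local Notation S := (Sv vstar).
Hypothesis pSv : forall v, p.-group (Sv v).
Hypothesis SvS : forall v, Sv v \subset S.
Hypothesis SeSv : forall e v, incident ends e v -> Se e \subset Sv v.
Hypothesis fusv : forall v, is_fusion (Sv v) (Fv v).
Hypothesis fuse : forall e, is_fusion (Se e) (Fe e).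
Hypothesis FeFv : forall e v (P : {group gT}), incident ends e v -> P \subset Se e ->
  Fe e P \subset Fv v P.
Hypothesis hypH : forall v, v != vstar -> forall e w s,
  path_starting (tjoins ends) v e w s vstar -> Se e = Sv v.
Hypothesis satv : forall v (P : {group gT}), P \subset Sv v -> sat_at (Sv v) (Fv v) p P.
Variable F : {set gT} -> {set mor gT}.
Hypothesis fus : is_fusion S F.
Hypothesis FvF : forall v (P : {group gT}), P \subset Sv v -> Fv v P \subset F P.
Hypothesis repT : forall P : {group gT}, P \subset S -> fcentric S F P ->
  Rep_is_tree ends Sv Se Fv Fe F P.
Implicit Types (P Q R N : {group gT}) (f : {perm gT}).
Local Notation isov v := (iso (Sv v) (Fv v)).
Local Notation isoe e := (iso (Se e) (Fe e)).
Local Notation isoT := (iso S F).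

Lemma tjoins_ends e : e \in [set: E] -> exists u v,
  [/\ u \in [set: V], v \in [set: V] & forall a b,
      tjoins ends e a b = ((a == u) && (b == v)) || ((a == v) && (b == u))].
Proof.
move=> _; exists (ends e).1, (ends e).2; split=> [||a b]; rewrite ?inE //.
rewrite /tjoins; case: (ends e) => u v; rewrite !xpair_eqE /=.
by rewrite (eq_sym u) (eq_sym v) (eq_sym u b) (eq_sym v a) (andbC (b == u)).
Qed.

Lemma tjoins_pair e : tjoins ends e (ends e).1 (ends e).2.
Proof. by rewrite /tjoins -surjective_pairing eqxx. Qed.

Lemma ends_neq e : (ends e).1 != (ends e).2.
Proof.
apply/eqP=> eqe; have := no_loop treeT tjoins_ends (ends e).1 (in_setT e).
by rewrite {2}eqe tjoins_pair.
Qed.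

Lemma incident1 e : incident ends e (ends e).1.
Proof. by rewrite /incident eqxx. Qed.

Lemma incident2 e : incident ends e (ends e).2.
Proof. by rewrite /incident eqxx orbT. Qed.

(** The end of e further from the root starts a simple path to it through e, so (H) applies. *)
Lemma edge_full e : exists2 v, incident ends e v & Se e = Sv v.
Proof.
have [d dP] := dist_ex treeT (in_setT vstar).
have := edge_dist treeT tjoins_ends dP (in_setT e) (tjoins_pair e).
have key v w : tjoins ends e v w -> d w < d v -> Se e = Sv v.
  move=> jvw lt; have nv : v != vstar.
    apply: contraTneq lt => ->; rewrite -leqNgt.
    have [_ /(_ [::])] := dP vstar (in_setT _); rewrite /walk_to /= eqxx => /(_ isT).
    by rewrite leqn0 => /eqP ->.
  have [s ws [ss us]] := geodesic_uniq dP (in_setT w).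
  apply: (hypH nv (e := e) (w := w) (s := s)).
  have /and3P[w1 w2 w3] := ws.
  rewrite /path_starting /= jvw w2 (eqP w3) eqxx /=.
  move: us; rewrite /= => ->; rewrite andbT inE negb_or.
  apply/andP; split; first by apply: contraTneq lt => ->; rewrite ltnn.
  apply/negP=> /(walk_to_suffix ws)[t [wt st _ _]].
  have [_ /(_ _ wt)] := dP v (in_setT _).
  by rewrite leqNgt (ltn_trans st) // ss.
rewrite neq_ltn => /orP[] lt.
  exists (ends e).2; first exact: incident2.
  by apply: key lt; rewrite /tjoins -surjective_pairing eqxx orbT.
exists (ends e).1; first exact: incident1.
by apply: key lt; apply: tjoins_pair.
Qed.

Lemma isov_T v P Q f : isov v P Q f -> isoT P Q f.
Proof.
case=> PS fF fP; split=> //; first exact: subset_trans PS (SvS v).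
exact: (subsetP (FvF PS)).
Qed.

Lemma isoe_v e v P Q f : incident ends e v -> isoe e P Q f -> isov v P Q f.
Proof.
move=> ev [PS fF fP]; split=> //; first exact: subset_trans PS (SeSv ev).
exact: (subsetP (FeFv ev PS)).
Qed.

Lemma isoe_T e P Q f : isoe e P Q f -> isoT P Q f.
Proof. by move/(isoe_v (incident1 e))/isov_T. Qed.

Lemma SeS e : Se e \subset S.
Proof. exact: subset_trans (SeSv (incident1 e)) (SvS _). Qed.

Lemma centric_v v P : P \subset Sv v -> fcentric S F P -> fcentric (Sv v) (Fv v) P.
Proof.
move=> PS /(fcentricP fus (subset_trans PS (SvS v))) cP.
apply/(fcentricP (@fusv v) PS) => Q f If.
by apply: subset_trans (cP _ _ (isov_T If)); apply: setSI.
Qed.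

Section Rep.
Variable P : {group gT}.
Hypothesis PS : P \subset S.
Hypothesis cP : fcentric S F P.

Local Notation vrep := (rep F Sv Fv P).
Local Notation erep := (rep F Se Fe P).
Local Notation EP := (RepVP fus Se Fe PS).
Local Notation VP := (RepVP fus Sv Fv PS).

Lemma vrep_edge e v Q f Q' f' : incident ends e v -> isoT P Q f -> Q \subset Se e ->
  isoT P Q' f' -> Q' \subset Se e -> erep e f = erep e f' -> vrep v f = vrep v f'.
Proof.
move=> ev If QS If' QS' /(rep_eqP fus fuse PS If QS If' QS')[_ Iff'].
apply/(rep_eqP fus fusv PS If _ If' _); rewrite ?(subset_trans _ (SeSv ev)) //.
by split=> //; apply: isoe_v Iff'.
Qed.

Lemma Repjoins_rep e Q f A B : isoT P Q f -> Q \subset Se e ->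
  Repjoins ends Sv Fv F P (erep e f) A B =
    ((A == vrep (ends e).1 f) && (B == vrep (ends e).2 f)) ||
    ((A == vrep (ends e).2 f) && (B == vrep (ends e).1 f)).
Proof.
move=> If QS; apply/exists_inP/idP=> [[x]|].
  case/(in_rep fus fuse PS _ If QS)=> Q' [g [Ig -> Ifg]] /=.
  have QS' := isoSr (@fuse e) Ifg.
  have e12 v : incident ends e v -> vclass Sv Fv F P (v, restr P g) = vrep v f.
    move=> ev; symmetry; apply: (vrep_edge ev If QS Ig QS').
    by apply/(rep_eqP fus fuse PS If QS Ig QS').
  rewrite !e12 ?incident1 ?incident2 //.
  by rewrite (andbC (B == _)).
move=> h; exists (e, restr P f).
  apply/(in_rep fus fuse PS _ If QS); exists Q, f; split=> //.
  by rewrite mulVg; apply: (iso_id (@fuse e)).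
by rewrite /= -/(vrep _ _) -/(vrep _ _) (andbC (B == _)).
Qed.

Local Notation VV := (RepV Sv Fv F P).
Local Notation EE := (RepE Se Fe F P).
Local Notation joins := (Repjoins ends Sv Fv F P).

Lemma vrep_in v Q f : isoT P Q f -> Q \subset Sv v -> vrep v f \in VV.
Proof. by move=> If QS; apply/VP; exists v, Q, f. Qed.

Lemma erep_in e Q f : isoT P Q f -> Q \subset Se e -> erep e f \in EE.
Proof. by move=> If QS; apply/EP; exists e, Q, f. Qed.

Lemma Rep_ends C : C \in EE -> exists A B, [/\ A \in VV, B \in VV &
  forall X Y, joins C X Y = ((X == A) && (Y == B)) || ((X == B) && (Y == A))].
Proof.
case/EP=> e [Q [f [If QS ->]]]; exists (vrep (ends e).1 f), (vrep (ends e).2 f).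
split; last by move=> X Y; apply: Repjoins_rep If QS.
  by apply: vrep_in If _; apply: subset_trans QS (SeSv (incident1 e)).
by apply: vrep_in If _; apply: subset_trans QS (SeSv (incident2 e)).
Qed.

Local Notation actX := (rep_act gT V).
Local Notation actY := (rep_act gT E).

Lemma act_VV a A : a \in AutF F P -> A \in VV -> actX A a \in VV.
Proof.
move=> aA /VP[v [Q [f [If QS ->]]]]; rewrite (rep_actE fus fusv PS If QS aA).
exact: vrep_in (AutF_trans fus PS aA If) QS.
Qed.

Lemma act_EE a C : a \in AutF F P -> C \in EE -> actY C a \in EE.
Proof.
move=> aA /EP[e [Q [f [If QS ->]]]]; rewrite (rep_actE fus fuse PS If QS aA).
exact: erep_in (AutF_trans fus PS aA If) QS.
Qed.

Lemma act_joins a C A B : a \in AutF F P -> C \in EE -> joins C A B ->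
  joins (actY C a) (actX A a) (actX B a).
Proof.
move=> aA /EP[e [Q [f [If QS ->]]]]; rewrite (rep_actE fus fuse PS If QS aA).
have QS1 := subset_trans QS (SeSv (incident1 e)).
have QS2 := subset_trans QS (SeSv (incident2 e)).
rewrite (Repjoins_rep _ _ If QS) (Repjoins_rep _ _ (AutF_trans fus PS aA If) QS).
by case/orP=> /andP[/eqP-> /eqP->];
  rewrite (rep_actE fus fusv PS If QS1 aA) (rep_actE fus fusv PS If QS2 aA) !eqxx ?orbT.
Qed.

(** The ends of an edge of Rep lie over distinct vertices of the underlying tree, and the action
    preserves the vertex underneath. *)
Lemma act_noinv a C A B : a \in AutF F P -> C \in EE -> joins C A B -> actY C a = C ->
  actX A a = A.
Proof.
move=> aA CE jAB Cf; have := act_joins aA CE jAB; rewrite Cf.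
case/(joins_eq Rep_ends CE jAB)=> [[//]|[e1 _]]; case/EP: CE e1 jAB => e [Q [f [If QS ->]]].
have QS1 := subset_trans QS (SeSv (incident1 e)).
have QS2 := subset_trans QS (SeSv (incident2 e)).
have If' := AutF_trans fus PS aA If.
rewrite (Repjoins_rep _ _ If QS) => e1 /orP[] /andP[/eqP eA /eqP eB]; move: e1.
  rewrite eA eB (rep_actE fus fusv PS If QS1 aA).
  case/(rep_eqP fus fusv PS If' QS1 If QS2)=> e12 _.
  by have := ends_neq e; rewrite e12 eqxx.
rewrite eA eB (rep_actE fus fusv PS If QS2 aA).
case/(rep_eqP fus fusv PS If' QS2 If QS1)=> e12 _.
by have := ends_neq e; rewrite e12 eqxx.
Qed.

Let treeP : is_tree VV EE joins := repT PS cP.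

Lemma AutS_mono v R : AutS (Sv v) R \subset AutS S R.
Proof. by apply: morphimS; apply: setSI. Qed.

Lemma faut_conj : exists Q f, isoT P Q f /\ fully_automised p S F Q.
Proof.
have [L sylL] := Sylow_exists p (AutG F P).
have LA : L \subset AutF F P by rewrite -(AutGE fus PS) (pHall_sub sylL).
have VV0 : VV != set0.
  by apply/set0Pn; exists (vrep vstar 1); apply: vrep_in PS; apply: iso_id.
have [A AV Afix] := pgroup_fixes_vertex treeP Rep_ends
  (fun k x kL => act_VV (subsetP LA k kL)) (fun k y kL => act_EE (subsetP LA k kL))
  p_pr (pHall_pgroup sylL) VV0 (fun k y a b kL => act_noinv (a := k) (subsetP LA k kL)).
have [v [Q [f [If QS Ae]]]] := VP _ AV.
have LQ : L :^ f \subset AutF (Fv v) Q.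
  apply/subsetP=> _ /imsetP[l lL ->].
  by apply: (rep_fixed fus fusv PS If QS (subsetP LA l lL)); rewrite -Ae Afix.
have [R [g [Ig fnR]]] := fully_normalised_ex (@fusv v) QS.
have RS := isoSr (@fusv v) Ig; have [fn _] := satv RS; have [_ fa] := fn fnR.
have pLf : p.-group (L :^ f)%G by rewrite pgroupJ (pHall_pgroup sylL).
have [b bA Lb] := faut_adjust (K := (L :^ f)%G) (@fusv v) fa Ig LQ pLf.
have Ib := AutF_iso RS bA; have IfT := iso_trans fus If (isov_T (iso_trans (@fusv v) Ig Ib)).
exists R, (f * (g * b)); split=> //; have RS' := isoSl (isov_T Ib).
rewrite /fully_automised -(AutGE fus RS').
apply: (@Sylow_of_card _ _ _ _ (L :^ (f * (g * b)))%G).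
- by rewrite (AutG_J fus IfT) pHallJ2.
- by rewrite (AutGE fus RS') AutS_sub.
- exact: pgroup_AutS.
rewrite /= subset_leq_card //; apply: subset_trans (AutS_mono v R).
by rewrite conjsgM.
Qed.

End Rep.

(** Conjugates of a centric subgroup have centralisers of equal order, so the greatest normaliser
    gives the greatest Aut_S, at least that of the conjugate from [faut_conj]. *)
Lemma centric_fnorm P : P \subset S -> fcentric S F P -> fully_normalised S F P ->
  fully_centralised S F P /\ fully_automised p S F P.
Proof.
move=> PS cP fnP; have fc := fcentric_fcent fus PS cP; split=> //.
have [Q [f [If fa]]] := faut_conj PS cP.
have QS := isoSr fus If; have Ii := iso_inv fus If.
move: fa; rewrite /fully_automised -(AutGE fus QS) -(AutGE fus PS) => sylQ.
apply: (@Sylow_of_card _ _ _ _ (AutS_group S Q :^ f^-1)%G).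
- by rewrite (AutG_J fus Ii) pHallJ2.
- by rewrite (AutGE fus PS) AutS_sub.
- exact: pgroup_AutS.
rewrite /= cardJg -(leq_pmul2r (cardG_gt0 'C_S(Q))).
rewrite card_AutS (leq_trans ((fully_normalisedP fus PS).1 fnP _ _ If)) //.
rewrite -card_AutS leq_mul2l; apply/orP; right.
have cQ := fcentric_iso fus If cP.
by apply: ((fully_centralisedP fus QS).1 (fcentric_fcent fus QS cQ) _ _ Ii).
Qed.

Section TrivialOn.
Variables P R : {group gT}.
Hypothesis RS : R \subset S.
Hypothesis PR : P \subset R.
Hypothesis RN : R \subset 'N(P).
Hypothesis cP : fcentric S F P.
Variable t : {perm gT}.
Hypothesis tA : t \in AutF F R.
Hypothesis tP : {in P, forall x, t x = x}.

(** z = x^-1 t(x) centralises P, hence lies in P and is fixed by t; so t^k sends x to x z^k. *)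
Lemma trivial_on_order : t ^+ #|P| = 1.
Proof.
have It := AutF_iso RS tA; have PS := subset_trans PR RS.
have CP : 'C_S(P) \subset P := (fcentricP fus PS).1 cP _ _ (iso_id fus PS).
have key x : x \in R -> x^-1 * t x \in P.
  move=> xR; have txR : t x \in R by rewrite (iso_mem _ It).
  have xS := subsetP RS x xR; have txS := subsetP RS _ txR.
  apply: (subsetP CP); rewrite inE groupM ?groupV //=; apply/centP=> y yP.
  apply/esym/commgP/conjg_fixP.
  have yxP : y ^ x^-1 \in P by rewrite memJ_norm // groupV (subsetP RN).
  rewrite conjgM -{1}(tP yxP) -(isoJ fus It) ?(subsetP PR _ yxP) //.
  by rewrite tP conjgKV.
apply/permP=> x; rewrite perm1.
have [xR|xR] := boolP (x \in R); last first.
  have tkA : t ^+ #|P| \in AutF F R by rewrite -(AutGE fus RS) groupX ?(AutGE fus RS).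
  by rewrite (out_perm (AutF_on tkA)).
have zP := key x xR; set z := x^-1 * t x in zP.
have e k : (t ^+ k) x = x * z ^+ k.
  elim: k => [|k IH]; first by rewrite perm1 mulg1.
  rewrite expgSr permM IH (isoM fus It) ?groupX ?(subsetP PR z) //.
  by rewrite (tP (groupX k zP)) expgS mulgA /z mulKVg.
by rewrite e (eqP (_ : z ^+ #|P| == 1)) ?mulg1 // -order_dvdn order_dvdG.
Qed.

Lemma trivial_on_pgroup : p.-group <[t]>.
Proof.
have PS := subset_trans PR RS; have pP := pgroupS PS (pSv vstar).
by rewrite /pgroup -orderE (pnat_dvd _ pP) // order_dvdn trivial_on_order.
Qed.

(** As t has p-power order, on a fully automised conjugate of R it becomes conjugation by some h in
    S. This h centralises the image of P, hence lies in it. *)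
Lemma trivial_on_conj : exists2 z, z \in P & {in R, forall x, t x = x ^ z}.
Proof.
have PS := subset_trans PR RS; have cR := fcentric_sup fus RS PR cP.
have [Q [f [If fa]]] := faut_conj RS cR.
have tAR : <[t]> \subset AutF F R by rewrite -(AutGE fus RS) cycle_subG (AutGE fus RS).
have [b bA tb] := faut_adjust fus fa If tAR trivial_on_pgroup.
have Ig := iso_trans fus If (AutF_iso (isoSr fus If) bA); set g := f * b in Ig tb.
have tgA : t ^ g \in AutS S Q by rewrite (subsetP tb) // memJ_conjg cycle_id.
have [h hN te] := AutSP _ _ _ tgA; have [hS hNQ] := setIP hN.
have tE x : x \in R -> g (t x) = g x ^ h.
  move=> xR; have gxQ : g x \in Q by rewrite (iso_mem _ Ig).
  by rewrite -(norm_conj_autE hNQ gxQ) -te permJ.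
have IP := iso_sub fus PR Ig.
have hP : h \in img g P.
  apply: (subsetP ((fcentricP fus PS).1 cP _ _ IP)); rewrite inE hS /=.
  rewrite -(imgE fus Ig PR); apply/centP=> _ /imsetP[x xP ->].
  by apply/esym/commgP/conjg_fixP; rewrite -tE ?(subsetP PR) // tP.
have : h \in g @: P by rewrite (imgE fus Ig PR).
case/imsetP=> z zP hz; exists z => // x xR; apply: (@perm_inj _ g).
by rewrite tE // hz (isoJ fus Ig) // (subsetP PR).
Qed.

End TrivialOn.

(* If P is a counterexample of maximal order, there is k in Aut_F(e)(P) of p-power  *)
(* order that normalises Aut_S(e)(P) without belonging to it.  It extends to        *)
(* R = N_S(e)(P) in the fusion systems of both ends of e.  The extensions differ by *)
(* conjugation by an element of P, so one of them fixes both ends of the edge of    *)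
(* the inclusion in Rep(R), hence lies in F(e).  As R is not a counterexample, it   *)
(* is realised in S(e) on an F(e)-conjugate of R, where the normaliser of the image *)
(* of P is too large.                                                               *)
Lemma edge_faut e P : P \subset Se e -> fcentric S F P ->
  fully_normalised (Se e) (Fe e) P -> fully_automised p (Se e) (Fe e) P.
Proof.
move: {2}(#|Se e| - #|P|).+1 (ltnSn (#|Se e| - #|P|)) => n.
elim: n P => // n IHn P ltn PSe cP fnP; have fe := @fuse e.
(* If P = S(e), then P is S(u) for an end u of e, and Aut_S(u)(P) is Sylow already in the larger
   group Aut_F(u)(P). *)
have [PeS|nPS] := eqVneq (P : {set gT}) (Se e).
  have {}PeS : P = Se e by apply: val_inj.
  have [u eu Su] := edge_full e.
  have [fn _] := satv (subxx (Sv u)).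
  have fnu : fully_normalised (Sv u) (Fv u) (Sv u).
    apply/(fully_normalisedP (@fusv u) (subxx _)) => Q f If.
    by rewrite (setIidPl (normG (Sv u))) subset_leq_card // subsetIl.
  have [_ fa] := fn fnu; rewrite PeS.
  have sub : AutF (Fe e) (Se e) \subset AutG (Fv u) (Sv u).
    rewrite (AutGE (@fusv u)) // -Su; apply/subsetP=> a aA.
    by apply: AutF_intro (AutF_on aA) => //; apply: isoe_v eu (AutF_iso _ aA).
  rewrite /fully_automised -(AutGE fe) //.
  rewrite -(AutGE fe) // in sub; apply: pHall_subl sub _; last first.
    by rewrite (AutGE (@fusv u)) // Su.
  by rewrite (AutGE fe) // AutS_sub.
have pPS : P \proper Se e by rewrite properEneq nPS.
have pSe : p.-group (Se e) := pgroupS (SeS e) (pSv vstar).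
have PS := subset_trans PSe (SeS e).
have pP : p.-group P := pgroupS PS (pSv vstar).
have CP : 'C_S(P) \subset P := (fcentricP fus PS).1 cP _ _ (iso_id fus PS).
pose K0 := AutS_group (Se e) P.
have K0A : K0 \subset AutG (Fe e) P by rewrite (AutGE fe) // AutS_sub.
have [Kh sylKh K0Kh] := Sylow_superset K0A (pgroup_AutS P pSe).
have [eK|nK] := eqVneq (K0 : {set _}) Kh.
  by rewrite /fully_automised -(AutGE fe) // -[AutS _ _]/(K0 : {set _}) eK.
have pK : K0 \proper Kh by rewrite properEneq nK.
have /properP[_ [k kN kK0]] := nilpotent_proper_norm (pgroup_nil (pHall_pgroup sylKh)) pK.
have [kKh kNK] := setIP kN.
have kA : k \in AutF (Fe e) P by rewrite -(AutGE fe) // (subsetP (pHall_sub sylKh)).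
have Ik := AutF_iso PSe kA.
pose R := 'N_(Se e)(P)%G; have RSe : R \subset Se e := subsetIl _ _.
have PR : P \subset R := sub_NS PSe; have RN : R \subset 'N(P) := subsetIr _ _.
have RS := subset_trans RSe (SeS e).
have cR := fcentric_sup fus RS PR cP.
have kJ g : g \in R -> exists2 h, h \in R & {in P, forall x, k (x ^ g) = k x ^ h}.
  move=> gR; have gK0 : conj_aut P g ^ k \in K0.
    by rewrite memJ_norm //; apply/AutSP; exists g.
  have [h hR e1] := AutSP _ _ _ gK0; exists h => //.
  by apply/(conj_aut_J Ik gR hR).
have extk u : incident ends e u -> exists2 f, isov u R R f & {in P, f =1 k}.
  move=> eu; have SeSu := SeSv eu; have PSu := subset_trans PSe SeSu.
  have Iku := isoe_v eu Ik; have [_ ext] := satv PSu.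
  have cPu := fcentric_fcent (@fusv u) PSu (centric_v PSu cP).
  have [N [f [If fE]]] := ext _ _ Iku cPu.
  have Rn : R \subset nphi (Sv u) P P k.
    apply/subsetP=> g gR; apply/(nphiP _ Iku).
    have sub : R \subset 'N_(Sv u)(P) := setSI _ SeSu.
    split; first exact: (subsetP sub).
    by have [h hR e1] := kJ g gR; exists h => //; apply: (subsetP sub).
  have IR := iso_sub (@fusv u) Rn If; exists f; last exact: fE.
  (* For g in R, f g and the h given by [kJ] act alike on P, so they differ by an element of P. *)
  suff eR : img f R = R by rewrite -{2}eR.
  apply: val_inj; apply/eqP; rewrite eqEcard (iso_card IR) leqnn andbT.
  apply/subsetP=> y yR; have : y \in f @: R by rewrite (iso_im IR).
  case/imsetP=> g gR ->; have [h hR e1] := kJ g gR.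
  have fgS : f g \in S by rewrite (subsetP (isoSr fus (isov_T IR))) // (iso_mem _ IR).
  have hS := subsetP RS h hR.
  rewrite -[f g](mulgKV h) groupM // (subsetP PR) // (subsetP CP) //.
  rewrite inE groupM ?groupV //=; apply/centP=> z zP; apply/esym/commgP/conjg_fixP.
  have wP : k^-1 z \in P by rewrite (iso_mem _ (iso_inv fe Ik)).
  have gNP := subsetP RN g gR; have wgP : k^-1 z ^ g \in P by rewrite memJ_norm.
  have := e1 _ wP; rewrite -(fE _ wgP) (isoJ (@fusv u) IR (subsetP PR _ wP) gR).
  by rewrite (fE _ wP) permKV conjgM => ->; rewrite conjgK.
have [fv Ifv fvE] := extk _ (incident1 e); have [fw Ifw fwE] := extk _ (incident2 e).
have It : isoT R R (fv * fw^-1).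
  exact: (iso_trans fus (isov_T Ifv) (iso_inv fus (isov_T Ifw))).
have tA := restr_perm_AutF fus It; have tE := restr_perm_eq It.
have tP : {in P, forall x, restr_perm R (fv * fw^-1) x = x}.
  by move=> x xP; rewrite tE ?(subsetP PR) // permM fvE // -fwE // permK.
have [z zP zE] := trivial_on_conj RS PR RN cP tA tP.
have Ifvw : isov (ends e).2 R R fv.
  have RSw := isoSl Ifw; have zR := subsetP PR z zP.
  have zN : z \in 'N_(Sv (ends e).2)(R) by rewrite inE (subsetP RSw) // (subsetP (normG R)).
  apply: (iso_ext _ (iso_trans (@fusv _) (iso_conj_aut (@fusv _) RSw zN) Ifw)) => x xR.
  rewrite permM norm_conj_autE ?(subsetP (normG R)) // -zE // tE //.
  by rewrite permM permKV.
have IT1 := iso_id fus RS; have IfT := isov_T Ifv.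
have e1 : rep F Sv Fv R (ends e).1 1 = rep F Sv Fv R (ends e).1 fv.
  apply/(rep_eqP fus fusv RS IT1 (isoSl Ifv) IfT (isoSl Ifv)).
  by rewrite invg1 mul1g.
have e2 : rep F Sv Fv R (ends e).2 1 = rep F Sv Fv R (ends e).2 fv.
  apply/(rep_eqP fus fusv RS IT1 (isoSl Ifw) IfT (isoSl Ifw)).
  by rewrite invg1 mul1g.
have Ife : isoe e R R fv.
  have : rep F Se Fe R e 1 = rep F Se Fe R e fv.
    apply: (edge_uniq (a := rep F Sv Fv R (ends e).1 1) (b := rep F Sv Fv R (ends e).2 1)
      (repT RS cR) (Rep_ends RS)).
    - exact: (erep_in RS IT1 RSe).
    - exact: (erep_in RS IfT RSe).
    - by rewrite (Repjoins_rep RS _ _ IT1 RSe) !eqxx.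
    by rewrite (Repjoins_rep RS _ _ IfT RSe) e1 e2 !eqxx.
  case/(rep_eqP fus fuse RS IT1 RSe IfT RSe)=> _.
  by rewrite invg1 mul1g.
pose a := restr_perm R fv.
have aA : a \in AutF (Fe e) R := restr_perm_AutF fe Ife.
have aT : a \in AutF F R := restr_perm_AutF fus IfT.
have aE : {in P, a =1 k} by move=> x xP; rewrite (restr_perm_eq IfT) ?fvE // (subsetP PR).
have pa : p.-group <[a]>.
  have aX m : {in P, forall x, (a ^+ m) x = (k ^+ m) x}.
    elim: m => [|m IH] x xP; first by rewrite !perm1.
    by rewrite !expgS !permM aE // IH // (iso_mem _ Ik).
  (* The power of [a] by |Kh| is trivial on P, where [a] agrees with k, so [trivial_on_order]
     applies to it. *)
  have am : (a ^+ #|Kh|) ^+ #|P| = 1.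
    apply: (trivial_on_order RS PR RN cP).
      by rewrite -(AutGE fus RS) groupX ?(AutGE fus RS).
    move=> x xP; rewrite aX //.
    by rewrite (eqP (_ : k ^+ #|Kh| == 1)) ?perm1 // -order_dvdn order_dvdG.
  rewrite /pgroup -orderE (@pnat_dvd _ (#|Kh| * #|P|)) //.
    by rewrite order_dvdn expgM am.
  by rewrite pnatM; apply/andP; split; [apply: pHall_pgroup sylKh | exact: pP].
have pPR : P \proper R by apply: nilpotent_proper_norm (pgroup_nil pSe) pPS.
have [R1 [f [If fnR1]]] := fully_normalised_ex fe RSe.
have R1Se := isoSr fe If; have cR1 := fcentric_iso fus (isoe_T If) cR.
have faR1 : fully_automised p (Se e) (Fe e) R1.
  apply: IHn => //; rewrite (iso_card If); rewrite ltnS in ltn; apply: leq_trans ltn.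
  by apply: ltn_sub2l; apply: proper_card.
have aAs : <[a]> \subset AutF (Fe e) R.
  by rewrite -(AutGE fe RSe) cycle_subG (AutGE fe RSe).
have [b bA ab] := faut_adjust fe faR1 If aAs pa.
have Ig := iso_trans fe If (AutF_iso R1Se bA); set g := f * b in Ig ab.
have agA : a ^ g \in AutS (Se e) R1 by rewrite (subsetP ab) // memJ_conjg cycle_id.
have [h hN ae] := AutSP _ _ _ agA; have [hS hNR] := setIP hN.
have hE x : x \in R -> g (a x) = g x ^ h.
  move=> xR; have gxR : g x \in R1 by rewrite (iso_mem _ Ig).
  by rewrite -(norm_conj_autE hNR gxR) -ae permJ.
have IP := iso_sub fe PR Ig; set P1 := img g P in IP.
have gP : g @: P = P1 := imgE fe Ig PR.
have hP1 : h \in 'N_(Se e)(P1).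
  rewrite inE hS /= inE; apply/subsetP=> _ /imsetP[y yP ->].
  have : y \in g @: P by rewrite gP.
  case/imsetP=> x xP ->; rewrite -hE ?(subsetP PR) // -gP imset_f // aE //.
  by rewrite (iso_mem _ Ik).
have hR1 : h \notin R1.
  apply: contra kK0 => hR1; have : h \in g @: R by rewrite (iso_im Ig).
  case/imsetP=> y yR hy; apply/AutSP; exists y => //; have yN := subsetP RN y yR.
  apply/permP=> x; have [xP|xP] := boolP (x \in P); last first.
    by rewrite (out_perm (AutF_on kA)) // (out_perm (conj_aut_on yN)).
  rewrite norm_conj_autE // -aE //; apply: (@perm_inj _ g); have xR := subsetP PR x xP.
  by rewrite hE // hy (isoJ fe Ig).
have R1N : R1 \subset 'N_(Se e)(P1) := iso_normal fe PR (subxx _) Ig gP.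
have : #|R1| < #|'N_(Se e)(P1)|.
  by apply: proper_card; apply/properP; split=> //; exists h.
rewrite (iso_card Ig) ltnNge.
by rewrite ((fully_normalisedP fe PSe).1 fnP _ _ IP).
Qed.

(** One move inside F(w): h and g have the same class at w, and saturation of F(w) at B turns the
    extension h to N into an extension of g. *)
Lemma extend_along w P N N' h B g : P \subset N -> N \subset 'N_S(P) ->
    isoT N N' h -> N' \subset Sv w -> isov w (img h P) B (h^-1 * g) ->
    fcentric S F B ->
    (forall x, x \in N -> exists2 u, u \in 'N_(Sv w)(B) &
       {in P, forall y, g (y ^ x) = g y ^ u}) ->
  exists f N'', [/\ isoT N N'' f, N'' \subset Sv w & {in P, f =1 g}].
Proof.
move=> PN NN Ih NS Ig cB gN; have BS := isoSr (@fusv w) Ig; have AS := isoSl Ig.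
have [_ ext] := satv BS.
have [M [r [Ir rE]]] := ext _ _ Ig (fcentric_fcent (@fusv w) BS (centric_v BS cB)).
have IP := iso_sub fus PN Ih.
have Nn : N' \subset nphi (Sv w) (img h P) B (h^-1 * g).
  apply/subsetP=> y yN; have : y \in h @: N by rewrite (iso_im Ih).
  case/imsetP=> x xN -> {y yN}; apply/(nphiP _ Ig).
  have /setIP[_ xNP] := subsetP NN x xN.
  split; first by rewrite inE (subsetP NS) ?(iso_mem _ Ih) // (iso_norm fus Ih PN xN).
  have [u uN e] := gN x xN; exists u => // y; rewrite -(imgE fus Ih PN).
  case/imsetP=> z zP ->; rewrite -(isoJ fus Ih (subsetP PN _ zP) xN) !permM !permK.
  exact: e.
have Irs := iso_sub (@fusv w) Nn Ir.
exists (h * r), (img r N'); split; first exact: (iso_trans fus Ih (isov_T Irs)).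
  exact: (isoSr (@fusv w) Irs).
move=> x xP; rewrite permM rE; first by rewrite permM permK.
by rewrite -(imgE fus Ih PN) imset_f.
Qed.

Lemma centric_extends P Q f : P \subset S -> fcentric S F P -> isoT P Q f -> extends S F P Q f.
Proof.
move=> PS cP If; pose N := nphi S P Q f; have QS := isoSr fus If.
have PN : P \subset N := nphi_ge fus If; have NN : N \subset 'N_S(P) := nphi_sub _ _ _ _.
have NS : N \subset S := subset_trans NN (subsetIl _ _).
have I1 := iso_id fus PS; have cQ := fcentric_iso fus If cP.
pose K := (conj_aut P @* N)%G.
have KA : K \subset AutF F P by apply: subset_trans (AutS_sub fus PS); apply: morphimS.
have KP k : k \in K -> exists2 g, g \in N & k = conj_aut P g.
  by case/morphimP=> g _ gN ->; exists g.
have gK g : g \in N -> conj_aut P g \in K.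
  by move=> gN; rewrite mem_morphim //; have /setIP[] := subsetP NN g gN.
(* A class satisfies [Ext] when some representative extends to N within the same S(v). The class of
   the inclusion does; the class of f is the goal. *)
pose Ext (A : {set V * mor gT}) := exists v h N',
  [/\ isoT N N' h, N' \subset Sv v & A = rep F Sv Fv P v h].
have [||||||v [h [N' [Ih NS' eA]]]] // := @fixed_vertex_ind _ _ _ _ _ (repT PS cP) (Rep_ends PS)
  _ K (rep_act gT V) (rep_act gT E)
  (fun k x kK => act_VV PS (subsetP KA k kK)) (fun k y kK => act_EE PS (subsetP KA k kK))
  (fun k y a b kK => act_joins PS (a := k) (subsetP KA k kK))
  (rep F Sv Fv P vstar 1) Ext _ _ _ _ (rep F Sv Fv P vstar f).
- exact: (vrep_in PS I1 PS).
- move=> k kK; have kA := subsetP KA k kK.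
  apply: (fixed_rep fus fusv PS I1 PS kA); rewrite conjg1.
  by have [g gN ->] := KP k kK; apply: (iso_conj_aut (@fusv _) PS); apply: (subsetP NN).
- by exists vstar, 1, N; split=> //; apply: iso_id.
- move=> C A B CE AV BV jAB fix3 [w [h [N' [Ih NS' eB]]]].
  have [e [D [be [Ibe DS eC]]]] := RepVP fus Se Fe PS _ CE.
  rewrite eC (Repjoins_rep PS _ _ Ibe DS) in jAB.
  have [v' [w' [v'e w'e eA eB']]] : exists v' w', [/\ incident ends e v', incident ends e w',
      A = rep F Sv Fv P v' be & B = rep F Sv Fv P w' be].
    case/orP: jAB => /andP[/eqP-> /eqP->]; [exists (ends e).1, (ends e).2 |
      exists (ends e).2, (ends e).1];
      by split=> //; rewrite ?incident1 ?incident2.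
  have IhP := iso_sub fus PN Ih.
  have hPS : img h P \subset Sv w.
    by rewrite (subset_trans _ NS') // -(iso_img Ih) img_sub.
  have DSw' := subset_trans DS (SeSv w'e); have DSv' := subset_trans DS (SeSv v'e).
  rewrite eB in eB'; have [ww Ihbe] := (rep_eqP fus fusv PS IhP hPS Ibe DSw').1 eB'.
  subst w'; have KD : K :^ be \subset AutF (Fe e) D.
    apply/subsetP=> _ /imsetP[k kK ->].
    apply: (rep_fixed fus fuse PS Ibe DS (subsetP KA k kK)).
    by rewrite -eC; case: (fix3 k kK).
  have [D1 [ch [Ich fnD1]]] := fully_normalised_ex (@fuse e) DS.
  have D1S := isoSr (@fuse e) Ich.
  have cD := fcentric_iso fus Ibe cP; have cD1 := fcentric_iso fus (isoe_T Ich) cD.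
  have fa := edge_faut D1S cD1 fnD1.
  have pK : p.-group (K :^ be)%G.
    by rewrite pgroupJ morphim_pgroup // (pgroupS NS (pSv vstar)).
  have [b bA Kb] := faut_adjust (K := (K :^ be)%G) (@fuse e) fa Ich KD pK.
  have Icb := iso_trans (@fuse e) Ich (AutF_iso D1S bA); set cb := ch * b in Icb Kb.
  have Ig := iso_trans fus Ibe (isoe_T Icb).
  have gN x : x \in N -> exists2 u, u \in 'N_(Se e)(D1) &
      {in P, forall y, (be * cb) (y ^ x) = (be * cb) y ^ u}.
    move=> xN; have : conj_aut P x ^ (be * cb) \in AutS (Se e) D1.
      by rewrite (subsetP Kb) // conjgM !memJ_conjg gK.
    case/AutSP=> u uN eu; exists u => //.
    by apply/(conj_aut_J Ig (subsetP NN x xN) _) => //; apply: (subsetP (setSI _ (SeS e))).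
  have Ihg : isov w (img h P) D1 (h^-1 * (be * cb)).
    by rewrite mulgA; apply: (iso_trans (@fusv w) Ihbe (isoe_v w'e Icb)).
  have [r [N'' [Ir _ rE]]] := extend_along PN NN Ih NS' Ihg cD1 (fun x xN =>
    let: ex_intro2 u uN e1 := gN x xN in
    ex_intro2 _ _ u (subsetP (setSI _ (SeSv w'e)) u uN) e1).
  exists v', r, N''; split=> //; last first.
    have <- : rep F Sv Fv P v' (be * cb) = rep F Sv Fv P v' r.
      by apply: rep_eq_ext => x xP; rewrite rE.
    rewrite eA.
    apply/(rep_eqP fus fusv PS Ibe DSv' Ig (subset_trans D1S (SeSv v'e))); split=> //.
    by rewrite mulKg; apply: (isoe_v v'e Icb).
  (* r x and u act alike on the centric group D1, so they differ by an element of D1. Hence r maps N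
     into S(e), and the extension passes to the other end of e. *)
  apply: subset_trans (SeSv v'e); apply/subsetP=> y yN.
  have : y \in r @: N by rewrite (iso_im Ir).
  case/imsetP=> x xN ->; have [u uN e1] := gN x xN.
  have [uS _] := setIP uN; have uT := subsetP (SeS e) u uS.
  have rS : r x \in S by rewrite (subsetP (isoSr fus Ir)) // (iso_mem _ Ir).
  have D1T := subset_trans D1S (SeS e).
  have CD : 'C_S(D1) \subset D1 := (fcentricP fus D1T).1 cD1 _ _ (iso_id fus D1T).
  rewrite -[r x](mulgKV u) groupM // (subsetP D1S) // (subsetP CD) //.
  rewrite inE groupM ?groupV //=; apply/centP=> z zD; apply/esym/commgP/conjg_fixP.
  have : z \in (be * cb) @: P by rewrite (iso_im Ig).
  case/imsetP=> y' yP ->; have /setIP[_ xNP] := subsetP NN x xN.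
  rewrite conjgM -(rE _ yP) -(isoJ fus Ir (subsetP PN _ yP) xN) rE ?memJ_norm //.
  by rewrite e1 // conjgK rE.
- exact: (vrep_in PS If QS).
- move=> k kK; have kA := subsetP KA k kK.
  apply: (fixed_rep fus fusv PS If QS kA); have [g gN ->] := KP k kK.
  have /(nphiP _ If)[gP [u uN e1]] := gN.
  rewrite (iffRL (conj_aut_J If gP uN) e1).
  exact: (iso_conj_aut (@fusv _) QS uN).
(* h has the same class as f, so a last extension inside F(vstar) replaces h by an extension of f
   itself. *)
have IhP := iso_sub fus PN Ih.
have hPS : img h P \subset Sv v by rewrite (subset_trans _ NS') // -(iso_img Ih) img_sub.
have [vv Ihf] := (rep_eqP fus fusv PS IhP hPS If QS).1 (esym eA).
subst v; have [r [N'' [Ir _ rE]]] := extend_along PN NN Ih NS' Ihf cQ (fun x xN =>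
  let: conj _ e1 := elimT (nphiP x If) xN in e1).
by exists N'', r.
Qed.

Theorem centric_sat P : P \subset S -> fcentric S F P -> sat_at S F p P.
Proof.
move=> PS cP; split=> [fnP|Q f If _]; first exact: centric_fnorm.
exact: (centric_extends (isoSl If) (fcentric_iso fus (iso_inv fus If) cP) If).
Qed.

End Tree.

(** * Generation by centric subgroups and saturation of the completion *)

Section Generation.
Variables (gT : finGroupType) (C : {group gT} -> Prop).
Variables (S : {group gT}) (F : {set gT} -> {set mor gT}).
Hypothesis fus : is_fusion S F.
Hypothesis C_iso : forall P Q f, iso S F P Q f -> C P -> C Q.
Hypothesis CS : C S.

Lemma gen_mono (S' : {group gT}) F' : (forall P Q f, iso S' F' P Q f -> iso S F P Q f) ->
  forall P Q f, gen C S' F' P Q f -> gen C S F P Q f.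
Proof.
move=> mono P Q f; elim=> {P Q f} [P Q R R' f CR If|P Q R f g _ g1 _|P Q f g fg _].
- exact: gen_base CR (mono _ _ _ If).
- exact: gen_comp g1.
exact: gen_ext fg.
Qed.

(** The generated morphisms as a fusion system; once it contains every F(v), it contains the
    completion. *)
Definition gen_homs (A : {set gT}) : {set mor gT} :=
  [set m | asbool (exists (P Q : {group gT}) (f : {perm gT}),
    [/\ A = P, gen C S F P Q f & m = restr A f])].

Lemma gen_homsP (P : {group gT}) m :
  reflect (exists Q f, gen C S F P Q f /\ m = restr P f) (m \in gen_homs P).
Proof.
rewrite [_ \in gen_homs _]inE; apply: (iffP (asboolP _)) => [[P' [Q [f [eP gf ->]]]]|].
  by exists Q, f; have -> : P = P' by apply: val_inj.
by case=> Q [f [gf ->]]; exists P, Q, f.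
Qed.

Lemma gen_homs_fusion : is_fusion S gen_homs.
Proof.
move=> P PS; split=> [g gS|m|Q a b QS|a].
- apply/gen_homsP; exists (P :^ g)%G, (cj g); split.
    exact: gen_base CS (iso_cj fus (subxx S) gS) PS (cj_im g P).
  by apply: eq_restr => x _; rewrite cjE.
- case/gen_homsP=> Q [f [gf ->]]; exact: (iso_injhom fus (gen_iso fus gf)).
- rewrite inE => /andP[/gen_homsP[P1 [f [gf ->]]]]; have If := gen_iso fus gf.
  rewrite restr_im // => fPQ /gen_homsP[Q1 [g [gg ->]]].
  rewrite comp_restr //; have P1Q : P1 \subset Q by rewrite -(iso_im If).
  apply/gen_homsP; exists (img g P1), (f * g); split.
    by apply: gen_comp gf (gen_sub fus P1Q (imgE fus (gen_iso fus gg) P1Q) gg).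
  by apply: eq_restr => x _; rewrite /= permM.
case/gen_homsP=> Q [f [gf ->]]; have If := gen_iso fus gf.
rewrite restr_im // (iso_im If); exists (restr Q f^-1).
  by apply/gen_homsP; exists P, f^-1; split=> //; apply: (gen_inv fus C_iso gf).
by move=> x xP; rewrite !restrE ?(iso_mem _ If) // permK.
Qed.

End Generation.

Theorem theoremB (gT : finGroupType) (p : nat) (V E : finType) (ends : E -> V * V)
    (Sv : V -> {group gT}) (Se : E -> {group gT})
    (Fv : V -> {set gT} -> {set mor gT}) (Fe : E -> {set gT} -> {set mor gT})
    (vstar : V) :
  prime p ->
  (* the underlying graph is a finite tree *)
  is_tree [set: V] [set: E] (tjoins ends) ->
  (* finite p-groups, all inside S = S(vstar), structure maps are inclusions *)
  (forall v, (p.-group (Sv v))%g) ->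
  (forall e, (p.-group (Se e))%g) ->
  (forall v, Sv v \subset Sv vstar) ->
  (forall e v, incident ends e v -> Se e \subset Sv v) ->
  (* fusion systems; F(e) -> F(v) are (inclusion) morphisms of fusion systems *)
  (forall v, is_fusion (Sv v) (Fv v)) ->
  (forall e, is_fusion (Se e) (Fe e)) ->
  (forall e v (P : {group gT}), incident ends e v -> P \subset Se e ->
     Fe e P \subset Fv v P) ->
  (* hypothesis (H) *)
  (forall v, v != vstar -> forall e w s,
     path_starting (tjoins ends) v e w s vstar -> Se e = Sv v) ->
  (* each F(v) is saturated *)
  (forall v, saturated p (Sv v) (Fv v)) ->
  (* (a) *)
  (forall P : {group gT}, P \subset Sv vstar ->
     ((exists v (Q : {group gT}), Q \subset Sv v /\ fessential p (Sv v) (Fv v) Q /\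
          fconj (completion Sv Fv (Sv vstar)) Q P)
      \/ (exists v, P = Sv v)) ->
     fcentric (Sv vstar) (completion Sv Fv (Sv vstar)) P) ->
  (* (b) *)
  (forall P : {group gT}, P \subset Sv vstar ->
     fcentric (Sv vstar) (completion Sv Fv (Sv vstar)) P ->
     Rep_is_tree ends Sv Se Fv Fe (completion Sv Fv (Sv vstar)) P) ->
  saturated p (Sv vstar) (completion Sv Fv (Sv vstar)).
Proof.
move=> p_pr treeT pSv pSe SvS SeSv fusv fuse FeFv hypH sat hypa hypb.
set S := Sv vstar; set F := completion Sv Fv S.
have satv v (P : {group gT}) : P \subset Sv v -> sat_at (Sv v) (Fv v) p P.
  by have [_ h] := (saturatedP _ _ _).1 (sat v); apply: h.
pose Gens (P : {set gT}) := \bigcup_(v | P \subset Sv v) Fv v P.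
have genI (Q : {group gT}) m : m \in Gens Q -> injhom Q S m.
  case/bigcupP=> v QS /(iso_mor (fusv v) QS)[R [f [If ->]]].
  have /and4P[h1 h2 h3 h4] := iso_injhom (fusv v) If.
  by apply/and4P; split=> //; apply: subset_trans h4 (SvS v).
have fus : is_fusion S F := generated_fusion genI.
have FvF v (P : {group gT}) : P \subset Sv v -> Fv v P \subset F P.
  move=> PS; apply: subset_trans (gens_generated S Gens P).
  exact: (bigcup_sup v).
have isov_T v P Q f : iso (Sv v) (Fv v) P Q f -> iso S F P Q f.
  case=> PS fF fP; split=> //; first exact: subset_trans PS (SvS v).
  exact: (subsetP (FvF _ _ PS)).
have C_iso (P Q : {group gT}) f : iso S F P Q f -> fcentric S F P -> fcentric S F Q.
  exact: fcentric_iso.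
have CSv v : fcentric S F (Sv v) by apply: hypa => //; right; exists v.
(* Condition (a) says that S(v) and the F(v)-essential subgroups are centric in the completion, as
   [alperin] requires. *)
have genv v P Q f : iso (Sv v) (Fv v) P Q f -> gen (fcentric S F) (Sv v) (Fv v) P Q f.
  apply: (alperin p_pr (pSv v) (@fusv v) (@satv v)) => //.
    by move=> P' Q' f' /isov_T; apply: C_iso.
  move=> R RS eR; have RS' := subset_trans RS (SvS v).
  apply: hypa => //; left; exists v, R; split=> //; split=> //.
  by apply/(fconjP fus _ RS'); exists 1; apply: iso_id.
have genF P Q f : iso S F P Q f -> gen (fcentric S F) S F P Q f.
  move=> If; have [PS fF fP] := If.
  have fG := gen_homs_fusion fus C_iso (CSv vstar).
  have : restr P f \in gen_homs (fcentric S F) S F P.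
    move/fusion_generatedP: fF; apply=> // R; apply/bigcupsP=> v RS.
    apply/subsetP=> m mF.
    have [R' [g [Ig ->]]] := iso_mor (fusv v) RS mF.
    apply/gen_homsP; exists R', g; split=> //.
    exact: (gen_mono (@isov_T v) (genv v _ _ _ Ig)).
  case/gen_homsP=> R [g [gg e]].
  have fg : {in P, g =1 f}.
    by move=> x xP; have := congr1 (fun k : mor gT => k x) e; rewrite !restrE.
  have -> : Q = R; last exact: gen_ext fg gg.
  apply: val_inj; rewrite /= -(iso_im If) -(iso_im (gen_iso fus gg)).
  by apply: eq_in_imset => x /fg.
apply/saturatedP; split=> // P.
(* Descending induction on |P|, as the noncentric case uses saturation at all larger subgroups. *)
move: {2}(#|S| - #|P|).+1 (ltnSn (#|S| - #|P|)) => n.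
elim: n P => // n IHn P ltn PS.
have [cP|ncP] := classic (fcentric S F P).
  exact: (centric_sat (E := E) (ends := ends) (Se := Se) (Fe := Fe) (Fv := Fv)).
apply: (noncentric_sat (pSv vstar) fus (n := #|P|)) => // R RS lt.
apply: IHn => //; rewrite ltnS in ltn; apply: leq_trans ltn.
by apply: ltn_sub2l => //; apply: leq_trans lt (subset_leq_card RS).
Qed.
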